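(* Let $p$ be an odd prime and let $\alpha \in \mathbb{Q}_p$ have infinite $p$-adic continued fraction expansion $\alpha = [0, b_1, b_2, \ldots]$ (of Browkin type or of Ruban type), with convergents $A_n/B_n$. Suppose that the sequence $(b_n)_{n \geq 1}$ begins with arbitrarily long palindromes, i.e. for infinitely many $n$ the word $(b_1, \ldots, b_n)$ satisfies $b_j = b_{n+1-j}$ for $1 \le j \le n$. If \[ \max\left(|A_n|_\infty^{1/n}, |B_n|_\infty^{1/n}\right) < p^{1/4} \quad \text{for all sufficiently large } n, \] then $\alpha$ is either transcendental or a quadratic irrational.
   Context: $|\cdot|_\infty$ denotes the usual (Archimedean) absolute value and $|\cdot|_p$ the $p$-adic absolute value, $|x|_p = p^{-v_p(x)}$. $p$-adic continued fractions: write $\beta = \sum_{i \ge r} a_i p^i \in \mathbb{Q}_p$ with digits $a_i \in \{-\tfrac{p-1}{2}, \ldots, \tfrac{p-1}{2}\}$ (Browkin) or $a_i \in \{0, \ldots, p-1\}$ (Ruban), and set $s(\beta) = \sum_{i=r}^{0} a_i p^i \in \mathbb{Q}$ (empty sum $=0$ if $r>0$). For $\alpha_0 = \alpha$, the partial quotients are $b_i = s(\alpha_i)$, $\alpha_{i+1} = 1/(\alpha_i - b_i)$, and one writes $\alpha = [b_0, b_1, \ldots]$. The numerators and denominators of convergents are defined by $A_{-2}=0$, $A_{-1}=1$, $A_i = b_i A_{i-1} + A_{i-2}$ and $B_{-2}=1$, $B_{-1}=0$, $B_i = b_i B_{i-1} + B_{i-2}$ for $i \ge 0$; they are elements of $\mathbb{Z}[1/p]$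 and $A_i/B_i = [b_0, \ldots, b_i]$. *)

(* Defs.v *)
From HB Require Import structures.
From mathcomp Require Import all_boot all_order all_algebra.
From mathcomp Require Import generic_quotient ring_quotient.
From mathcomp Require Import mathcomp_extra boolp classical_sets functions filter.
From mathcomp Require Import reals exp.
From mathcomp Require Import ring.
Set Implicit Arguments.
Unset Strict Implicit.
Unset Printing Implicit Defensive.
Import Order.TTheory GRing.Theory Num.Theory.
Local Open Scope classical_set_scope.
Local Open Scope ring_scope.
Local Open Scope quotient_scope.

Section PadicAbs.
Variable p : nat.

Definition padic_val (x : rat) : int :=
  (logn p `|numq x|)%:Z - (logn p `|denq x|)%:Z.

Definition padic_abs (x : rat) : rat :=
  if x == 0 then 0 else (p%:R : rat) ^ (- padic_val x).

Definition padic_cauchy (u : nat -> rat) : Prop :=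
  forall e : rat, 0 < e -> exists N : nat, forall m n : nat,
    (N <= m)%N -> (N <= n)%N -> padic_abs (u m - u n) < e.

Definition padic_null (u : nat -> rat) : Prop :=
  forall e : rat, 0 < e -> exists N : nat, forall n : nat,
    (N <= n)%N -> padic_abs (u n) < e.

Hypothesis p_pr : prime p.

Let p_gt0 : (0 : rat) < p%:R.
Proof. by rewrite ltr0n prime_gt0. Qed.

Let p_neq0 : (p%:R : rat) != 0.
Proof. by rewrite gt_eqF. Qed.

Lemma padic_val_frac (a b : int) : a != 0 -> b != 0 ->
  padic_val (a%:~R / b%:~R) = (logn p `|a|)%:Z - (logn p `|b|)%:Z.
Proof.
move=> a0 b0; rewrite /padic_val.
set x := a%:~R / b%:~R.
have x0 : x != 0 by rewrite mulf_neq0 ?invr_eq0 ?intr_eq0.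
have n0 : (0 < `|numq x|)%N by rewrite absz_gt0 numq_eq0.
have d0 : (0 < `|denq x|)%N by rewrite absz_gt0 denq_neq0.
have E : numq x * b = a * denq x.
  apply: (@intr_inj rat); rewrite !rmorphM/= numqE /x mulrAC.
  by rewrite divfK// intr_eq0.
have : (logn p `|(numq x * b)%R| = logn p `|(a * denq x)%R|)%N by rewrite E.
rewrite !abszM !lognM ?absz_gt0 ?numq_eq0 ?denq_neq0// => {}E.
apply/eqP; rewrite subr_eq addrAC eq_sym subr_eq -!PoszD; apply/eqP.
by rewrite E.
Qed.

Lemma padic_abs0 : padic_abs 0 = 0.
Proof. by rewrite /padic_abs eqxx. Qed.

Lemma padic_abs_ge0 x : 0 <= padic_abs x.
Proof. by rewrite /padic_abs; case: ifP => // _; apply: exprz_ge0; rewrite ler0n. Qed.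

Lemma padic_abs_eq0 x : (padic_abs x == 0) = (x == 0).
Proof.
rewrite /padic_abs; case: ifP => [|_]; first by rewrite eqxx.
by apply/negbTE; rewrite expfz_neq0.
Qed.

Lemma padic_absM x y : padic_abs (x * y) = padic_abs x * padic_abs y.
Proof.
rewrite /padic_abs mulf_eq0; have [->|x0] := eqVneq x 0; first by rewrite /= !mul0r.
have [->|y0] := eqVneq y 0; first by rewrite orbT mulr0.
rewrite /= -expfzDr//; congr (_ ^ _).
have -> : x * y = (numq x * numq y)%:~R / (denq x * denq y)%:~R.
  by rewrite !rmorphM/= -mulf_div !divq_num_den.
rewrite padic_val_frac ?mulf_neq0 ?numq_eq0 ?denq_neq0//.
rewrite !abszM !lognM ?absz_gt0 ?numq_eq0 ?denq_neq0//.
by rewrite /padic_val -opprD !PoszD; congr (- _); rewrite opprD addrACA.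
Qed.

Lemma padic_abs1 : padic_abs 1 = 1.
Proof. by rewrite /padic_abs oner_eq0 /padic_val subrr. Qed.

Lemma padic_absN x : padic_abs (- x) = padic_abs x.
Proof.
by rewrite /padic_abs oppr_eq0 /padic_val numqN denqN abszN.
Qed.

Lemma padic_absB x y : padic_abs (x - y) = padic_abs (y - x).
Proof. by rewrite -padic_absN opprB. Qed.

Lemma padic_absV x : padic_abs x^-1 = (padic_abs x)^-1.
Proof.
have [->|x0] := eqVneq x 0; first by rewrite !(invr0, padic_abs0).
apply: (mulfI (x := padic_abs x)); first by rewrite padic_abs_eq0.
by rewrite -padic_absM !mulfV ?padic_abs_eq0// padic_abs1.
Qed.

Lemma padic_abs_int (a : int) : a != 0 ->
  padic_abs a%:~R = (p%:R : rat) ^- logn p `|a|.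
Proof.
move=> a0; rewrite /padic_abs intr_eq0 (negbTE a0).
have -> : a%:~R = a%:~R / (1%:Z)%:~R :> rat by rewrite divr1.
rewrite padic_val_frac// logn1 subr0.
by rewrite exprnN.
Qed.

Let padic_abs_intD (a b : int) :
  padic_abs (a + b)%:~R <= Num.max (padic_abs a%:~R) (padic_abs b%:~R).
Proof.
have [->|a0] := eqVneq a 0; first by rewrite add0r le_max lexx orbT.
have [->|b0] := eqVneq b 0; first by rewrite addr0 le_max lexx.
have [->|ab0] := eqVneq (a + b) 0.
  by rewrite padic_abs0 le_max padic_abs_ge0.
rewrite !padic_abs_int// le_max.
have mono m n : ((p%:R : rat) ^- m <= p%:R ^- n) = (n <= m)%N.
  rewrite lef_pV2 ?posrE ?exprn_gt0// ler_eXn2l//.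
  by rewrite ltr1n prime_gt1.
rewrite !mono -!pfactor_dvdn ?absz_gt0//.
have dvdD k : (k <= logn p `|a|)%N -> (k <= logn p `|b|)%N ->
    (p ^ k %| `|(a + b)%R|)%N.
  move=> ka kb; suff : ((p ^ k)%N%:Z %| a + b)%Z by rewrite dvdzE.
  by rewrite rpredD// dvdzE/= pfactor_dvdn ?absz_gt0.
have [le|le] := leqP (logn p `|a|) (logn p `|b|); apply/orP; [left|right].
  exact: dvdD.
by apply: dvdD => //; exact: ltnW.
Qed.

Lemma padic_absD x y :
  padic_abs (x + y) <= Num.max (padic_abs x) (padic_abs y).
Proof.
have d0 z : ((denq z)%:~R : rat) != 0 by rewrite intr_eq0 denq_neq0.
set d : rat := (denq x)%:~R * (denq y)%:~R.
have dx : x = (numq x * denq y)%:~R / d.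
  by rewrite rmorphM/= -mulf_div divff// mulr1 divq_num_den.
have dy : y = (numq y * denq x)%:~R / d.
  by rewrite rmorphM/= /d (mulrC (denq x)%:~R) -mulf_div divff// mulr1 divq_num_den.
set a := numq x * denq y in dx; set b := numq y * denq x in dy.
clearbody a b d; subst x y.
rewrite -mulrDl -rmorphD/= !padic_absM.
by rewrite -maxr_pMl ?padic_abs_ge0// ler_wpM2r ?padic_abs_ge0.
Qed.

Lemma padic_absD_lt x y e :
  padic_abs x < e -> padic_abs y < e -> padic_abs (x + y) < e.
Proof.
by move=> xe ye; apply: le_lt_trans (padic_absD x y) _; rewrite gt_max xe.
Qed.

Lemma padic_cauchy_bounded u : padic_cauchy u ->
  exists2 M : rat, 0 < M & forall n, padic_abs (u n) <= M.
Proof.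
move=> /(_ 1 ltr01)[N Nu].
have [M M0 MN] : exists2 M : rat, 1 <= M &
    forall n, (n <= N)%N -> padic_abs (u n) <= M.
  elim: N {Nu} => [|N [M M1 MN]].
    exists (Num.max 1 (padic_abs (u 0))); first by rewrite le_max lexx.
    by move=> n; rewrite leqn0 => /eqP ->; rewrite le_max lexx orbT.
  exists (Num.max M (padic_abs (u N.+1))); first by rewrite le_max M1.
  move=> n; rewrite leq_eqVlt => /predU1P[->|nN]; first by rewrite le_max lexx orbT.
  by rewrite le_max MN.
exists M => [|n]; first exact: lt_le_trans M0.
have [nN|Nn] := leqP n N; first exact: MN.
rewrite -(subrK (u N) (u n)); apply: le_trans (padic_absD _ _) _.
rewrite ge_max MN// andbT (le_trans (ltW _) M0)//.
by apply: Nu => //; exact: ltnW.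
Qed.

Lemma padic_cauchy_away u : padic_cauchy u -> ~ padic_null u ->
  exists c, exists2 N : nat, 0 < c & forall n, (N <= n)%N -> padic_abs (u n) = c.
Proof.
move=> cu nu.
have [e [e0 He]] : exists e : rat, 0 < e /\
    forall N, exists2 n, (N <= n)%N & e <= padic_abs (u n).
  apply: contrapT => H; apply: nu => e e0.
  apply: contrapT => H'; apply: H; exists e; split => // N.
  apply: contrapT => H''; apply: H'; exists N => n Nn.
  by rewrite ltNge; apply/negP => eu; apply: H''; exists n.
have [N HN] := cu e e0.
have [m Nm em] := He N.
exists (padic_abs (u m)), N; first exact: lt_le_trans em.
move=> n Nn; have mn := lt_le_trans (HN m n Nm Nn) em.
have nm : padic_abs (u n) <= padic_abs (u m).
  rewrite -(subrK (u m) (u n)); apply: le_trans (padic_absD _ _) _.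
  by rewrite ge_max lexx andbT padic_absB ltW.
apply/eqP; rewrite eq_le nm/=.
have := padic_absD (u m - u n) (u n); rewrite subrK le_max.
by rewrite leNgt mn.
Qed.

End PadicAbs.

Section PadicField.
Variables (p : nat) (p_pr : prime p).

Definition padic_cauchy_pred of prime p : {pred nat -> rat} :=
  fun u => `[< padic_cauchy p u >].

Local Notation C := (padic_cauchy_pred p_pr).

Fact padic_cauchy_subring : subring_closed C.
Proof.
split.
- apply/asboolP => e e0; exists 0%N => m n _ _.
  by rewrite [X in padic_abs p X]subrr padic_abs0.
- move=> u v /asboolP cu /asboolP cv; apply/asboolP => e e0.
  have [N Nu] := cu e e0; have [M Mv] := cv e e0.
  exists (maxn N M) => m n; rewrite !geq_max => /andP[Nm Mm] /andP[Nn Mn].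
  have -> : (u - v) m - (u - v) n = (u m - u n) + (v n - v m).
    by rewrite !fctE; ring.
  by apply: padic_absD_lt => //; [exact: Nu|exact: Mv].
- move=> u v /asboolP cu /asboolP cv; apply/asboolP => e e0.
  have [A A0 Au] := padic_cauchy_bounded p_pr cu.
  have [B B0 Bv] := padic_cauchy_bounded p_pr cv.
  have [N Nu] := cu (e / B) (divr_gt0 e0 B0).
  have [M Mv] := cv (e / A) (divr_gt0 e0 A0).
  exists (maxn N M) => m n; rewrite !geq_max => /andP[Nm Mm] /andP[Nn Mn].
  have -> : (u * v) m - (u * v) n = (u m - u n) * v m + u n * (v m - v n).
    by rewrite !fctE mulrBl mulrBr subrKA.
  apply: padic_absD_lt => //; rewrite padic_absM//.
    apply: le_lt_trans (_ : _ <= padic_abs p (u m - u n) * B) _.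
      by rewrite ler_wpM2l ?padic_abs_ge0.
    by rewrite -ltr_pdivlMr// Nu.
  apply: le_lt_trans (_ : _ <= A * padic_abs p (v m - v n)) _.
    by rewrite ler_wpM2r ?padic_abs_ge0.
  by rewrite mulrC -ltr_pdivlMr// Mv.
Qed.

HB.instance Definition _ := GRing.isSubringClosed.Build (nat -> rat)
  (padic_cauchy_pred p_pr) padic_cauchy_subring.

Definition padic_cauchy_seq := {u : nat -> rat | C u}.
HB.instance Definition _ := SubChoice.on padic_cauchy_seq.
HB.instance Definition _ :=
  [SubChoice_isSubComNzRing of padic_cauchy_seq by <:].

Lemma padic_cauchy_seqP (u : padic_cauchy_seq) : padic_cauchy p (val u).
Proof. exact/asboolP/(valP u). Qed.

Definition padic_null_pred : {pred padic_cauchy_seq} :=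
  fun u => `[< padic_null p (val u) >].

Fact padic_null_ideal : idealr_closed padic_null_pred.
Proof.
split.
- apply/asboolP => e e0; exists 0%N => n _.
  by rewrite [X in padic_abs p X](_ : _ = 0)// padic_abs0.
- apply/negP => /asboolP /(_ 1 ltr01)[N /(_ N (leqnn N))].
  by rewrite [X in padic_abs p X](_ : _ = 1)// padic_abs1 ltxx.
- move=> a u v /asboolP nu /asboolP nv; apply/asboolP => e e0.
  have [A A0 Aa] := padic_cauchy_bounded p_pr (padic_cauchy_seqP a).
  have [N Nu] := nu (e / A) (divr_gt0 e0 A0).
  have [M Mv] := nv e e0.
  exists (maxn N M) => n; rewrite geq_max => /andP[Nn Mn].
  rewrite [X in padic_abs p X](_ : _ = val a n * val u n + val v n)//.
  apply: padic_absD_lt => //; last exact: Mv.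
  rewrite padic_absM//.
  apply: le_lt_trans (_ : _ <= A * padic_abs p (val u n)) _.
    by rewrite ler_wpM2r ?padic_abs_ge0.
  by rewrite mulrC -ltr_pdivlMr// Nu.
Qed.

HB.instance Definition _ :=
  isIdealr.Build padic_cauchy_seq padic_null_pred padic_null_ideal.

(* The completion of rat for padic_abs: Cauchy sequences modulo null sequences;
   see Qp_dense and Qp_complete below. *)
Definition Qp := {ideal_quot padic_null_pred}.
HB.instance Definition _ := GRing.ComNzRing.on Qp.

Lemma pi_Qp_eq0 (u : padic_cauchy_seq) :
  (\pi_Qp u == 0 :> Qp) = `[< padic_null p (val u) >].
Proof.
have -> : 0 = \pi_Qp 0 :> Qp by rewrite rmorph0.
by rewrite -Quotient.idealrBE subr0.
Qed.

Lemma Qp_inv_exists (x : Qp) : x != 0 -> exists y : Qp, y * x = 1.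
Proof.
elim/quotW: x => u; rewrite pi_Qp_eq0 => /asboolPn nu.
have cu := padic_cauchy_seqP u.
have [c [N c0 uc]] := padic_cauchy_away p_pr cu nu.
have u0 n : (N <= n)%N -> val u n != 0.
  by move=> /uc unc; rewrite -(padic_abs_eq0 p_pr) unc gt_eqF.
pose v n := (val u n)^-1.
have cv : C v.
  apply/asboolP => e e0.
  have [M Mu] := cu (e * (c * c)) (mulr_gt0 e0 (mulr_gt0 c0 c0)).
  exists (maxn N M) => m n; rewrite !geq_max => /andP[Nm Mm] /andP[Nn Mn].
  have -> : v m - v n = (val u n - val u m) / (val u m * val u n).
    by rewrite /v; field; rewrite !u0.
  rewrite padic_absM// padic_absV// padic_absM// !uc//.
  by rewrite ltr_pdivrMr ?mulr_gt0// Mu.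
exists (\pi_Qp (exist _ v cv : padic_cauchy_seq)).
rewrite -rmorphM -(rmorph1 \pi_Qp); apply/eqP; rewrite -Quotient.idealrBE.
apply/asboolP => e e0; exists N => n Nn.
rewrite [X in padic_abs p X](_ : _ = v n * val u n - 1)//.
by rewrite /v mulVf ?u0// subrr padic_abs0.
Qed.

Definition Qp_inv (x : Qp) : Qp :=
  if x == 0 then 0 else xget 0 [set y | y * x = 1].

Fact Qp_mulVf (x : Qp) : x != 0 -> Qp_inv x * x = 1.
Proof.
move=> x0; rewrite /Qp_inv (negbTE x0).
by case: xgetP => // /(_ _)/= H; have [y /H] := Qp_inv_exists x0.
Qed.

Fact Qp_inv0 : Qp_inv 0 = 0.
Proof. by rewrite /Qp_inv eqxx. Qed.

HB.instance Definition _ := GRing.ComNzRing_isField.Build Qp Qp_mulVf Qp_inv0.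

Definition padic_abs_lim (u : nat -> rat) (l : rat) : Prop :=
  forall e : rat, 0 < e -> exists N : nat, forall n : nat,
    (N <= n)%N -> `|padic_abs p (u n) - l| < e.

(* The limit of |x_n|_p for any sequence x_n representing x (Qp_abs_piE). *)
Definition Qp_abs (x : Qp) : rat :=
  xget 0 [set l | padic_abs_lim (val (repr x)) l].

Let lim_const u c : (exists N : nat, forall n, (N <= n)%N ->
  padic_abs p (u n) = c) -> padic_abs_lim u c.
Proof.
by move=> [N H] e e0; exists N => n /H ->; rewrite subrr normr0.
Qed.

Let lim_uniq u l l' : padic_abs_lim u l -> padic_abs_lim u l' -> l = l'.
Proof.
move=> ul ul'; apply/eqP/contraT => ll'.
have e0 : 0 < `|l - l'| / 2 by rewrite divr_gt0// normr_gt0 subr_eq0.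
have [N H] := ul _ e0; have [M K] := ul' _ e0.
have := ltrD (H _ (leq_maxl N M)) (K _ (leq_maxr N M)).
rewrite -splitr distrC => /(le_lt_trans (ler_distD (padic_abs p (u (maxn N M))) l l')).
by rewrite ltxx.
Qed.

Lemma Qp_abs_piE (u : padic_cauchy_seq) l :
  padic_abs_lim (val u) l -> Qp_abs (\pi_Qp u) = l.
Proof.
move=> ul; set x := \pi_Qp u.
have rl : padic_abs_lim (val (repr x)) l.
  have /asboolP nx : repr x - u \in padic_null_pred.
    by rewrite Quotient.idealrBE; apply/eqP; rewrite reprK.
  have {}nx : padic_null p (fun n => val (repr x) n - val u n) := nx.
  move=> e e0; have e2 : 0 < e / 2 by rewrite divr_gt0.
  have [N H] := ul _ e2; have [M K] := nx _ e2.
  exists (maxn N M) => n; rewrite geq_max => /andP[Nn Mn].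
  rewrite -(subrKA (padic_abs p (val u n))); apply: le_lt_trans (ler_normD _ _) _.
  rewrite [e]splitr ltrD ?H//; apply: le_lt_trans (K _ Mn).
  have sub a b : padic_abs p a <= padic_abs p b + padic_abs p (a - b).
    rewrite -{1}(subrK b a) addrC; apply: le_trans (padic_absD _ _ _) _ => //.
    by rewrite ge_max lerDl lerDr !padic_abs_ge0.
  rewrite ler_norml lerBlDl lerNl opprB lerBlDl sub andbT.
  by rewrite padic_absB sub.
by rewrite /Qp_abs; case: xgetP => [y _ yl|/(_ l)//]; exact: lim_uniq yl rl.
Qed.

Let Qp_abs_cases (u : padic_cauchy_seq) :
  (\pi_Qp u = 0 :> Qp /\ padic_null p (val u)) \/
  exists2 c, 0 < c & exists N : nat, forall n, (N <= n)%N ->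
    padic_abs p (val u n) = c.
Proof.
have [nu|nu] := pselect (padic_null p (val u)).
  by left; split => //; apply/eqP; rewrite pi_Qp_eq0; apply/asboolP.
right; have [c [N c0 H]] := padic_cauchy_away p_pr (padic_cauchy_seqP u) nu.
by exists c => //; exists N.
Qed.

Lemma Qp_abs0 : Qp_abs 0 = 0.
Proof.
rewrite -(rmorph0 \pi_Qp); apply: Qp_abs_piE; apply: lim_const.
by exists 0%N => n _; exact: padic_abs0.
Qed.

Lemma Qp_abs_eq0 x : (Qp_abs x == 0) = (x == 0).
Proof.
apply/eqP/eqP => [|->]; last exact: Qp_abs0.
elim/quotW: x => u; have [[-> //]|[c c0 H]] := Qp_abs_cases u.
by rewrite (Qp_abs_piE (lim_const H)) => c00; rewrite c00 ltxx in c0.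
Qed.

Lemma Qp_abs_ge0 x : 0 <= Qp_abs x.
Proof.
elim/quotW: x => u; have [[-> _]|[c c0 H]] := Qp_abs_cases u.
  by rewrite Qp_abs0.
by rewrite (Qp_abs_piE (lim_const H)) ltW.
Qed.

Lemma Qp_absM x y : Qp_abs (x * y) = Qp_abs x * Qp_abs y.
Proof.
elim/quotW: x => u; elim/quotW: y => v.
have [[-> _]|[c c0 H]] := Qp_abs_cases u; first by rewrite mul0r Qp_abs0 mul0r.
have [[-> _]|[d d0 K]] := Qp_abs_cases v; first by rewrite mulr0 Qp_abs0 mulr0.
rewrite -rmorphM (Qp_abs_piE (lim_const H)) (Qp_abs_piE (lim_const K)).
apply: Qp_abs_piE; apply: lim_const; move: H K => [N H] [M K].
exists (maxn N M) => n; rewrite geq_max => /andP[/H <- /K <-].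
by rewrite -padic_absM.
Qed.

Lemma Qp_absD x y : Qp_abs (x + y) <= Num.max (Qp_abs x) (Qp_abs y).
Proof.
elim/quotW: x => u; elim/quotW: y => v.
have [[-> _]|[c c0 H]] := Qp_abs_cases u; first by rewrite add0r le_max lexx orbT.
have [[-> _]|[d d0 K]] := Qp_abs_cases v; first by rewrite addr0 le_max lexx.
rewrite (_ : \pi_Qp u + \pi_Qp v = \pi_Qp (u + v)); last by rewrite rmorphD.
rewrite (Qp_abs_piE (lim_const H)) (Qp_abs_piE (lim_const K)).
have [[-> _]|[e e0 L]] := Qp_abs_cases (u + v).
  by rewrite Qp_abs0 le_max (ltW c0).
rewrite (Qp_abs_piE (lim_const L)).
move: H K L => [N H] [M K] [P L].
pose n := maxn N (maxn M P).
rewrite -(H n) ?leq_maxl// -(K n) ?leq_max ?leqnn ?orbT//.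
by rewrite -(L n) ?leq_max ?leqnn ?orbT//; exact: padic_absD.
Qed.

Fact Qp_of_rat_subproof (q : rat) : C (fun=> q).
Proof.
by apply/asboolP => e e0; exists 0%N => m n _ _; rewrite subrr padic_abs0.
Qed.

Definition padic_cst_seq (q : rat) : padic_cauchy_seq := exist _ (fun=> q) (Qp_of_rat_subproof q).

Definition Qp_of_rat (q : rat) : Qp := \pi_Qp (padic_cst_seq q).

Let Qp_of_ratM : monoid_morphism Qp_of_rat.
Proof.
split=> [|x y].
  by rewrite -(rmorph1 \pi_Qp); congr (\pi_Qp _); exact: val_inj.
by rewrite -rmorphM; congr (\pi_Qp _); exact: val_inj.
Qed.

Let Qp_of_ratB : zmod_morphism Qp_of_rat.
Proof. by move=> x y; rewrite -rmorphB; congr (\pi_Qp _); exact: val_inj. Qed.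

HB.instance Definition _ :=
  GRing.isZmodMorphism.Build rat Qp Qp_of_rat Qp_of_ratB.
HB.instance Definition _ :=
  GRing.isMonoidMorphism.Build rat Qp Qp_of_rat Qp_of_ratM.

Lemma Qp_ratrE q : ratr q = Qp_of_rat q.
Proof. by rewrite -(fmorph_eq_rat Qp_of_rat). Qed.

Lemma Qp_abs_ratr (q : rat) : Qp_abs (ratr q) = padic_abs p q.
Proof.
rewrite Qp_ratrE; apply: Qp_abs_piE; apply: lim_const.
by exists 0%N.
Qed.

Lemma Qp_dense (x : Qp) (e : rat) : 0 < e ->
  exists q : rat, Qp_abs (x - ratr q) < e.
Proof.
move=> e0; elim/quotW: x => u; have [N H] := padic_cauchy_seqP u e0.
exists (val u N); rewrite Qp_ratrE.
rewrite (_ : _ - _ = \pi_Qp (u - padic_cst_seq (val u N))); last by rewrite rmorphB.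
have [[-> _]|[c c0 K]] := Qp_abs_cases (u - padic_cst_seq (val u N)).
  by rewrite Qp_abs0.
rewrite (Qp_abs_piE (lim_const K)); move: K => [M K]; rewrite -(K _ (leq_maxr N M)).
by apply: H => //; exact: leq_maxl.
Qed.

Definition Qp_cvg (u : nat -> Qp) (l : Qp) : Prop :=
  forall e : rat, 0 < e -> exists N : nat, forall n : nat,
    (N <= n)%N -> Qp_abs (u n - l) < e.

Lemma Qp_absB x y : Qp_abs (x - y) = Qp_abs (y - x).
Proof.
rewrite -opprB -mulN1r Qp_absM.
by rewrite -(rmorphN1 Qp_of_rat) -[X in Qp_abs X]Qp_ratrE Qp_abs_ratr padic_absN padic_abs1 mul1r.
Qed.

Lemma Qp_complete (u : nat -> Qp) :
  (forall e : rat, 0 < e -> exists N : nat, forall m n : nat,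
     (N <= m)%N -> (N <= n)%N -> Qp_abs (u m - u n) < e) ->
  exists l, Qp_cvg u l.
Proof.
move=> cu.
have ltD x y e : Qp_abs x < e -> Qp_abs y < e -> Qp_abs (x + y) < e.
  by move=> xe ye; rewrite (le_lt_trans (Qp_absD x y))// gt_max xe.
have ex n : exists q : rat, Qp_abs (u n - ratr q) < n.+1%:R^-1.
  by apply: Qp_dense; rewrite invr_gt0 ltr0n.
have [q uq] := choice ex.
have small e : 0 < e -> exists N : nat, forall n : nat, (N <= n)%N ->
    Qp_abs (u n - ratr (q n)) < e.
  move=> e0; exists (Num.bound e^-1) => n Nn; apply: lt_trans (uq n) _.
  rewrite invf_plt ?posrE ?ltr0n//.
  apply: lt_le_trans (archi_boundP _) _; first by rewrite invr_ge0 ltW.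
  by rewrite ler_nat ltnW.
have cq : C q.
  apply/asboolP => e e0; have [N H] := cu e e0; have [M K] := small e e0.
  exists (maxn N M) => m n; rewrite !geq_max => /andP[Nm Mm] /andP[Nn Mn].
  rewrite -Qp_abs_ratr Qp_ratrE rmorphB/= -!Qp_ratrE.
  have -> : ratr (q m) - ratr (q n) =
      (ratr (q m) - u m) + ((u m - u n) + (u n - ratr (q n))) :> Qp by ring.
  by apply: (ltD); [rewrite Qp_absB K|apply: ltD; [exact: H|exact: K]].
pose w : padic_cauchy_seq := exist _ q cq.
exists (\pi_Qp w) => e e0.
have e2 : 0 < e / 2 by rewrite divr_gt0.
have [M K] := small e e0; have [N H] := padic_cauchy_seqP w e2.
exists (maxn N M) => n; rewrite geq_max => /andP[Nn Mn].
rewrite -(subrKA (ratr (q n))); apply: ltD; first exact: K.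
rewrite Qp_absB Qp_ratrE.
rewrite (_ : _ - _ = \pi_Qp (w - padic_cst_seq (q n))); last by rewrite rmorphB.
have [[-> _]|[c c0 L]] := Qp_abs_cases (w - padic_cst_seq (q n)).
  by rewrite Qp_abs0.
rewrite (Qp_abs_piE (lim_const L)); move: L => [P L]; rewrite -(L _ (leq_maxr N P)).
apply: lt_trans (H _ _ (leq_maxl N P) Nn) _.
by rewrite ltr_pdivrMr// ltr_pMr// ltr1n.
Qed.

End PadicField.

Variant cf_kind := Browkin | Ruban.

Definition padic_digit (k : cf_kind) (p : nat) (a : int) : bool :=
  match k with
  | Browkin => - (p.-1./2)%:Z <= a <= (p.-1./2)%:Z
  | Ruban => 0 <= a <= p.-1%:Z
  end.

(* The first n terms of \sum_(i >= r) a_i p^i. *)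
Definition digit_sum (F : fieldType) (p : nat) (a : int -> int) (r : int)
    (n : nat) : F :=
  \sum_(j < n) (a (r + j%:Z))%:~R * p%:R ^ (r + j%:Z).

Section ContinuedFraction.
Variables (p : nat) (p_pr : prime p) (k : cf_kind).

Definition digit_expansion (beta : Qp p_pr) (r : int) (a : int -> int) : Prop :=
  (forall i : int, r <= i -> padic_digit k p (a i)) /\
  Qp_cvg (fun n => digit_sum (Qp p_pr) p a r n) beta.

(* The graph of the function s: the terms of index r, ..., 0 are the first
   |r| + 1 ones when r <= 0. *)
Definition padic_s (beta : Qp p_pr) (q : rat) : Prop :=
  exists r a, digit_expansion beta r a /\
    q = digit_sum rat p a r (if r <= 0 then `|r|%N.+1 else 0%N).

Definition infinite_cf (alpha : Qp p_pr) (b : nat -> rat) : Prop :=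
  exists al : nat -> Qp p_pr,
    [/\ al 0%N = alpha,
        forall i, padic_s (al i) (b i),
        forall i, al i != ratr (b i)
      & forall i, al i.+1 = (al i - ratr (b i))^-1].

End ContinuedFraction.

(* With init = (X_(-2), X_(-1)), returns (X_(n-2), X_(n-1)). *)
Fixpoint continuants (b : nat -> rat) (init : rat * rat) (n : nat) : rat * rat :=
  if n is m.+1 then
    let: (x, y) := continuants b init m in (y, b m * y + x)
  else init.

Definition cf_num (b : nat -> rat) (n : nat) : rat :=
  (continuants b (0, 1) n.+1).2.

Definition cf_den (b : nat -> rat) (n : nat) : rat :=
  (continuants b (1, 0) n.+1).2.

Definition palindromic_prefix (b : nat -> rat) (n : nat) : Prop :=
  forall j : nat, (1 <= j <= n)%N -> b j = b (n.+1 - j)%N.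

Definition transcendental (F : fieldType) (x : F) : Prop :=
  ~ algebraicOver (@ratr F) x.

Definition quadratic_irrational (F : fieldType) (x : F) : Prop :=
  (exists2 P : {poly rat}, size P = 3%N & root (map_poly ratr P) x) /\
  ~ (exists q : rat, x = ratr q).

(* Main.v *)
(* If b_1 ... b_n is a palindrome then A_n = B_(n-1), so that alpha and alpha^2 are both
   p-adically close to A_n / B_n and A_(n-1) / B_n: the integer vector proportional to
   (B_n, A_n, A_(n-1)) has real size at most p^(5e/4) and makes alpha X0 - X1 and
   alpha^2 X0 - X2 of p-adic size at most p^(-2e), where |B_n|_p = p^e.  If alpha is
   algebraic of degree at least 3, such vectors are excluded by the subspace theorem for
   the linear forms X0, alpha X0 - X1, alpha^2 X0 - X2.  Only a special case of it is
   needed.  Either the point itself or a short vector orthogonal to it is the normal of a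
   plane spanned by two integer vectors that are small with respect to all three forms at
   once, so the geometry of numbers reduces to a two-dimensional lattice reduction.
   Siegel's lemma gives a multihomogeneous form in m blocks of three variables that
   vanishes to high order along these linear forms.  By the product formula it also
   vanishes along m of those planes, of rapidly increasing heights; dehomogenised on the
   planes, this contradicts Roth's lemma, which is proved with generalised Wronskians. *)

Require Import Defs.
From HB Require Import structures.
From mathcomp Require Import all_boot all_order all_algebra fingroup perm.
From mathcomp Require Import zify ring lra.
From mathcomp Require Import mpoly.
From mathcomp Require Import boolp reals sequences exp.
Set Implicit Arguments.
Unset Strict Implicit.
Unset Printing Implicit Defensive.
Import Order.TTheory GRing.Theory Num.Theory.
Local Open Scope ring_scope.

(** * Weighted norms and the index of a polynomial *)

(** Write F = p^(2e). The integer point has real size at most about F^(5/8), and two forms at it are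
    at most 1/F, so what is needed is that (real size)^3 falls below F^2, that is, an exponent below
    2/3. The value 63/100 lies strictly between 5/8 and 2/3; the gap above 5/8 pays for replacing
    alpha by an algebraic integer beta = a alpha, the gap below 2/3 for rounding. The weights
    express the same inequality: vectors of size 2^(50c) whose forms have p-adic exponents of sum
    152 > 3 * 50. Since beta is integral, polynomials in beta with integer coefficients have integer
    coordinates on 1, ..., beta^(d-1); hence Siegel's lemma and Liouville's inequality stay over the
    integers, without number fields. Planes are needed because Roth's lemma takes one rational
    number per block: a plane in three-space supplies one as a quotient of two coordinates of its
    normal, a point does not. Liouville's inequality keeps the normals from being too small, so that
    their heights grow with those of the points; degree at least 3 enters there, through the
    independence of 1, beta, beta^2. *)

Section WeightedNorm.
Variables (R : comNzRingType) (n : nat) (nu : R -> rat) (kap : 'I_n -> rat).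
Hypothesis nu0 : nu 0 = 0.
Hypothesis nu_ge0 : forall x, 0 <= nu x.
Hypothesis nuD : forall x y, nu (x + y) <= nu x + nu y.
Hypothesis nuM : forall x y, nu (x * y) <= nu x * nu y.
Hypothesis nu1 : nu 1 <= 1.
Hypothesis kap_gt0 : forall i, 0 < kap i.

Definition mwt (K : 'X_{1..n}) : rat := \prod_(i < n) (kap i ^- K i).

(** A weighted length in which X_i counts as 1 / kap i. Only subadditivity and submultiplicativity
    are asked of nu, so that it serves for the real and the p-adic absolute values and for [pnrm] on
    integer polynomials. *)
Definition mnorm (p : {mpoly R[n]}) : rat := \sum_(K <- msupp p) nu p@_K * mwt K.

Lemma mwt_gt0 K : 0 < mwt K.
Proof. by apply: prodr_gt0 => i _; rewrite invr_gt0 exprn_gt0. Qed.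

Lemma mwtD K L : mwt (K + L)%MM = mwt K * mwt L.
Proof.
rewrite /mwt -big_split /=; apply: eq_bigr => i _.
by rewrite mnmDE exprD invfM.
Qed.

Lemma mnorm_ge0 p : 0 <= mnorm p.
Proof. by apply: sumr_ge0 => K _; rewrite mulr_ge0 // ltW // mwt_gt0. Qed.

Lemma mnorm_sub (s : seq 'X_{1..n}) p :
  uniq s -> {subset msupp p <= s} -> mnorm p = \sum_(K <- s) nu p@_K * mwt K.
Proof.
move=> us sub; rewrite /mnorm [RHS](bigID (mem (msupp p))) /=.
rewrite [X in _ + X]big1 ?addr0 => [|K]; last first.
  by rewrite -mcoeff_eq0 => /eqP ->; rewrite nu0 mul0r.
rewrite -[RHS]big_filter; apply: perm_big; apply: uniq_perm.
- exact: msupp_uniq.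
- exact: filter_uniq.
by move=> K; rewrite mem_filter; case: (boolP (K \in msupp p)) => //= /sub ->.
Qed.

Lemma mnormD p q : mnorm (p + q) <= mnorm p + mnorm q.
Proof.
pose s := undup (msupp p ++ msupp q).
have us : uniq s by exact: undup_uniq.
rewrite (mnorm_sub us) => [|K /msuppD_le]; last by rewrite mem_undup.
rewrite (@mnorm_sub s p us) => [|K Kp]; last by rewrite mem_undup mem_cat Kp.
rewrite (@mnorm_sub s q us) => [|K Kp]; last by rewrite mem_undup mem_cat Kp orbT.
rewrite -big_split /=; apply: ler_sum => K _; rewrite mcoeffD -mulrDl.
by rewrite ler_wpM2r // ltW // mwt_gt0.
Qed.

Lemma mnorm0 : mnorm 0 = 0.
Proof. by rewrite /mnorm msupp0 big_nil. Qed.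

Lemma mnorm_sum (I : Type) (s : seq I) (P : pred I) (E : I -> {mpoly R[n]}) :
  mnorm (\sum_(i <- s | P i) E i) <= \sum_(i <- s | P i) mnorm (E i).
Proof.
elim/big_rec2: _ => [|i y1 y2 _ le]; first by rewrite mnorm0.
by apply: le_trans (mnormD _ _) _; rewrite lerD2l.
Qed.

Lemma mnormZX c K : mnorm (c *: 'X_[K]) <= nu c * mwt K.
Proof.
have s1 : {subset msupp (c *: 'X_[K]) <= [:: K]}.
  move=> L; rewrite mcoeff_msupp mcoeffZ mcoeffX inE.
  by case: (eqVneq K L) => [//|ne]; rewrite mulr0 eqxx.
by rewrite (mnorm_sub _ s1) // big_seq1 mcoeffZ mcoeffX eqxx mulr1.
Qed.

Lemma mnormM p q : mnorm (p * q) <= mnorm p * mnorm q.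
Proof.
rewrite mpolyME; apply: le_trans (mnorm_sum _ _ _) _.
rewrite /mnorm mulr_suml big_allpairs_dep /=; apply: ler_sum => K _; rewrite mulr_sumr.
apply: ler_sum => L _; apply: le_trans (mnormZX _ _) _.
rewrite mwtD; apply: le_trans (_ : _ <= nu p@_K * nu q@_L * (mwt K * mwt L)) _.
  by rewrite ler_wpM2r // mulr_ge0 // ltW // mwt_gt0.
by rewrite mulrACA.
Qed.

Lemma mnorm1 : mnorm 1 <= 1.
Proof.
rewrite -mpolyX0 -[X in mnorm X]scale1r; apply: le_trans (mnormZX _ _) _.
by rewrite /mwt big1 ?mulr1 // => i _; rewrite mnm0E expr0 invr1.
Qed.

Lemma mnorm_prod (I : Type) (s : seq I) (P : pred I) (E : I -> {mpoly R[n]}) :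
  mnorm (\prod_(i <- s | P i) E i) <= \prod_(i <- s | P i) mnorm (E i).
Proof.
elim/big_rec2: _ => [|i y1 y2 _ le]; first exact: mnorm1.
by apply: le_trans (mnormM _ _) _; rewrite ler_wpM2l // mnorm_ge0.
Qed.

Lemma mnormX p k : mnorm (p ^+ k) <= mnorm p ^+ k.
Proof.
elim: k => [|k IH]; first exact: mnorm1.
rewrite !exprS; apply: le_trans (mnormM _ _) _.
by rewrite ler_wpM2l // mnorm_ge0.
Qed.

Lemma mnorm_coef p K : nu p@_K * mwt K <= mnorm p.
Proof.
have [Kp|Kp] := boolP (K \in msupp p); last first.
  move: Kp; rewrite -mcoeff_eq0 => /eqP ->.
  by rewrite nu0 mul0r mnorm_ge0.
rewrite /mnorm (bigD1_seq K) ?msupp_uniq //= lerDl sumr_ge0 // => L _.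
by rewrite mulr_ge0 // ltW // mwt_gt0.
Qed.

Lemma mnorm_det k (A : 'M[{mpoly R[n]}]_k) E :
  nu (-1) <= 1 -> 0 <= E -> (forall i j, mnorm (A i j) <= E) ->
  mnorm (\det A) <= (k`!)%:R * E ^+ k.
Proof.
move=> nuN E0 AE; rewrite /determinant; apply: le_trans (mnorm_sum _ _ _) _.
apply: le_trans (_ : _ <= \sum_(s : 'S_k) E ^+ k) _; last first.
  by rewrite sumr_const card_Sn mulr_natl.
apply: ler_sum => s _; apply: le_trans (mnormM _ _) _.
rewrite -[leRHS]mul1r; apply: ler_pM; rewrite ?mnorm_ge0 //.
  case: (odd_perm s) => /=; rewrite ?expr0 ?expr1 ?mnorm1 //.
  have -> : -1 = (-1) *: 'X_[0%MM] :> {mpoly R[n]} by rewrite scaleN1r mpolyX0.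
  apply: le_trans (mnormZX _ _) _.
  by rewrite /mwt big1 ?mulr1 // => i _; rewrite mnm0E expr0 invr1.
apply: le_trans (mnorm_prod _ _ _) _; rewrite -[X in _ <= _ ^+ X]card_ord.
rewrite -prodr_const; apply: ler_prod => i _.
by rewrite mnorm_ge0 AE.
Qed.

End WeightedNorm.

Section Order.
Variables (R : comNzRingType) (n : nat) (w : 'I_n -> rat).
Hypothesis w_ge0 : forall i, 0 <= w i.

Definition lwt (K : 'X_{1..n}) : rat := \sum_(i < n) w i * (K i)%:R.

(* For w h = 1 / r h, the index at the origin in Roth's sense is the largest such t. *)
Definition vord (t : rat) (p : {mpoly R[n]}) :=
  forall K, p@_K != 0 -> t <= lwt K.

Lemma lwtD K L : lwt (K + L)%MM = lwt K + lwt L.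
Proof.
by rewrite /lwt -big_split /=; apply: eq_bigr => i _; rewrite mnmDE natrD mulrDr.
Qed.

Lemma lwt_ge0 K : 0 <= lwt K.
Proof. by apply: sumr_ge0 => i _; rewrite mulr_ge0. Qed.

Lemma vord_0 t : vord t 0.
Proof. by move=> K; rewrite mcoeff0 eqxx. Qed.

Lemma vord_ge0 p : vord 0 p.
Proof. by move=> K _; exact: lwt_ge0. Qed.

Lemma vord_le s t p : s <= t -> vord t p -> vord s p.
Proof. by move=> st vp K /vp; exact: le_trans. Qed.

Lemma vordD t p q : vord t p -> vord t q -> vord t (p + q).
Proof.
move=> vp vq K; rewrite mcoeffD; have [->|pK _] := eqVneq p@_K 0.
  by rewrite add0r => /vq.
exact: vp.
Qed.

Lemma vord_sum t (I : Type) (s : seq I) (P : pred I) (E : I -> {mpoly R[n]}) :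
  (forall i, P i -> vord t (E i)) -> vord t (\sum_(i <- s | P i) E i).
Proof. by move=> vE; apply: big_ind => //; [exact: vord_0|exact: vordD]. Qed.

Lemma vordM s t p q : vord s p -> vord t q -> vord (s + t) (p * q).
Proof.
move=> vp vq K; apply: contraR => nle; rewrite mcoeffM big1 // => -[a b] /= /eqP EK.
have [->|pa] := eqVneq p@_a 0; first by rewrite mul0r.
have [->|qb] := eqVneq q@_b 0; first by rewrite mulr0.
by case/negP: nle; rewrite EK lwtD lerD ?vp ?vq.
Qed.

Lemma vord_prod (I : finType) (t : I -> rat) (E : I -> {mpoly R[n]}) :
  (forall i, vord (t i) (E i)) -> vord (\sum_i t i) (\prod_i E i).
Proof.
move=> vE; elim/big_rec2: _ => [|i y1 y2 _ le]; first exact: vord_ge0.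
exact: vordM.
Qed.

(** Every term of the Leibniz expansion takes one entry from each column, so lower bounds that
    depend on the column alone add up. *)
Lemma vord_det k (A : 'M[{mpoly R[n]}]_k) (g : 'I_k -> rat) :
  (forall i j, vord (g j) (A i j)) -> vord (\sum_j g j) (\det A).
Proof.
move=> vA; apply: vord_sum => s _; rewrite -[X in vord X _]add0r.
apply: vordM; first exact: vord_ge0.
have -> : \sum_j g j = \sum_j g (s j).
  by rewrite (reindex_inj (@perm_inj _ s)).
by apply: vord_prod => i; exact: vA.
Qed.

End Order.

(** * Divided derivatives and translations *)

Section Hasse.
Variable n : nat.
Implicit Types (p q : {mpoly rat[n]}) (a b K : 'X_{1..n}) (xi : 'I_n -> rat).

Definition mbin b a : rat := \prod_(i < n) ('C(a i, b i))%:R.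

(** The derivative divided by b!: it keeps integer coefficients integral, and its values are exactly
    the Taylor coefficients ([mcoeff_trl]). *)
Definition hasse b p : {mpoly rat[n]} :=
  \sum_(a <- msupp p) (p@_a * mbin b a) *: 'X_[a - b].

Lemma mbin_eq0 b a : (mbin b a == 0) = ~~ (b <= a)%MM.
Proof.
rewrite /mbin; apply/prodf_eq0/idP => [[i _]|].
  rewrite pnatr_eq0 -leqn0 -ltnS => h; apply/negP => /mnm_lepP /(_ i).
  by rewrite -bin_gt0 => h2; move: h h2; case: 'C(_, _).
rewrite /= -[(b <= a)%MM]/([forall i, b i <= a i])%N negb_forall => /existsP[i].
rewrite -ltnNge => lt; exists i => //; by rewrite bin_small.
Qed.

Lemma mcoeff_hasse b p K : (hasse b p)@_K = p@_(K + b) * mbin b (K + b)%MM.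
Proof.
rewrite /hasse raddf_sum /=.
have E a : a \in msupp p -> ((p@_a * mbin b a) *: 'X_[a - b])@_K =
   if a == (K + b)%MM then p@_(K + b) * mbin b (K + b)%MM else 0.
  move=> _; rewrite mcoeffZ mcoeffX; case: (eqVneq a (K + b)%MM) => [->|ne].
    by rewrite addmK eqxx mulr1.
  have [lba|] := boolP (b <= a)%MM; last first.
    by rewrite -mbin_eq0 => /eqP ->; rewrite mulr0 mul0r.
  case: eqP => [EK|_]; last by rewrite mulr0.
  by case/eqP: ne; rewrite -EK submK.
rewrite big_seq (eq_bigr _ E) -big_seq /=.
have [Kp|Kp] := boolP ((K + b)%MM \in msupp p).
  rewrite (bigD1_seq (K + b)%MM) ?msupp_uniq //= eqxx big1 ?addr0 // => a ne.
  by rewrite (negbTE ne).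
rewrite big1_seq => [|a /andP[_ ap]].
  by move: Kp; rewrite -mcoeff_eq0 => /eqP ->; rewrite mul0r.
by case: eqP => // aE; move: Kp; rewrite -aE ap.
Qed.

Lemma hasse_is_linear b : linear (hasse b).
Proof.
move=> c p q; apply/mpolyP => K.
by rewrite mcoeffD mcoeffZ !mcoeff_hasse mcoeffD mcoeffZ mulrDl mulrA.
Qed.
HB.instance Definition _ b :=
  GRing.isLinear.Build rat {mpoly rat[n]} {mpoly rat[n]} _ (hasse b) (hasse_is_linear b).

Lemma hasseX b a : hasse b 'X_[a] = mbin b a *: 'X_[a - b].
Proof. by rewrite /hasse msuppX big_seq1 mcoeffX eqxx mul1r. Qed.

(** Coordinate by coordinate both sides are a! / (b! c! (a - b - c)!). *)
Lemma mbin_mul b c a : (b + c <= a)%MM ->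
  mbin c (a - b)%MM * mbin b a = mbin b (b + c)%MM * mbin (b + c)%MM a.
Proof.
move=> /mnm_lepP le; rewrite /mbin -!big_split /=; apply: eq_bigr => i _.
move: (le i); rewrite mnmBE !mnmDE -!natrM => lei; congr (_%:R).
have fz k : (0 < k`!)%N by rewrite fact_gt0.
have h1 := @bin_fact (a i - b i) (c i) ltac:(lia).
have h2 := @bin_fact (a i) (b i) ltac:(lia).
have h3 := @bin_fact (b i + c i) (b i) ltac:(lia).
have h4 := @bin_fact (a i) (b i + c i) lei.
have e1 : (b i + c i - b i = c i)%N by lia.
have e2 : (a i - (b i + c i) = a i - b i - c i)%N by lia.
rewrite e1 in h3; rewrite e2 in h4.
have f1 := fz (b i); have f2 := fz (c i); have f3 := fz (a i - b i - c i)%N.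
have f4 := fz (a i - b i)%N; have f5 := fz (b i + c i)%N.
apply/eqP; rewrite -(@eqn_pmul2r ((c i)`! * (a i - b i - c i)`! * (b i)`!)) ?muln_gt0 ?f1 ?f2 ?f3 //.
apply/eqP; transitivity ((a i)`!).
  by rewrite -h2 -h1; lia.
by rewrite -h4 -h3; lia.
Qed.

Lemma hasse_hasse b c p :
  hasse c (hasse b p) = mbin b (b + c)%MM *: hasse (b + c)%MM p.
Proof.
apply/mpolyP => K; rewrite mcoeffZ !mcoeff_hasse.
have -> : (K + c + b = K + (b + c))%MM by rewrite -addmA [(c + b)%MM]addmC.
have := @mbin_mul b c (K + (b + c))%MM (lem_addl _ _).
have -> : (K + (b + c) - b = K + c)%MM.
  by rewrite [(b + c)%MM]addmC addmA addmK.
move=> E; rewrite -mulrA [mbin b (K + _)%MM * _]mulrC E; ring.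
Qed.

Definition trl xi p : {mpoly rat[n]} := mmap (@mpolyC n rat) (fun i => 'X_i + (xi i)%:MP) p.

HB.instance Definition _ xi := GRing.RMorphism.copy (trl xi) (mmap (@mpolyC n rat) (fun i => 'X_i + (xi i)%:MP)).

Lemma trlX xi a : trl xi 'X_[a] = \prod_i ('X_i + (xi i)%:MP) ^+ a i.
Proof. by rewrite /trl mmapX. Qed.

Lemma mcoeff_prod_uni (N : nat) (c : 'I_n -> 'I_N.+1 -> rat) K :
  (\prod_i \sum_(j < N.+1) c i j *: 'X_[U_(i) *+ j])@_K =
  if [forall i, K i <= N]%N then \prod_i c i (inord (K i)) else 0.
Proof.
rewrite bigA_distr_bigA /= raddf_sum /=.
have E (f : {ffun 'I_n -> 'I_N.+1}) : (\prod_i (c i (f i) *: 'X_[U_(i) *+ f i]))@_K =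
   (\prod_i c i (f i)) * ([multinom (f i : nat) | i < n] == K)%:R.
  rewrite scaler_prod -(big_morph _ (@mpolyXD n rat) (mpolyX0 n rat)) mcoeffZ mcoeffX.
  congr (_ * (_ == _)%:R); rewrite [RHS]multinomUE_id.
  by apply: eq_bigr => i _; rewrite mnmE.
under eq_bigr => f _ do rewrite E.
case: ifPn => [/forallP KN|].
  pose f0 : {ffun 'I_n -> 'I_N.+1} := [ffun i => inord (K i)].
  rewrite (bigD1 f0) //= [X in _ + X]big1 ?addr0 => [|f ne].
    have -> : [multinom (f0 i : nat) | i < n] == K.
      by apply/eqP/mnmP => i; rewrite mnmE ffunE inordK // ltnS.
    by rewrite mulr1; apply: eq_bigr => i _; rewrite ffunE.
  case: eqP => [fK|_]; last by rewrite mulr0.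
  case/eqP: ne; apply/ffunP => i; rewrite ffunE; apply: val_inj => /=.
  by rewrite inordK ?ltnS // -fK mnmE.
rewrite negb_forall => /existsP[i Ki]; rewrite big1 // => f _.
case: eqP => [fK|_]; last by rewrite mulr0.
by move: Ki; rewrite -fK mnmE -ltnS ltn_ord.
Qed.

Lemma mcoeff_trlX xi a b : (trl xi 'X_[a])@_b = mbin b a * \prod_i xi i ^+ (a i - b i).
Proof.
pose N := (mdeg a + mdeg b)%N.
have leN i : (a i <= mdeg a)%N /\ (b i <= mdeg b)%N.
  by rewrite !mdegE (bigD1 i) //= [in X in _ /\ X](bigD1 i) //= !leq_addr.
have -> : trl xi 'X_[a] = \prod_i \sum_(j < N.+1)
    (('C(a i, j))%:R * xi i ^+ (a i - j)) *: 'X_[U_(i) *+ j].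
  rewrite trlX; apply: eq_bigr => i _; rewrite addrC exprDn.
  rewrite (big_ord_widen_cond N.+1 xpredT (fun j => ((xi i)%:MP ^+ (a i - j) * 'X_i ^+ j) *+ 'C(a i, j))); last first.
    by have [] := leN i; lia.
  rewrite big_mkcond /=; apply: eq_bigr => j _; case: ifPn => [_|].
    rewrite -mpolyXn -mul_mpolyC mpolyCM rmorphXn /= rmorph_nat -mulr_natl; ring.
  by rewrite -leqNgt => lt; rewrite bin_small // mul0r scale0r.
rewrite mcoeff_prod_uni ifT; last first.
  by apply/forallP => i; have [] := leN i; rewrite /N; lia.
rewrite -big_split /=; apply: eq_bigr => i _.
by rewrite inordK // ltnS; have [] := leN i; rewrite /N; lia.
Qed.

Lemma mcoeff_trl xi p b : (trl xi p)@_b = (hasse b p).@[xi].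
Proof.
rewrite [in LHS](mpolyE p) /hasse rmorph_sum !raddf_sum; apply: eq_bigr => a _.
have E : trl xi (p@_a *: 'X_[a]) = (p@_a)%:MP * trl xi 'X_[a].
  by rewrite -mul_mpolyC rmorphM /= /trl mmapC.
rewrite -/(trl xi _) -[LHS]/(mcoeff b (trl xi _)) E mcoeffCM mcoeff_trlX.
rewrite -[RHS]/(meval xi _) mevalZ mevalX -mulrA; congr (_ * (_ * _)).
by apply: eq_bigr => i _; rewrite mnmBE.
Qed.

(** The Taylor coefficient of [hasse b p] at K is a multiple of that of p at K + b, by
    [hasse_hasse]. *)
Lemma vord_hasse w t xi b p : (forall i, 0 <= w i) ->
  vord w t (trl xi p) -> vord w (t - lwt w b) (trl xi (hasse b p)).
Proof.
move=> w0 vp K; rewrite mcoeff_trl hasse_hasse mevalZ mulf_eq0 negb_or => /andP[_].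
by rewrite -mcoeff_trl => /vp; rewrite lwtD addrC lerBlDr.
Qed.

Lemma trl_supp xi p K : (trl xi p)@_K != 0 -> exists2 a, p@_a != 0 & (K <= a)%MM.
Proof.
rewrite mcoeff_trl /hasse => h.
have : ~~ all (fun a => (p@_a * mbin K a) == 0) (msupp p).
  apply: contra h => /allP h; rewrite raddf_sum /= big_seq big1 // => a /h /eqP ->.
  by rewrite scale0r meval0.
case/allPn => a ap; rewrite mulf_eq0 negb_or mbin_eq0 negbK => /andP[].
by exists a.
Qed.

Definition nrm p : rat := mnorm (fun x : rat => `|x|) (fun=> 1) p.

Let a0 : `|0 : rat| = 0 := normr0 _.
Let a_ge0 (x : rat) : 0 <= `|x| := normr_ge0 x.
Let aD (x y : rat) : `|x + y| <= `|x| + `|y| := ler_normD x y.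
Let aM (x y : rat) : `|x * y| <= `|x| * `|y|. Proof. by rewrite normrM. Qed.
Let a1 : `|1 : rat| <= 1. Proof. by rewrite normr1. Qed.
Let k_gt0 (i : 'I_n) : (0 : rat) < 1 := ltr01.

Lemma nrmE p : nrm p = \sum_(K <- msupp p) `|p@_K|.
Proof.
apply: eq_bigr => K _; rewrite /mwt big1 ?mulr1 // => i _.
by rewrite expr1n invr1.
Qed.

Lemma mbin_bound N b a : (forall i, (a i <= N)%N) -> 0 <= mbin b a <= 2 ^+ (n * N).
Proof.
move=> aN; rewrite /mbin prodr_ge0 ?ler0n //= mulnC exprM.
rewrite -[X in _ <= _ ^+ X]card_ord -prodr_const; apply: ler_prod => i _.
rewrite ler0n /= -natrX ler_nat.
apply: leq_trans (_ : _ <= 2 ^ a i)%N _; last by rewrite leq_exp2l.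
rewrite -[2%N]/(1 + 1)%N expnDn; have [le|lt] := leqP (b i) (a i); last first.
  by rewrite bin_small.
rewrite (bigD1 (Ordinal (n:=(a i).+1) (m:=b i) le)) //= !exp1n !muln1.
exact: leq_addr.
Qed.

Lemma nrm_hasse N b p : (forall a, p@_a != 0 -> forall i, (a i <= N)%N) ->
  nrm (hasse b p) <= 2 ^+ (n * N) * nrm p.
Proof.
move=> pN; rewrite /hasse [nrm p]nrmE mulr_sumr.
rewrite [leLHS]/nrm; apply: le_trans (mnorm_sum a0 aD k_gt0 _ _ _) _.
rewrite !big_seq; apply: ler_sum => a; rewrite mcoeff_msupp => /pN aN.
apply: le_trans (mnormZX _ a0 _ _) _.
rewrite /mwt big1 ?mulr1 => [|i _]; last by rewrite expr1n invr1.
have /andP[h0 h1] := mbin_bound b aN.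
by rewrite normrM [X in X <= _]mulrC ger0_norm // ler_wpM2r.
Qed.

Lemma nrm_ge0 p : 0 <= nrm p.
Proof. exact: mnorm_ge0. Qed.

Lemma nrm_coef p K : `|p@_K| <= nrm p.
Proof.
have := mnorm_coef a0 a_ge0 k_gt0 p K.
by rewrite /mwt big1 ?mulr1 // => i _; rewrite expr1n invr1.
Qed.

Lemma nrm_det k (A : 'M[{mpoly rat[n]}]_k) E :
  0 <= E -> (forall i j, nrm (A i j) <= E) -> nrm (\det A) <= (k`!)%:R * E ^+ k.
Proof. by apply: mnorm_det => //; rewrite normrN1. Qed.

(** * Generalised Wronskians *)

(** Multiplying the function [mbin b] by a coordinate stays in the span of binomials of degree at
    most one more, so binomials can replace monomials in the interpolation below. *)
Lemma mbinS h b a : (a h)%:R * mbin b a =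
  (b h).+1%:R * mbin (b + U_(h))%MM a + (b h)%:R * mbin b a.
Proof.
have D b' : mbin b' a = ('C(a h, b' h))%:R * \prod_(i < n | i != h) ('C(a i, b' i))%:R.
  by rewrite /mbin (bigD1 h).
have E : \prod_(i < n | i != h) ('C(a i, (b + U_(h))%MM i))%:R =
         \prod_(i < n | i != h) ('C(a i, b i))%:R :> rat.
  apply: eq_bigr => i ih.
  by rewrite mnmDE mnm1E eq_sym (negbTE ih) addn0.
rewrite !D E; set Q := \prod_(_ < _ | _) _.
rewrite mnmDE mnm1E eqxx addn1 !mulrA -mulrDl; congr (_ * _).
rewrite -!natrM -natrD; congr (_%:R).
have := mul_bin_left (a h) (b h).
have [le|lt] := leqP (b h) (a h); last by rewrite !bin_small ?muln0 // ltnW.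
move=> ->; rewrite -mulnDl subnK //.
Qed.

(** Lagrange interpolation: for each point of s one multiplies by a linear factor that vanishes
    there but not at [a j0]. Each factor raises the degree by at most one ([mbinS]), and what
    survives is the term of j0. *)
Lemma mbin_separate (T : finType) (s : seq T) (C : T -> rat) (a : T -> 'X_{1..n}) j0 :
  (forall j, j \in s -> a j != a j0) ->
  (forall j, j != j0 -> j \notin s -> C j = 0) -> C j0 != 0 ->
  exists2 b, (mdeg b <= size s)%N & \sum_j C j * mbin b (a j) != 0.
Proof.
elim: s C => [|j1 s IH] C sa sC C0.
  exists 0%MM; first by rewrite mdeg0.
  rewrite (bigD1 j0) //= [X in _ + X]big1 ?addr0 => [|j jj0]; last by rewrite sC ?mul0r.
  rewrite mulf_neq0 // mbin_eq0 negbK; apply/mnm_lepP => i.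
  by rewrite mnm0E.
have [h ah] : exists h, a j1 h != a j0 h.
  apply/existsP; rewrite -negb_forall; apply: contra (sa j1 (mem_head _ _)).
  by move=> /forallP e; apply/eqP/mnmP => i; exact/eqP.
pose C' j := C j * ((a j h)%:R - (a j1 h)%:R).
have [b bs nz] : exists2 b, (mdeg b <= size s)%N & \sum_j C' j * mbin b (a j) != 0.
  apply: IH => [j js|j jj0 js|].
  - by apply: sa; rewrite inE js orbT.
  - rewrite /C'; have [->|ne] := eqVneq j j1; first by rewrite subrr mulr0.
    by rewrite sC ?mul0r // inE negb_or ne.
  - by rewrite /C' mulf_neq0 // subr_eq0 eqr_nat eq_sym.
have E : \sum_j C' j * mbin b (a j) =
    (b h).+1%:R * (\sum_j C j * mbin (b + U_(h))%MM (a j)) +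
    ((b h)%:R - (a j1 h)%:R) * (\sum_j C j * mbin b (a j)).
  rewrite !mulr_sumr -big_split /=; apply: eq_bigr => j _.
  rewrite /C' -mulrA mulrBl mbinS; ring.
have [z|nz'] := eqVneq (\sum_j C j * mbin b (a j)) 0.
  exists (b + U_(h))%MM; first by rewrite mdegD mdeg1 addn1.
  by apply: contra nz => /eqP z'; rewrite E z z' !mulr0 addr0.
by exists b => //; exact: leqW.
Qed.

(** Rows are added one at a time. The cofactors of the new last row do not depend on it, and the
    last of them is nonzero by induction, so [mbin_separate] finds a row of degree at most k that
    makes the expansion nonzero. The degree bound is what makes differentiation cheap in
    [roth_step]. *)
Lemma mbin_indep k (a : 'I_k -> 'X_{1..n}) : injective a ->
  exists2 b : 'I_k -> 'X_{1..n}, (forall i, (mdeg (b i) <= i)%N) &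
    \det (\matrix_(i, j) mbin (b i) (a j)) != 0.
Proof.
elim: k a => [|k IH] a inj_a.
  by exists (fun=> 0%MM) => [[]//|]; rewrite det_mx00 oner_eq0.
have [b bi nz] := IH (fun j => a (lift ord_max j)) (inj_comp inj_a (@lift_inj _ _)).
pose B (i : 'I_k.+1) := if unlift ord_max i is Some i' then b i' else 0%MM.
pose A := \matrix_(i, j) mbin (B i) (a j).
pose C j := cofactor A ord_max j.
have [b0 b0k nz0] : exists2 b0, (mdeg b0 <= k)%N & \sum_j C j * mbin b0 (a j) != 0.
  have := @mbin_separate _ (rem ord_max (enum 'I_k.+1)) C a ord_max.
  rewrite size_rem ?mem_enum // size_enum_ord; apply.
  - move=> j; rewrite rem_filter ?enum_uniq // mem_filter /= => /andP[jm _].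
    by rewrite (inj_eq inj_a).
  - move=> j jm; rewrite rem_filter ?enum_uniq // mem_filter /= mem_enum jm //.
  rewrite /C /cofactor mulf_neq0 //; first by rewrite signr_eq0.
  move: nz; congr (\det _ != 0); apply/matrixP => i j; rewrite !mxE /B.
  by rewrite liftK.
pose B' (i : 'I_k.+1) := if unlift ord_max i is Some i' then b i' else b0.
exists B' => [i|].
  rewrite /B'; case: unliftP => [i' ->|->] //.
  by apply: leq_trans (bi i') _; rewrite lift_max.
rewrite (expand_det_row _ ord_max); move: nz0; congr (_ != 0).
apply: eq_bigr => j _; rewrite mxE mulrC /B' unlift_none; congr (_ * _).
rewrite /C /cofactor; congr (_ * \det _); apply/matrixP => i j'.
by rewrite !mxE /B liftK.
Qed.

Definition indep k (f : 'I_k -> {mpoly rat[n]}) :=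
  forall c : 'I_k -> rat, \sum_i c i *: f i = 0 -> forall i, c i = 0.

(** Gaussian elimination on leading monomials. The last clause serves the induction: the leading
    monomial removed from the other polynomials does not come back, so the new leading monomials
    differ from it. *)
Lemma echelon k (f : 'I_k -> {mpoly rat[n]}) : indep f ->
  exists (B : 'M[rat]_k) (g : 'I_k -> {mpoly rat[n]}),
  [/\ forall i, f i = \sum_j B i j *: g j, forall i, g i != 0,
      injective (fun i => mlead (g i)) &
      forall K, (forall i, (f i)@_K = 0) -> forall i, (g i)@_K = 0].
Proof.
elim: k f => [|k IH] f fi.
  by exists 0, (fun=> 0); split=> [[]//|[]//|[]//|? ? []//].
have f0 : f ord0 != 0.
  apply/eqP => f0; have := fi (fun i => (i == ord0)%:R).
  have -> : \sum_i (i == ord0)%:R *: f i = 0.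
    rewrite (bigD1 ord0) //= f0 scaler0 add0r big1 // => i /negbTE ->.
    by rewrite scale0r.
  by move/(_ erefl ord0)/eqP; rewrite eqxx oner_eq0.
pose L := mlead (f ord0); pose t i := (f (lift ord0 i))@_L / (f ord0)@_L.
have fL : (f ord0)@_L != 0 by rewrite mleadc_eq0.
pose h i := f (lift ord0 i) - t i *: f ord0.
have hi : indep h.
  move=> c hc i.
  pose c' j := if unlift ord0 j is Some j' then c j' else - \sum_j c j * t j.
  have := fi c' _ (lift ord0 i); rewrite /c' liftK; apply.
  rewrite big_ord_recl unlift_none -[RHS]hc scaleNr scaler_suml addrC.
  rewrite -sumrB; apply: eq_bigr => j _; rewrite liftK /h scalerBr scalerA //.
have [B [g [hB gnz ginj gsupp]]] := IH h hi.
pose g' j := if unlift ord0 j is Some j' then g j' else f ord0.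
pose B' : 'M[rat]_k.+1 := \matrix_(i, j) match unlift ord0 i, unlift ord0 j with
  | None, None => 1 | None, Some _ => 0 | Some i', None => t i'
  | Some i', Some j' => B i' j' end.
have gL i : (g i)@_L = 0.
  by apply: gsupp => j; rewrite mcoeffB mcoeffZ /t divfK // subrr.
exists B', g'; split=> [i|i|i j|K fK i].
- rewrite big_ord_recl /B' mxE unlift_none /g' unlift_none.
  case: unliftP => [i' ->|->].
    rewrite (eq_bigr (fun j => B i' j *: g j)) => [|j _]; last by rewrite mxE !liftK.
    by rewrite -hB /h addrC subrK.
  by rewrite scale1r big1 ?addr0 // => j _; rewrite mxE unlift_none liftK scale0r.
- by rewrite /g'; case: unliftP => [i' _|_].
- have ne i' : mlead (g i') != L.
    by apply/eqP => e; have := gnz i'; rewrite -mleadc_eq0 e gL eqxx.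
  rewrite /g'; case: unliftP => [i' ->|->]; case: unliftP => [j' ->|->] //.
  + by move/ginj => ->.
  + by move/eqP; rewrite (negbTE (ne _)).
  + by move/esym/eqP; rewrite (negbTE (ne _)).
- rewrite /g'; case: unliftP => [i' _|_] //; apply: gsupp => j.
  by rewrite mcoeffB mcoeffZ !fK mulr0 subrr.
Qed.

Lemma mcoeff_prod_le k (q : 'I_k -> {mpoly rat[n]}) (a : 'I_k -> 'X_{1..n}) :
  (forall i, (mlead (q i) <= a i)%O) ->
  (\prod_i q i)@_(\sum_i a i)%MM = \prod_i (q i)@_(a i) /\
  (mlead (\prod_i q i) <= (\sum_i a i)%MM)%O.
Proof.
move=> qa; elim: (index_enum _) => [|i s [IH1 IH2]].
  by rewrite !big_nil mcoeff1 eqxx mlead1.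
rewrite !big_cons mleadcMW // IH1; split=> //.
by apply: le_trans (mleadM_le _ _) _; apply: lem_add.
Qed.

(** After [echelon] the leading monomials are distinct, so [mbin_indep] applies to them. At the
    product of these monomials the determinant, with rows rescaled, has for coefficient the binomial
    determinant times the leading coefficients. *)
Lemma wronskian k (f : 'I_k -> {mpoly rat[n]}) : indep f ->
  exists2 b : 'I_k -> 'X_{1..n}, (forall i, (mdeg (b i) <= i)%N) &
    \det (\matrix_(i, j) hasse (b i) (f j)) != 0.
Proof.
move=> fi; have [B [g [fB gnz ginj _]]] := echelon fi.
have [b bi nz] := mbin_indep ginj; exists b => //.
have -> : \matrix_(i, j) hasse (b i) (f j) =
    (\matrix_(i, j) hasse (b i) (g j)) *m (map_mx (@mpolyC n rat) B)^T.
  apply/matrixP => i j; rewrite !mxE fB raddf_sum; apply: eq_bigr => l _.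
  by rewrite !mxE -[LHS]/(hasse (b i) _) linearZ /= -mul_mpolyC mulrC.
rewrite det_mulmx det_tr det_map_mx mulf_neq0 ?mpolyC_eq0 //; last first.
  apply/det0P => -[v v0 vB]; case/eqP: v0; apply/rowP => i; rewrite mxE.
  apply: (fi (v 0)); under eq_bigr => j _ do rewrite fB scaler_sumr.
  rewrite exchange_big big1 // => l _; under eq_bigr => j _ do rewrite scalerA.
  rewrite -scaler_suml; have /matrixP/(_ 0 l) := vB; rewrite !mxE => ->.
  by rewrite scale0r.
apply: contra nz => /eqP dz.
(* Multiplying row i by X^(b i) undoes the shift of exponents: the coefficient at K of an entry is
   then [mbin (b i) K] times that of [g j], and no leading monomial exceeds that of [g j]. *)
have : \det (diag_mx (\row_i 'X_[b i]) *m \matrix_(i, j) hasse (b i) (g j)) = 0.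
  by rewrite det_mulmx dz mulr0.
set M := _ *m _.
have ME i j K : (M i j)@_K = mbin (b i) K * (g j)@_K.
  rewrite /M mul_diag_mx !mxE /hasse mulr_sumr raddf_sum /=.
  have E a : a \in msupp (g j) -> ('X_[b i] * (((g j)@_a * mbin (b i) a) *: 'X_[a - b i]))@_K
      = if a == K then mbin (b i) K * (g j)@_K else 0.
    move=> _; rewrite -scalerAr mcoeffZ -mpolyXD mcoeffX.
    have [le|] := boolP (b i <= a)%MM; last first.
      rewrite -mbin_eq0 => /eqP z; rewrite z mulr0 mul0r; case: eqP => // <-.
      by rewrite z mul0r.
    rewrite addmC submK //; case: eqP => [->|_]; first by rewrite mulr1 mulrC.
    by rewrite mulr0.
  rewrite big_seq (eq_bigr _ E) -big_seq /=.
  have [Kp|Kp] := boolP (K \in msupp (g j)).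
    rewrite (bigD1_seq K) ?msupp_uniq //= eqxx big1 ?addr0 // => a ne.
    by rewrite (negbTE ne).
  rewrite big1_seq => [|a /andP[_ ap]].
    by move: Kp; rewrite -mcoeff_eq0 => /eqP ->; rewrite mulr0.
  by case: eqP => // aE; move: Kp; rewrite -aE ap.
have Mle i j : (mlead (M i j) <= mlead (g j))%O.
  have [->|nz] := eqVneq (M i j) 0; first by rewrite mlead0 le0m.
  apply: msupp_le_mlead; have := mlead_supp nz.
  by rewrite !mcoeff_msupp ME mulf_eq0 negb_or => /andP[].
move/(congr1 (mcoeff (\sum_j mlead (g j))%MM)); rewrite mcoeff0 => dM.
suff E : (\det M)@_(\sum_j mlead (g j))%MM =
    \det (\matrix_(i, j) mbin (b i) (mlead (g j))) * \prod_j mleadc (g j).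
  move/eqP: dM; rewrite E mulf_eq0 => /orP[//|/prodf_eq0 [j _]].
  by rewrite mleadc_eq0 (negbTE (gnz j)).
rewrite /determinant raddf_sum mulr_suml; apply: eq_bigr => s _.
have -> : (\sum_j mlead (g j) = \sum_j mlead (g (s j)))%MM.
  by rewrite (reindex_inj (@perm_inj _ s)).
have [E _] := mcoeff_prod_le (fun i => Mle i (s i)).
have -> : (-1) ^+ s = ((-1) ^+ s)%:MP :> {mpoly rat[n]}.
  by rewrite rmorphXn rmorphN rmorph1.
rewrite -[LHS]/(mcoeff _ _) mcoeffCM E -mulrA; congr (_ * _).
have -> : \prod_j mleadc (g j) = \prod_j mleadc (g (s j)).
  by rewrite (reindex_inj (@perm_inj _ s)).
by rewrite -big_split; apply: eq_bigr => i _; rewrite ME mxE.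
Qed.

End Hasse.

(** * Roth's lemma *)

Lemma taylor_dvdp (f : {poly rat}) (xi : rat) l :
  (forall j, (j < l)%N -> f^`N(j).[xi] = 0) -> ('X - xi%:P) ^+ l %| f.
Proof.
move=> fj; have -> : f = \sum_(i < size f) (f^`N(i).[xi])%:P * ('X - xi%:P) ^+ i.
  have := @nderiv_taylor _ (map_poly polyC f) xi%:P ('X - xi%:P) (mulrC _ _).
  rewrite addrC subrK -[X in X = _]/(f \Po 'X) comp_polyXr => {1}->.
  rewrite size_map_polyC; apply: eq_bigr => i _.
  by rewrite nderivn_map /= horner_map.
rewrite big_seq; apply: (big_ind (fun g => _ %| g)); first exact: dvdp0.
- exact: dvdp_add.
move=> i _; have [il|li] := ltnP i l; first by rewrite fj // polyC0 mul0r dvdp0.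
by rewrite dvdp_mull // dvdp_exp2l.
Qed.

(** Gauss's lemma: an integral multiple p1 of (X - xi)^l divides f over the integers. Comparing its
    extreme coefficients, denq xi ^ l divides the leading coefficient of p1, since numerator and
    denominator are coprime. *)
Lemma lead_coef_denq (f : {poly rat}) (xi : rat) l :
  f != 0 -> (forall i, f`_i \is a Num.int) ->
  (forall j, (j < l)%N -> f^`N(j).[xi] = 0) -> ((denq xi)%:~R : rat) ^+ l <= `|lead_coef f|.
Proof.
move=> f0 fi /taylor_dvdp dv.
pose F : {poly int} := map_poly Num.floor f.
have fF : f = map_poly intr F.
  apply/polyP => i; rewrite coef_map /= coef_map_id0 ?floor0 //.
  by rewrite floorK.
have F0 : F != 0 by apply: contra f0 => /eqP F0; rewrite fF F0 rmorph0.
rewrite fF in dv; have [p1 [a a0 pE] [r FE]] := dvdpP_rat_int dv.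
have lf : lead_coef f = (lead_coef F)%:~R.
  by rewrite fF lead_coef_map_inj // => x y /intr_inj.
have p10 : p1 != 0 by apply: contra F0 => /eqP p10; rewrite FE p10 mul0r.
have mon : ('X - xi%:P) ^+ l \is monic by rewrite monic_exp // monicXsubC.
have la : a * (lead_coef p1)%:~R = 1 :> rat.
  have := monicP mon; rewrite pE lead_coefZ lead_coef_map_inj //.
  by move=> x y /intr_inj.
have c0 : (- xi) ^+ l = a * (p1`_0)%:~R :> rat.
  have := congr1 (fun h : {poly rat} => h.[0]) pE.
  rewrite /= hornerZ [(map_poly _ _).[0] ]horner_coef0 coef_map_id0 // => <-.
  by rewrite horner_exp hornerD hornerX hornerN hornerC add0r.
have : (denq xi ^+ l %| lead_coef p1)%Z.
  have E : (numq (- xi)) ^+ l * lead_coef p1 = p1`_0 * (denq xi) ^+ l.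
    apply: (@intr_inj rat); rewrite !rmorphM !rmorphXn /=.
    have -> : (numq (- xi))%:~R = (- xi) * (denq xi)%:~R :> rat.
      by rewrite numqE denqN.
    rewrite exprMn c0; apply: (mulfI a0).
    transitivity ((a * (lead_coef p1)%:~R) * (a * (p1`_0)%:~R * (denq xi)%:~R ^+ l)); first by ring.
    by rewrite la mul1r mulrA.
  have : (denq xi ^+ l %| (numq (- xi)) ^+ l * lead_coef p1)%Z.
    by rewrite E dvdz_mull // dvdzz.
  rewrite Gauss_dvdzr // coprimezE !abszX coprimeXl // coprimeXr //.
  by rewrite coprime_sym -denqN coprime_num_den.
move=> dvl; have {dvl} : (denq xi ^+ l %| lead_coef F)%Z.
  by rewrite FE lead_coefM dvdz_mulr.
move/dvdzP => [c lF]; rewrite lf lF rmorphM normrM rmorphXn /=.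
have dp : 0 <= ((denq xi)%:~R : rat) ^+ l by rewrite exprn_ge0 // ler0z denq_ge0.
rewrite [X in _ <= _ * X]ger0_norm // -[leLHS]mul1r ler_wpM2r //.
rewrite -intr_norm ler1z -gtz0_ge1 normr_gt0.
by apply: contra F0 => /eqP c00; rewrite -lead_coef_eq0 lF c00 mul0r.
Qed.

Section OneVar.
Variable n : nat.
Implicit Types (p q : {mpoly rat[n]}) (v : 'I_n).

(** The polynomial ring stays fixed through the induction, so that polynomials in fewer variables
    are described by their supports. *)
Definition only v p := forall K, p@_K != 0 -> K = (U_(v) *+ K v)%MM.
Definition avoids v p := forall K, p@_K != 0 -> K v = 0%N.
Definition intp p := forall K, p@_K \is a Num.int.

(** The case of one variable of Roth's lemma: a high order of vanishing at xi v forces a large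
    leading coefficient. *)
Lemma one_var_bound v p d (e : rat) xi : only v p -> p != 0 -> intp p ->
  (forall K, p@_K != 0 -> (K v <= d)%N) ->
  (forall j, (trl xi p)@_(U_(v) *+ j)%MM != 0 -> (e : rat) <= j%:R) ->
  forall l : nat, (forall j, (j < l)%N -> j%:R < e) -> ((denq (xi v))%:~R : rat) ^+ l <= nrm p.
Proof.
move=> pv p0 pi pd pe l le.
pose f : {poly rat} := \poly_(j < d.+1) p@_(U_(v) *+ j)%MM.
have fE j : f`_j = p@_(U_(v) *+ j)%MM.
  rewrite coef_poly ltnS; case: leqP => // dj; apply/esym/eqP; apply: contraT => /pd.
  by rewrite mulmnE mnm1E eqxx mul1n leqNgt dj.
have f0 : f != 0.
  apply: contra p0 => /eqP f0; apply/eqP/mpolyP => K; rewrite mcoeff0.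
  by apply/eqP; apply: contraT => pK; have := pv _ pK; move: pK => /[swap] ->; rewrite -fE f0 coef0 eqxx.
apply: le_trans (lead_coef_denq f0 _ _) (_ : `|lead_coef f| <= nrm p) => //.
- by move=> i; rewrite fE.
- move=> j jl; have : (trl xi p)@_(U_(v) *+ j)%MM = 0.
    by apply/eqP; apply: contraT => /pe; rewrite leNgt le.
  rewrite mcoeff_trl => <-; rewrite /hasse raddf_sum /=.
  have E a : a \in msupp p -> ((p@_a * mbin (U_(v) *+ j) a) *: 'X_[a - U_(v) *+ j]).@[xi] =
     p@_a * (('C(a v, j))%:R * xi v ^+ (a v - j)).
    rewrite mcoeff_msupp => /pv aE; rewrite mevalZ mevalX -mulrA; congr (_ * _).
    rewrite (bigD1 v) //= mnmBE mulmnE mnm1E eqxx mul1n [X in _ * (_ * X)]big1 ?mulr1 => [|i iv].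
      congr (_ * _); rewrite /mbin (bigD1 v) //= mulmnE mnm1E eqxx mul1n big1 ?mulr1 // => i iv.
      by rewrite mulmnE mnm1E eq_sym (negbTE iv) mul0n bin0.
    by rewrite mnmBE aE mulmnE mnm1E eq_sym (negbTE iv) !mul0n sub0n expr0.
  rewrite big_seq (eq_bigr _ E) -big_seq.
  have -> : f = \sum_(a <- msupp p) p@_a *: 'X^(a v).
    apply/polyP => i; rewrite fE coef_sum.
    have E' a : a \in msupp p -> (p@_a *: 'X^(a v) : {poly rat})`_i =
        if a == (U_(v) *+ i)%MM then p@_(U_(v) *+ i)%MM else 0.
      rewrite mcoeff_msupp => /pv aE; rewrite coefZ coefXn.
      case: (eqVneq i (a v)) => [->|ne]; first by rewrite -aE eqxx mulr1.
      case: eqP => [a2|_]; last by rewrite mulr0.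
      by move: ne; rewrite a2 mulmnE mnm1E eqxx mul1n eqxx.
    rewrite big_seq (eq_bigr _ E') -big_seq /=.
    have [Kp|Kp] := boolP ((U_(v) *+ i)%MM \in msupp p).
      rewrite (bigD1_seq (U_(v) *+ i)%MM) ?msupp_uniq //= eqxx big1 ?addr0 // => a ne.
      by rewrite (negbTE ne).
    rewrite big1_seq => [|a /andP[_ ap]].
      by move: Kp; rewrite -mcoeff_eq0 => /eqP ->.
    by case: eqP => // aE; move: Kp; rewrite -aE ap.
  rewrite raddf_sum -[LHS]/(horner _ _) horner_sum; apply: eq_bigr => a _ /=.
  rewrite linearZ /= hornerZ; congr (_ * _).
  by rewrite nderivnXn hornerMn hornerXn mulr_natl.
- by rewrite lead_coefE fE nrm_coef.
Qed.

Lemma sep_coef v p q K : avoids v p -> only v q ->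
  (p * q)@_K = p@_(K - U_(v) *+ K v)%MM * q@_(U_(v) *+ K v)%MM.
Proof.
move=> pv qv; set K1 := (K - _)%MM; set K2 := (_ *+ K v)%MM.
have K12 : K = (K1 + K2)%MM.
  rewrite /K1 submK //; apply/mnm_lepP => i; rewrite mulmnE mnm1E.
  by case: eqVneq => [->|_]; rewrite ?mul1n.
have K1v : K1 v = 0%N by rewrite mnmBE mulmnE mnm1E eqxx mul1n subnn.
rewrite mpolyME raddf_sum big_allpairs_dep /=.
transitivity (\sum_(a <- msupp p) \sum_(c <- msupp q)
    (if a == K1 then p@_K1 else 0) * (if c == K2 then q@_K2 else 0)).
  rewrite !big_seq; apply: eq_bigr => a; rewrite mcoeff_msupp => /pv av.
  rewrite !big_seq; apply: eq_bigr => c; rewrite mcoeff_msupp => /qv cv.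
  rewrite mcoeffZ mcoeffX.
  case: (eqVneq (a + c)%MM K) => [E|ne].
    have Kc : K v = c v by rewrite -E mnmDE av add0n.
    have c2 : c = K2 by rewrite /K2 Kc.
    have a1 : a = K1 by rewrite /K1 -/K2 -E c2 addmK.
    by rewrite -c2 -a1 !eqxx mulr1.
  rewrite mulr0; case: eqP => [a1|_]; last by rewrite mul0r.
  case: eqP => [c2|_]; last by rewrite mulr0.
  by case/eqP: ne; rewrite a1 c2.
have S (r : {mpoly rat[n]}) L : \sum_(a <- msupp r) (if a == L then r@_L else 0) = r@_L.
  have [Kp|Kp] := boolP (L \in msupp r).
    rewrite (bigD1_seq L) ?msupp_uniq //= eqxx big1 ?addr0 // => a ne.
    by rewrite (negbTE ne).
  rewrite big1_seq => [|a /andP[_ ap]].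
    by move: Kp; rewrite -mcoeff_eq0 => /eqP ->.
  by case: eqP => // aE; move: Kp; rewrite -aE ap.
rewrite -[p@_K1 in RHS]S mulr_suml; apply: eq_bigr => a _.
by rewrite -mulr_sumr S.
Qed.

Lemma hasse_sep v (b c : 'X_{1..n}) p q : b v = 0%N -> c = (U_(v) *+ c v)%MM ->
  avoids v p -> only v q -> hasse (b + c)%MM (p * q) = hasse b p * hasse c q.
Proof.
move=> bv cv pv qv; rewrite [in LHS](mpolyE p) [in LHS](mpolyE q) mulr_suml raddf_sum.
rewrite [hasse b p]/hasse [hasse c q]/hasse mulr_suml !big_seq; apply: eq_bigr => a; rewrite mcoeff_msupp => /pv av.
rewrite mulr_sumr -[LHS]/(hasse _ _) raddf_sum mulr_sumr; apply: eq_bigr => e; rewrite mcoeff_msupp => /qv ev.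
rewrite -scalerAl -scalerAr scalerA -mpolyXD -[LHS]/(hasse _ _) linearZ /= hasseX.
rewrite -scalerAl -scalerAr !scalerA -mpolyXD; congr (_ *: 'X_[_]).
  rewrite -!mulrA; congr (_ * _); rewrite mulrCA; congr (_ * _).
  rewrite /mbin -big_split; apply: eq_bigr => i _ /=.
  rewrite !mnmDE; have [->|iv] := eqVneq i v; first by rewrite av bv !add0n bin0 mul1r.
  have -> : c i = 0%N by rewrite cv mulmnE mnm1E eq_sym (negbTE iv) mul0n.
  have -> : e i = 0%N by rewrite ev mulmnE mnm1E eq_sym (negbTE iv) mul0n.
  by rewrite !addn0 bin0 mulr1.
apply/mnmP => i; rewrite !(mnmDE, mnmBE).
have [->|iv] := eqVneq i v; first by rewrite av bv !add0n ?sub0n.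
have -> : c i = 0%N by rewrite cv mulmnE mnm1E eq_sym (negbTE iv) mul0n.
have -> : e i = 0%N by rewrite ev mulmnE mnm1E eq_sym (negbTE iv) mul0n.
by rewrite !addn0.
Qed.

Lemma avoids_sum v (I : Type) (s : seq I) (P : pred I) (E : I -> {mpoly rat[n]}) :
  (forall i, P i -> avoids v (E i)) -> avoids v (\sum_(i <- s | P i) E i).
Proof.
move=> h; apply: big_ind => // [K|p q hp hq K]; first by rewrite mcoeff0 eqxx.
rewrite mcoeffD; have [pz|/hp //] := eqVneq p@_K 0.
by rewrite pz add0r => /hq.
Qed.

End OneVar.

Lemma det_row_neq0 (R : comNzRingType) k (A : 'M[R]_k) i :
  \det A != 0 -> exists j, A i j != 0.
Proof.
move=> dA; apply/existsP; apply: contraR dA; rewrite negb_exists => /forallP h.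
rewrite (expand_det_row A i) big1 // => j _.
by move: (h j); rewrite negbK => /eqP ->; rewrite mul0r.
Qed.

(** The first floor(a k / 4) + 1 terms are each at least a / 2, because k <= r + 1 <= 2 r gives l /
    r <= a / 2 for them. *)
Lemma sum_max_ge (a : rat) (k r : nat) : 0 <= a <= 1 -> (0 < r)%N -> (k <= r.+1)%N ->
  k%:R * a ^+ 2 / 8 <= \sum_(l < k) Num.max 0 (a - l%:R / r%:R).
Proof.
case/andP=> a0 a1 r0 kr; case: k kr => [|k] kr; first by rewrite !mul0r big_ord0.
pose x : rat := a * k.+1%:R / 4.
have x0 : 0 <= x by rewrite /x divr_ge0 // mulr_ge0.
have /andP[cx xc] := truncn_itv x0.
set c := Num.truncn x in cx xc.
have rR : (0 : rat) < r%:R by rewrite ltr0n.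
have krR : k.+1%:R <= r%:R + 1 :> rat by rewrite -natr1 natr1 -[X in _ + X]/(1%:R) -natrD ler_nat addn1.
have r1 : 1 <= r%:R :> rat by rewrite ler1n.
have xk : x <= k.+1%:R / 4 by rewrite /x ler_pM2r // ler_piMl.
have ck : (c < k.+1)%N.
  have : c%:R <= k.+1%:R / 4 :> rat by apply: le_trans xk.
  rewrite -(ltr_nat rat) => h; apply: le_lt_trans h _.
  by have : (0 : rat) < k.+1%:R by []; lra.
apply: le_trans (_ : _ <= \sum_(l < k.+1 | (l < c.+1)%N) (a / 2)) _.
  rewrite sumr_const.
  have -> : #|(fun l : 'I_k.+1 => (l < c.+1)%N)| = c.+1.
    rewrite -[RHS]card_ord -[RHS](card_image (f := widen_ord ck)).
      apply: eq_card => l; rewrite [LHS]unfold_in; apply/idP/imageP => [lc|[j _ ->]].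
        by exists (Ordinal lc) => //; exact: val_inj.
      exact: (ltn_ord j).
    by move=> i j /(congr1 val) /= /val_inj.
  have -> : a / 2 *+ c.+1 = (c%:R + 1) * (a / 2) by rewrite natr1 mulr_natl.
  have h : x <= c%:R + 1 by rewrite natr1 ltW.
  have : x * (a / 2) <= (c%:R + 1) * (a / 2) by rewrite ler_wpM2r // divr_ge0.
  have -> : x * (a / 2) = k.+1%:R * a ^+ 2 / 8 by rewrite /x; field.
  by [].
rewrite [leRHS](bigID (fun l : 'I_k.+1 => (l < c.+1)%N)) /=.
rewrite -[leLHS]addr0 lerD //; last by apply: sumr_ge0 => l _; rewrite le_max lexx.
apply: ler_sum => l; rewrite ltnS => lc; rewrite le_max; apply/orP; right.
have lx : l%:R <= x by apply: le_trans cx; rewrite ler_nat.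
have : x <= a * r%:R / 2.
  have h1 : k.+1%:R <= 2 * r%:R :> rat by lra.
  have := ler_wpM2l a0 h1; rewrite /x; lra.
move=> xr; have : l%:R / r%:R <= a / 2.
  by rewrite ler_pdivrMr // mulrAC; apply: le_trans xr.
by lra.
Qed.

Section Roth.
Variable n : nat.
Implicit Types (p q P : {mpoly rat[n]}) (v : 'I_n).

Definition dle (d : 'I_n -> nat) p := forall K, p@_K != 0 -> forall h, (K h <= d h)%N.

Lemma dle_le d e p : (forall h, d h <= e h)%N -> dle d p -> dle e p.
Proof. by move=> de dp K pK h; exact: leq_trans (dp K pK h) (de h). Qed.

Lemma dleM d e p q : dle d p -> dle e q -> dle (fun h => d h + e h)%N (p * q).
Proof.
move=> dp eq K; rewrite -mcoeff_msupp => /msuppM_le/allpairsP [[a b] /=].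
rewrite !mcoeff_msupp => -[/dp ap /eq bq -> h]; rewrite mnmDE; exact: leq_add.
Qed.

Lemma dle_det k (A : 'M[{mpoly rat[n]}]_k) d :
  (forall i j, dle d (A i j)) -> dle (fun h => k * d h)%N (\det A).
Proof.
move=> dA; have dD p q e : dle e p -> dle e q -> dle e (p + q).
  move=> ep eq K h; have [pz|/ep //] := eqVneq p@_K 0; apply: eq.
  by move: h; rewrite mcoeffD pz add0r.
apply: big_ind; [by move=> K; rewrite mcoeff0 eqxx|by move=> p q; exact: dD|].
move=> s _; have d1 : dle (fun=> 0%N) ((-1) ^+ s : {mpoly rat[n]}).
  have -> : (-1) ^+ s = ((-1) ^+ s)%:MP :> {mpoly rat[n]} by rewrite rmorphXn rmorphN rmorph1.
  move=> K; rewrite mcoeffC; case: (eqVneq K 0%MM) => [-> _ h|_]; first by rewrite mnm0E.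
  by rewrite mulr0 eqxx.
apply: dle_le (dleM d1 _) => [h|]; first exact: leqnn.
have : dle (fun h => \sum_(i < k) d h)%N (\prod_i A i (s i)).
  elim: (index_enum _) => [|i e IH].
    rewrite big_nil => K; rewrite mcoeff1; case: (eqVneq K 0%MM) => [-> _ h|_].
      by rewrite mnm0E.
    by rewrite eqxx.
  rewrite big_cons; apply: dle_le (dleM (dA _ _) IH) => h.
  by rewrite big_cons.
by apply: dle_le => h; rewrite sum_nat_const card_ord.
Qed.

Lemma dle_hasse d b p : dle d p -> dle d (hasse b p).
Proof.
move=> dp K; rewrite mcoeff_hasse mulf_eq0 negb_or => /andP[/dp h _] i.
by apply: leq_trans (h i); rewrite mnmDE leq_addr.
Qed.

Lemma dle_trl d xi p : dle d p -> dle d (trl xi p).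
Proof.
move=> dp K /trl_supp [a /dp ha /mnm_lepP Ka] h.
exact: leq_trans (Ka h) (ha h).
Qed.

Lemma dle_avoids d v p : dle d p -> d v = 0%N -> avoids v p.
Proof. by move=> dp dv K /dp /(_ v); rewrite dv leqn0 => /eqP. Qed.

Lemma dle_only d v p : dle d p -> (forall h, h != v -> d h = 0%N) -> only v p.
Proof.
move=> dp dv K /dp h; apply/mnmP => i; rewrite mulmnE mnm1E eq_sym.
have [->|iv] := eqVneq i v; first by rewrite mul1n.
by apply/eqP; rewrite mul0n -leqn0 -(dv _ iv).
Qed.

Lemma vord_dec (w : 'I_n -> rat) t p :
  vord w t p \/ exists2 K, p@_K != 0 & lwt w K < t.
Proof.
have [/hasP [K Kp lt]|/hasPn h] := boolP (has (fun K => lwt w K < t) (msupp p)).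
  by right; exists K => //; rewrite -mcoeff_msupp.
by left=> K; rewrite -mcoeff_msupp => /h; rewrite -leNgt.
Qed.

Lemma nrm_sum_le (s : seq 'X_{1..n}) p : uniq s -> \sum_(K <- s) `|p@_K| <= nrm p.
Proof.
move=> us; rewrite (bigID (mem (msupp p))) /= [X in _ + X]big1 ?addr0 => [|K]; last first.
  by rewrite -mcoeff_eq0 => /eqP ->; rewrite normr0.
rewrite -big_filter nrmE [leRHS](bigID (mem s)) /=.
rewrite (perm_big [seq K <- msupp p | K \in s]); last first.
  apply: uniq_perm; rewrite ?filter_uniq ?msupp_uniq // => K.
  by rewrite !mem_filter andbC.
by rewrite big_filter lerDl sumr_ge0.
Qed.

Lemma nrm_ge1 p : p != 0 -> intp p -> 1 <= nrm p.
Proof.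
move=> p0 pi; have := mlead_supp p0; rewrite mcoeff_msupp => h.
by apply: le_trans (nrm_coef p (mlead p)); exact: norm_intr_ge1.
Qed.

(** The coefficients of [q@_c0 *: p] are some of those of p q. Thus factors with rational
    coefficients can be made integral without exceeding the norm of their product. *)
Lemma slice_l v p q c0 : avoids v p -> only v q -> q@_c0 != 0 ->
  intp (p * q) -> intp (q@_c0 *: p) /\ nrm (q@_c0 *: p) <= nrm (p * q).
Proof.
move=> pv qv q0 pqi; have c0E := qv _ q0.
have E K : p@_K != 0 -> (q@_c0 *: p)@_K = (p * q)@_(K + c0).
  move=> pK; rewrite mcoeffZ (sep_coef _ pv qv) mnmDE (pv _ pK) add0n -c0E addmK.
  by rewrite mulrC.
have Z K : (q@_c0 *: p)@_K != 0 -> p@_K != 0.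
  by rewrite mcoeffZ mulf_eq0 negb_or => /andP[].
split=> [K|].
  have [pz|pK] := eqVneq p@_K 0; first by rewrite mcoeffZ pz mulr0.
  by rewrite E.
apply: le_trans (nrm_sum_le (p * q) (s := [seq (K + c0)%MM | K <- msupp (q@_c0 *: p)]) _).
  rewrite big_map nrmE !big_seq; apply: ler_sum => K; rewrite mcoeff_msupp => /Z pK.
  by rewrite E.
by rewrite map_inj_uniq ?msupp_uniq //; exact: addIm.
Qed.

Lemma slice_r v p q a0 : avoids v p -> only v q -> p@_a0 != 0 ->
  intp (p * q) -> intp (p@_a0 *: q) /\ nrm (p@_a0 *: q) <= nrm (p * q).
Proof.
move=> pv qv p0 pqi; have a0v := pv _ p0.
have E K : q@_K != 0 -> (p@_a0 *: q)@_K = (p * q)@_(a0 + K).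
  move=> qK; rewrite mcoeffZ (sep_coef _ pv qv) mnmDE a0v add0n -(qv _ qK) addmK.
  by [].
have Z K : (p@_a0 *: q)@_K != 0 -> q@_K != 0.
  by rewrite mcoeffZ mulf_eq0 negb_or => /andP[].
split=> [K|].
  have [pz|pK] := eqVneq q@_K 0; first by rewrite mcoeffZ pz mulr0.
  by rewrite E.
apply: le_trans (nrm_sum_le (p * q) (s := [seq (a0 + K)%MM | K <- msupp (p@_a0 *: q)]) _).
  rewrite big_map nrmE !big_seq; apply: ler_sum => K; rewrite mcoeff_msupp => /Z pK.
  by rewrite E.
by rewrite map_inj_uniq ?msupp_uniq //; exact: addmI.
Qed.

(** Arrange the coefficients of P in a matrix, with the powers of X_v as rows and the other
    monomials as columns, and factor it through its rank: the independence of the two families is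
    the freeness of the row and column bases. *)
Lemma rank_factor v d P : dle d P -> P != 0 -> exists k f g,
  [/\ P = \sum_(i < k) f i * g i, indep f, indep g, (0 < k <= (d v).+1)%N &
      (forall i, dle (fun h => if h == v then 0%N else d h) (f i)) /\
      (forall i, dle (fun h => if h == v then d v else 0%N) (g i))].
Proof.
move=> dP P0; pose red (K : 'X_{1..n}) := (K - U_(v) *+ K v)%MM.
pose sM := undup [seq red K | K <- msupp P]; pose N := size sM.
pose mon (c : 'I_N) := nth 0%MM sM c.
have moninj : injective mon.
  move=> c c' /eqP; rewrite nth_uniq ?undup_uniq ?ltn_ord // => /eqP.
  exact: val_inj.
have monP c : exists2 K, P@_K != 0 & mon c = red K.
  have : mon c \in sM by rewrite mem_nth.
  by rewrite mem_undup => /mapP [K]; rewrite mcoeff_msupp => ? ?; exists K.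
have redv K : red K v = 0%N by rewrite mnmBE mulmnE mnm1E eqxx mul1n subnn.
have redh K h : h != v -> red K h = K h.
  by move=> hv; rewrite mnmBE mulmnE mnm1E eq_sym (negbTE hv) mul0n subn0.
have redK K : K = (red K + U_(v) *+ K v)%MM.
  apply/mnmP => h; rewrite mnmDE mulmnE mnm1E eq_sym.
  have [->|hv] := eqVneq h v; first by rewrite redv mul1n.
  by rewrite redh // mul0n addn0.
pose C : 'M[rat]_((d v).+1, N) := \matrix_(j, c) P@_(mon c + U_(v) *+ j)%MM.
have PE : P = \sum_(j < (d v).+1) \sum_(c < N) C j c *: ('X_[mon c] * 'X_[U_(v) *+ j]).
  apply/mpolyP => K; rewrite raddf_sum /=.
  transitivity (\sum_(j < (d v).+1) \sum_(c < N) P@_K * ((mon c + U_(v) *+ j)%MM == K)%:R).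
    have [->|PK] := eqVneq P@_K 0.
      by rewrite big1 // => j _; rewrite big1 // => c _; rewrite mul0r.
    have Kd := dP _ PK v; rewrite -ltnS in Kd.
    have ic : (index (red K) sM < N)%N.
      by rewrite index_mem mem_undup; apply/mapP; exists K; rewrite ?mcoeff_msupp.
    have monK : mon (Ordinal ic) = red K.
      by apply: nth_index; rewrite -index_mem.
    rewrite (bigD1 (Ordinal Kd)) //= (bigD1 (Ordinal ic)) //= monK -redK eqxx mulr1.
    rewrite big1 ?addr0 => [|c cne]; last first.
      case: eqP => [E|_]; last by rewrite mulr0.
      case/eqP: cne; apply: moninj; rewrite monK.
      by move: E; rewrite {2}(redK K) => /addIm.
    rewrite big1 ?addr0 // => j jne; rewrite big1 // => c _.
    case: eqP => [E|_]; last by rewrite mulr0.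
    case/eqP: jne; apply: val_inj => /=; rewrite -E mnmDE mulmnE mnm1E eqxx mul1n.
    by have [L _ ->] := monP c; rewrite redv.
  apply: eq_bigr => j _; rewrite -[RHS]/(mcoeff K _) raddf_sum; apply: eq_bigr => c _.
  rewrite -[RHS]/(mcoeff K _) mcoeffZ -mpolyXD mcoeffX mxE; case: eqP => [->|] //.
  by rewrite !mulr0.
pose k := \rank C.
pose f (i : 'I_k) := \sum_(c < N) row_base C i c *: 'X_[mon c].
pose g (i : 'I_k) := \sum_(j < (d v).+1) col_base C j i *: 'X_[U_(v) *+ j] : {mpoly rat[n]}.
have PE' : P = \sum_(i < k) f i * g i.
  rewrite {1}PE -{1}[C]mulmx_base.
  under eq_bigr => j _ do under eq_bigr => c _ do rewrite mxE scaler_suml.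
  under eq_bigr => j _ do rewrite exchange_big /=.
  rewrite exchange_big /=; apply: eq_bigr => i _.
  rewrite /f /g mulr_suml exchange_big /=; apply: eq_bigr => c _.
  rewrite mulr_sumr; apply: eq_bigr => j _.
  by rewrite -scalerAl -scalerAr scalerA mulrC.
exists k, f, g; split=> //.
- move=> c hc i; have /row_freeP [B CB] := row_base_free C.
  have : (\row_i c i) *m row_base C = 0.
    apply/rowP => l; have E := congr1 (mcoeff (mon l)) hc.
    rewrite mcoeff0 raddf_sum in E; rewrite !mxE -[RHS]E; apply: eq_bigr => j _.
    rewrite mxE -[RHS]/(mcoeff _ (_ *: _)) mcoeffZ /f raddf_sum /= (bigD1 l) //= mcoeffZ mcoeffX eqxx mulr1.
    rewrite big1 ?addr0 // => c' ne; rewrite mcoeffZ mcoeffX.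
    by rewrite (inj_eq moninj) (negbTE ne) mulr0.
  move/(congr1 (mulmx^~ B)); rewrite -mulmxA CB mulmx1 mul0mx => /rowP /(_ i).
  by rewrite !mxE.
- move=> c hc i; have /row_fullP [B CB] := col_base_full C.
  have : col_base C *m (\col_i c i) = 0.
    apply/colP => l; have E := congr1 (mcoeff (U_(v) *+ l)%MM) hc.
    rewrite mcoeff0 raddf_sum in E; rewrite mxE [RHS]mxE -[RHS]E; apply: eq_bigr => j _.
    rewrite [(\col_i c i) _ _]mxE -[RHS]/(mcoeff _ (_ *: _)) mcoeffZ /g raddf_sum /= (bigD1 l) //= mcoeffZ mcoeffX eqxx mulr1.
    rewrite big1 ?addr0 1?mulrC // => c' ne; rewrite mcoeffZ mcoeffX.
    case: eqP => [E'|_]; last by rewrite mulr0.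
    case/eqP: ne; apply: val_inj; move/mnmP/(_ v): E'.
    by rewrite !mulmnE mnm1E eqxx !mul1n.
  move/(congr1 (mulmx B)); rewrite mulmxA CB mul1mx mulmx0 => /colP /(_ i).
  by rewrite !mxE.
- rewrite rank_leq_row andbT lt0n; apply: contra P0; rewrite /k => /eqP k0.
  by rewrite PE' big1 // => -[i hi] _; have hi2 := hi; rewrite /k k0 in hi2.
split=> i.
  move=> K fK h; have [c /eqP Kc] : exists c, K == mon c.
    apply/existsP; apply: contraR fK; rewrite negb_exists => /forallP ne.
    rewrite raddf_sum big1 // => c _; rewrite /= mcoeffZ mcoeffX eq_sym.
    by rewrite (negbTE (ne c)) mulr0.
  rewrite Kc; have [L PL ->] := monP c; case: eqP => [->|/eqP hv]; first by rewrite redv.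
  by rewrite redh // dP.
move=> K gK h; have [j Kj] : exists j : 'I_(d v).+1, K == (U_(v) *+ j)%MM.
  apply/existsP; apply: contraR gK; rewrite negb_exists => /forallP ne.
  rewrite raddf_sum big1 // => c _; rewrite /= mcoeffZ mcoeffX eq_sym.
  by rewrite (negbTE (ne c)) mulr0.
rewrite (eqP Kj) mulmnE mnm1E eq_sym; case: eqP => _; last by rewrite mul0n.
by rewrite mul1n -ltnS ltn_ord.
Qed.

End Roth.

Lemma fact_le_exp k M : (k <= M)%N -> (k`! <= M ^ k)%N.
Proof.
elim: k => [|k IH] kM; first by rewrite expn0.
by rewrite factS expnS leq_mul // IH // ltnW.
Qed.

Lemma lerX (x y : rat) k : 0 <= x -> x <= y -> x ^+ k <= y ^+ k.
Proof. by move=> x0 xy; rewrite lerXn2r ?nnegrE // (le_trans x0). Qed.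

Section RothStep.
Variable n : nat.
Implicit Types (p q P : {mpoly rat[n]}) (v : 'I_n).

Definition qd (xi : 'I_n -> rat) h : rat := (denq (xi h))%:~R.

(* The first m variables are the active ones; the induction is on m with the
   polynomial ring fixed. *)
Definition roth_at m (eps : rat) (D : nat) :=
  forall (r : 'I_n -> nat) (xi : 'I_n -> rat) (P : {mpoly rat[n]}) (R : nat),
  (forall h : 'I_n, (h < m)%N -> (0 < r h <= R)%N) ->
  (forall h h' : 'I_n, (h < h')%N -> (h' < m)%N -> (D * r h' <= r h)%N) ->
  (forall h : 'I_n, (h < m)%N -> (2 ^+ R * nrm P) ^+ D <= qd xi h ^+ r h) ->
  P != 0 -> intp P -> dle (fun h => if (h < m)%N then r h else 0%N) P ->
  ~ vord (fun h => (r h)%:R^-1) eps (trl xi P).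

Lemma roth0 eps : 0 < eps -> roth_at 0 eps 1.
Proof.
move=> e0 r xi P R _ _ _ P0 Pi Pd Pv.
have PC : P = (P@_0)%:MP.
  apply/mpolyP => K; rewrite mcoeffC; case: (eqVneq K 0%MM) => [->|K0].
    by rewrite mulr1.
  rewrite mulr0; apply/eqP; apply: contraNT K0 => /Pd h.
  by apply/eqP/mnmP => i; rewrite mnm0E; apply/eqP; rewrite -leqn0 h.
have c0 : P@_0 != 0 by apply: contra P0 => /eqP c0; rewrite PC c0.
have := Pv 0%MM; rewrite PC /trl mmapC mcoeffC eqxx mulr1 => /(_ c0).
rewrite /lwt big1 => [|i _]; last by rewrite mnm0E mulr0.
by rewrite leNgt e0.
Qed.

Lemma lwtZ k (r : 'I_n -> nat) K :
  lwt (fun h => (k * r h)%:R^-1) K = k%:R^-1 * lwt (fun h => (r h)%:R^-1) K.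
Proof.
by rewrite /lwt mulr_sumr; apply: eq_bigr => h _; rewrite natrM invfM mulrA.
Qed.

(** The factor 2^(k R) on the left is the one that [roth_at] asks for once the degrees are
    multiplied by k. As k <= R + 1 <= 2^R, the factorial costs another 2^(k R), and the entries cost
    2^(n R k): in all n + 2. *)
Lemma wronskian_nrm k R P (W : 'M[{mpoly rat[n]}]_k) : P != 0 -> intp P ->
  (0 < R)%N -> (k <= R.+1)%N -> (forall i l, nrm (W i l) <= 2 ^+ (n * R) * nrm P) ->
  2 ^+ (k * R) * nrm (\det W) <= (2 ^+ R * nrm P) ^+ (n.+2 * k).
Proof.
move=> P0 Pi R0 kR Wb; have P1 := nrm_ge1 P0 Pi.
have nP0 : 0 <= nrm P := nrm_ge0 _.
have E0 : 0 <= 2 ^+ (n * R) * nrm P by rewrite mulr_ge0 // exprn_ge0.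
apply: le_trans (_ : _ <= 2 ^+ (k * R) * ((k`!)%:R * (2 ^+ (n * R) * nrm P) ^+ k)) _.
  by rewrite ler_wpM2l ?exprn_ge0 // nrm_det.
have kf : (k`!)%:R <= (2 ^+ R) ^+ k :> rat.
  rewrite -!natrX ler_nat; apply: fact_le_exp.
  by apply: leq_trans kR _; exact: ltn_expl.
apply: le_trans (_ : _ <= (2 ^+ R * (2 ^+ R * (2 ^+ (n * R) * nrm P))) ^+ k) _.
  rewrite [leRHS]exprMn [in X in _ <= _ * X]exprMn mulnC [2 ^+ (R * k)]exprM.
  rewrite ler_wpM2l ?exprn_ge0 //.
  by rewrite ler_wpM2r // exprn_ge0.
rewrite [leRHS]exprM; apply: lerX; first by rewrite !mulr_ge0 // exprn_ge0.
rewrite [leRHS]exprMn -[(2 ^+ R) ^+ _]exprM (_ : (R * n.+2 = R + (R + n * R))%N); last by lia.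
rewrite [leLHS](_ : _ = 2 ^+ (R + (R + n * R)) * nrm P); last by rewrite !exprD !mulrA.
rewrite ler_wpM2l ?exprn_ge0 // -[leLHS]expr1.
exact: ler_weXn2l.
Qed.

(** A determinant W of derivatives of P inherits a large index from P. It is also a product U V,
    with U free of X_v and V in X_v alone; the index of U is small by induction and that of V by
    [one_var_bound]. *)
Lemma roth_step m (hm : (m < n)%N) :
  (forall eps, 0 < eps -> exists2 D, (0 < D)%N & roth_at m eps D) ->
  forall eps, 0 < eps -> exists2 D, (0 < D)%N & roth_at m.+1 eps D.
Proof.
move=> IH eps eps0; pose e := Num.min eps 1.
have e0 : 0 < e by rewrite lt_min eps0 ltr01.
have e1 : e <= 1 by rewrite ge_min lexx orbT.
(* The two factors have index below k d each, and W has index at least k (3 e / 4)^2 / 8 = 9 k e^2 /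
   128. This value of d makes 2 k d = 8 k e^2 / 128. *)
pose d := e ^+ 2 / 32.
have d0 : 0 < d by rewrite divr_gt0 // exprn_gt0.
have [D1 D10 HD1] := IH d d0.
pose D2 := (Num.truncn d^-1).+1.
have D2d : 1 <= d * D2%:R.
  have /andP[_ h] : (Num.truncn d^-1)%:R <= d^-1 < (Num.truncn d^-1).+1%:R.
    by apply: truncn_itv; rewrite invr_ge0 ltW.
  by rewrite -[leLHS](mulfV (x := d)) ?gt_eqF // ler_wpM2l ?ltW.
pose D3 := (Num.truncn (e / 4)^-1).+1.
have D3e : D3%:R^-1 <= e / 4.
  have e40 : 0 < e / 4 by rewrite divr_gt0.
  have /andP[_ h] : (Num.truncn (e / 4)^-1)%:R <= (e / 4)^-1 < D3%:R.
    by apply: truncn_itv; rewrite invr_ge0 ltW.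
  by rewrite invf_ple ?posrE ?ltr0n // ltW.
(* D1 and D2 take care of U and V, at the exponent n + 2 of [wronskian_nrm]; D3 makes the derivative
   [b i] cost at most e / 4, since it acts on variables whose degrees are at least D times that of
   X_v. *)
pose D := (n.+2 * (D1 * D2) + D3)%N.
exists D => [|r xi P R rR rD Pq P0 Pi Pd Pv]; first by rewrite /D addnS.
pose v : 'I_n := Ordinal hm.
have [k [f [g [PE fi gi /andP[k0 kd] [fd gd]]]]] := rank_factor v Pd P0.
have vm : (v < m.+1)%N by [].
rewrite /= ltnSn in kd fd gd.
have [b bi Unz] := wronskian fi; have [c ci Vnz] := wronskian gi.
set U := \det _ in Unz; set V := \det _ in Vnz.
have /andP[rv0 rvR] := rR v vm.
have R0 : (0 < R)%N by exact: leq_trans rvR.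
have fav i : avoids v (f i) by apply: dle_avoids (fd i) _; rewrite eqxx.
have gon i : only v (g i) by apply: dle_only (gd i) _ => h /negbTE ->.
(* Here [b i] only involves the first m variables and [c l] only X_v, so [hasse_sep] turns W into a
   product of the two Wronskian matrices. *)
pose W : 'M[{mpoly rat[n]}]_k := \matrix_(i, l) hasse (b i + c l)%MM P.
have bP i (h : 'I_n) : (m <= h)%N -> b i h = 0%N.
  move=> mh; have [j] := det_row_neq0 i Unz; rewrite mxE => bf.
  have := mlead_supp bf; rewrite mcoeff_msupp mcoeff_hasse mulf_eq0 negb_or => /andP[/fd /(_ h) + _].
  rewrite mnmDE; case: eqP => [_|hv]; last rewrite ltnS.
    by rewrite leqn0 addn_eq0 => /andP[_ /eqP].
  have -> : (h <= m)%N = false.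
    by apply/negbTE; rewrite -ltnNge ltn_neqAle mh andbT; apply/eqP => E; apply: hv; exact: val_inj.
  by rewrite leqn0 addn_eq0 => /andP[_ /eqP].
have cP l : c l = (U_(v) *+ c l v)%MM.
  have [j] := det_row_neq0 l Vnz; rewrite mxE => cg.
  have := mlead_supp cg; rewrite mcoeff_msupp mcoeff_hasse mulf_eq0 negb_or => /andP[/gd h _].
  apply/mnmP => i; rewrite mulmnE mnm1E eq_sym; case: eqP => [->|/eqP iv]; first by rewrite mul1n.
  by have := h i; rewrite (negbTE iv) leqn0 mnmDE addn_eq0 => /andP[_ /eqP].
have WUV : \det W = U * V.
  have -> : W = (\matrix_(i, j) hasse (b i) (f j)) *m (\matrix_(i, j) hasse (c i) (g j))^T.
    apply/matrixP => i l; rewrite !mxE PE raddf_sum; apply: eq_bigr => j _.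
    by rewrite !mxE; apply: hasse_sep (cP l) (fav j) (gon j); exact: bP.
  by rewrite det_mulmx det_tr.
have Ud : dle (fun h => k * (if (h < m)%N then r h else 0))%N U.
  apply: dle_det => i j; rewrite mxE; apply: dle_hasse; apply: dle_le (fd j) => h.
  case: eqP => // hv; suff -> : (h < m.+1)%N = (h < m)%N by [].
  by rewrite ltnS leq_eqVlt; case: (eqVneq (h : nat) m) => // E; case: hv; exact: val_inj.
have Vd : dle (fun h => k * (if h == v then r v else 0))%N V.
  by apply: dle_det => i j; rewrite mxE; exact/dle_hasse/gd.
clearbody U V.
have Uav : avoids v U by apply: dle_avoids Ud _; rewrite /= ltnn muln0.
have Von : only v V by apply: dle_only Vd _ => h /negbTE ->; rewrite muln0.
have Wint : intp (U * V).
  rewrite -WUV /determinant => K; rewrite raddf_sum rpred_sum // => s _.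
  have : intp (\prod_i W i (s i)).
    elim: (index_enum _) => [|i t IHt].
      by rewrite big_nil => L; rewrite mcoeff1; case: (_ == _).
    rewrite big_cons => L; rewrite mcoeffM rpred_sum // => -[u w] _ /=.
    apply: rpredM => //; rewrite mxE mcoeff_hasse rpredM // /mbin rpred_prod // => z _.
    exact: intr_nat.
  move=> h; have -> : (-1) ^+ s = ((-1) ^+ s)%:MP :> {mpoly rat[n]}.
    by rewrite rmorphXn rmorphN rmorph1.
  by rewrite -[X in X \in _]/(mcoeff _ _) mcoeffCM rpredM // rpredX // rpredN rpred1.
have V0 := mlead_supp Vnz; rewrite mcoeff_msupp in V0.
have U0 := mlead_supp Unz; rewrite mcoeff_msupp in U0.
(* U and V need not be integral, but U V = det W is; the slices restore integrality and keep the
   norm bound. *)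
have [U'int U'n] := slice_l Uav Von V0 Wint.
have [V'int V'n] := slice_r Uav Von U0 Wint.
set U' := _ *: U in U'int U'n; set V' := _ *: V in V'int V'n.
have U'0 : U' != 0 by rewrite mscalerI negb_or V0.
have V'0 : V' != 0 by rewrite mscalerI negb_or U0.
pose N := 2 ^+ R * nrm P.
have P1 := nrm_ge1 P0 Pi.
have N1 : 1 <= N by rewrite mulr_ege1 // exprn_ege1 // ler1n.
have N0 : 0 <= N by exact: le_trans N1.
have kR : (k <= R.+1)%N by exact: leq_trans kd _.
have Wn : 2 ^+ (k * R) * nrm (U * V) <= N ^+ (n.+2 * k).
  rewrite -WUV; apply: wronskian_nrm => // i l; rewrite mxE.
  apply: nrm_hasse => a /Pd ha h; apply: leq_trans (ha h) _.
  by case: ifP => // hm'; have /andP[] := rR h hm'.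
have Nq (h : 'I_n) (E : nat) : (h < m.+1)%N -> (E <= D1 * D2)%N ->
    (N ^+ (n.+2 * k)) ^+ E <= qd xi h ^+ (k * r h).
  move=> hh EE.
  have -> : (N ^+ (n.+2 * k)) ^+ E = (N ^+ (n.+2 * E)) ^+ k by rewrite -!exprM mulnAC.
  rewrite [(k * r h)%N]mulnC [leRHS]exprM.
  have le1 : N ^+ (n.+2 * E) <= N ^+ D.
    by apply: ler_weXn2l => //; rewrite /D; apply: leq_trans (leq_addr _ _); rewrite leq_mul2l EE orbT.
  by apply: lerX; [rewrite exprn_ge0|exact: le_trans le1 (Pq h hh)].
have D1D : (D1 <= D)%N.
  by rewrite /D; apply: leq_trans (leq_addr _ _); rewrite mulnCA leq_pmulr // muln_gt0.
(* The induction hypothesis for the degrees k r, which also multiplies the index by k when it is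
   measured with r. *)
have [K UK Kd] : exists2 K, (trl xi U')@_K != 0 &
    lwt (fun h => (r h)%:R^-1) K < k%:R * d.
  have [vU|[K UK lt]] := vord_dec (fun h => (k * r h)%:R^-1) d (trl xi U'); last first.
    exists K => //; move: lt; rewrite lwtZ mulrC ltr_pdivrMr ?ltr0n // mulrC //.
  case: (HD1 (fun h => k * r h)%N xi U' (k * R)%N _ _ _ U'0 U'int _ vU) => [h hm'|h h' hh hm'|h hm'|].
  - have /andP[r0 rr] := rR h (ltnW hm'); by rewrite muln_gt0 k0 r0 leq_mul2l rr orbT.
  - rewrite mulnCA leq_mul2l; apply/orP; right; apply: leq_trans (rD h h' hh (ltnW hm')).
    by rewrite leq_mul2r D1D orbT.
  - apply: le_trans (Nq h D1 (ltnW hm') _); last by rewrite leq_pmulr.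
    apply: lerX; first by rewrite mulr_ge0 ?nrm_ge0 // exprn_ge0.
    by apply: le_trans Wn; apply: ler_wpM2l U'n; exact: exprn_ge0.
  - move=> L; rewrite mcoeffZ mulf_eq0 negb_or => /andP[_ /Ud h] i; apply: leq_trans (h i) _.
    by case: ifP => //; rewrite muln0.
(* Otherwise V' vanishes to an order l >= k d r_v, so the denominator to the power l D2 >= k r_v is
   at most [nrm V' ^+ D2]. The hypothesis on denominators bounds it below with an extra 2^(k R D2),
   which makes the contradiction strict. *)
have [L VL Ld] : exists2 L, (trl xi V')@_L != 0 &
    lwt (fun h => (r h)%:R^-1) L < k%:R * d.
  have [vV|//] := vord_dec (fun h => (r h)%:R^-1) (k%:R * d) (trl xi V').
  exfalso; have V'd : dle (fun h => k * (if h == v then r v else 0))%N V'.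
    by move=> L; rewrite mcoeffZ mulf_eq0 negb_or => /andP[_ /Vd].
  have V'on : only v V' by apply: dle_only V'd _ => h /negbTE ->; rewrite muln0.
  pose x := k%:R * d * (r v)%:R.
  have rvR0 : (0 : rat) < (r v)%:R by rewrite ltr0n.
  have x0 : 0 <= x by rewrite /x mulr_ge0 ?ler0n // mulr_ge0 ?ler0n // ltW.
  have kRR : (0 : rat) < k%:R by rewrite ltr0n.
  have hV j : (trl xi V')@_(U_(v) *+ j)%MM != 0 -> x <= j%:R.
    move/vV; rewrite /lwt (bigD1 v) //= big1 ?addr0 => [|h hv]; last first.
      by rewrite mulmnE mnm1E eq_sym (negbTE hv) mul0n mulr0.
    by rewrite mulmnE mnm1E eqxx mul1n [_^-1 * _]mulrC ler_pdivlMr.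
  have xl : exists l : nat, x <= l%:R.
    by exists (Num.truncn x).+1; have /andP[_ /ltW] := truncn_itv x0.
  have lx := ex_minnP xl; case: lx => l xl' lmin.
  have := one_var_bound V'on V'0 V'int (d := (k * r v)%N) _ hV (l := l) _.
  have vle K' : V'@_K' != 0 -> (K' v <= k * r v)%N by move/V'd/(_ v); rewrite eqxx.
  move=> /(_ vle) h; have {h} : qd xi v ^+ l <= nrm V'.
    by apply: h => j jl; rewrite ltNge; apply: contraL jl => /lmin; rewrite -leqNgt.
  move=> qV; have q1 : 1 <= qd xi v by rewrite /qd ler1z -gtz0_ge1 denq_gt0.
  have h1 : (2 ^+ (k * R) * nrm V') ^+ D2 <= qd xi v ^+ (k * r v).
    apply: le_trans (Nq v D2 vm _); last by rewrite leq_pmull.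
    apply: lerX; first by rewrite mulr_ge0 ?nrm_ge0 // exprn_ge0.
    by apply: le_trans Wn; apply: ler_wpM2l V'n; exact: exprn_ge0.
  have h2 : qd xi v ^+ (k * r v) <= (nrm V') ^+ D2.
    apply: le_trans (_ : _ <= qd xi v ^+ (l * D2)) _.
      apply: ler_weXn2l => //; rewrite -(ler_nat rat) !natrM.
      apply: le_trans (_ : _ <= x * D2%:R) _; last by rewrite ler_wpM2r.
      rewrite (_ : x * D2%:R = k%:R * (r v)%:R * (d * D2%:R)); last by rewrite /x; ring.
      by rewrite -[leLHS]mulr1 ler_wpM2l // mulr_ge0.
    by rewrite exprM lerX // exprn_ge0 // (le_trans _ q1).
  have V1 := nrm_ge1 V'0 V'int.
  have h3 : (nrm V') ^+ D2 < (2 ^+ (k * R) * nrm V') ^+ D2.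
    rewrite ltrXn2r // ?nnegrE ?mulr_ge0 ?nrm_ge0 ?exprn_ge0 //.
    rewrite ltr_pMl ?(lt_le_trans _ V1) // exprn_egt1 ?ltr1n //.
    by rewrite -lt0n muln_gt0 k0.
  by have := lt_le_trans h3 (le_trans h1 h2); rewrite ltxx.
have trUV : (trl xi (\det W))@_(K + L) != 0.
  have tUav : avoids v (trl xi U) by apply: (@dle_avoids n _ v _ (@dle_trl n _ xi _ Ud)); rewrite /= ltnn muln0.
  have tVon : only v (trl xi V) by apply: (@dle_only n _ v _ (@dle_trl n _ xi _ Vd)) => h /negbTE ->; rewrite muln0.
  have tZ (a : rat) p : trl xi (a *: p) = a *: trl xi p.
    by rewrite -!mul_mpolyC rmorphM /= /trl mmapC.
  have UK' : (trl xi U)@_K != 0.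
    by apply: contra UK => /eqP z; rewrite /U' tZ mcoeffZ z mulr0.
  have VL' : (trl xi V)@_L != 0.
    by apply: contra VL => /eqP z; rewrite /V' tZ mcoeffZ z mulr0.
  have -> : trl xi (\det W) = trl xi U * trl xi V by rewrite WUV rmorphM.
  rewrite (sep_coef _ tUav tVon) mnmDE (tUav _ UK') add0n -(tVon _ VL') addmK.
  exact: mulf_neq0.
(* From e one loses at most e / 4 by [b i] and l / r_v by [c l]. The bound depends on the column
   only, as [vord_det] requires, and is cut at 0, which is always a valid index. *)
pose gg (l : 'I_k) : rat := Num.max 0 (3 * e / 4 - l%:R / (r v)%:R).
have w0 h : (0 : rat) <= (r h)%:R^-1 by rewrite invr_ge0.
have Wv : vord (fun h => (r h)%:R^-1) (\sum_l gg l) (trl xi (\det W)).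
  rewrite -det_map_mx; apply: vord_det => // i l; rewrite !mxE /gg.
  have [le|lt] := leP (3 * e / 4 - l%:R / (r v)%:R) 0; first exact: vord_ge0.
  have hvo := @vord_hasse n _ _ xi (b i + c l)%MM P w0 Pv.
  apply: (vord_le _ hvo); rewrite lwtD opprD addrA.
  have lb : lwt (fun h => (r h)%:R^-1) (b i) <= e / 4.
    apply: le_trans (_ : _ <= \sum_(h < n) (D%:R * (r v)%:R)^-1 * (b i h)%:R) _.
      apply: ler_sum => h _; have [mh|hm'] := leqP m h; first by rewrite bP // !mulr0.
      rewrite ler_wpM2r // lef_pV2 ?posrE ?ltr0n //; last 2 first.
      - by have /andP[] := rR h (ltnW hm').
      - by rewrite mulr_gt0 // ltr0n // /D addnS.
      by rewrite -natrM ler_nat; exact: rD.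
    rewrite -mulr_sumr -natr_sum -mdegE.
    apply: le_trans (_ : _ <= (D%:R * (r v)%:R)^-1 * (r v)%:R) _.
      rewrite ler_wpM2l ?invr_ge0 ?mulr_ge0 // ler_nat.
      by apply: leq_trans (bi i) _; rewrite -ltnS (leq_trans (ltn_ord i)).
    rewrite invfM mulfVK ?pnatr_eq0 -?lt0n //.
    apply: le_trans D3e; rewrite lef_pV2 ?posrE ?ltr0n //; last by rewrite /D addnS.
    by rewrite ler_nat leq_addl.
  have lc : lwt (fun h => (r h)%:R^-1) (c l) <= l%:R / (r v)%:R.
    rewrite cP /lwt (bigD1 v) //= big1 ?addr0 => [|h hv]; last first.
      by rewrite mulmnE mnm1E eq_sym (negbTE hv) mul0n mulr0.
    rewrite mulmnE mnm1E eqxx mul1n [_^-1 * _]mulrC ler_wpM2r // ler_nat.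
    apply: leq_trans (ci l); rewrite mdegE (bigD1 v) //= leq_addr //.
  have ee : e <= eps by rewrite ge_min lexx.
  by lra.
have := Wv _ trUV; rewrite lwtD => h1.
have h2 : k%:R * (3 * e / 4) ^+ 2 / 8 <= \sum_l gg l.
  have e34 : 0 <= 3 * e / 4 <= 1.
    by move: e0 e1; clear; move: e => x x0 x1; apply/andP; split; lra.
  by apply: sum_max_ge.
have h3 : k%:R * d * 2 <= k%:R * (3 * e / 4) ^+ 2 / 8.
  rewrite -!mulrA ler_wpM2l // /d; have : 0 <= e ^+ 2 by rewrite exprn_ge0 // ltW.
  by rewrite !expr2; lra.
have : \sum_l gg l < k%:R * d * 2 by apply: le_lt_trans h1 _; lra.
by rewrite ltNge (le_trans h3 h2).
Qed.

Lemma roth m : (m <= n)%N -> forall eps, 0 < eps -> exists2 D, (0 < D)%N & roth_at m eps D.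
Proof.
elim: m => [|m IH] mn eps e0; first by exists 1%N => //; exact: roth0.
by apply: roth_step => //; apply: IH; exact: ltnW.
Qed.

End RothStep.

(** * Siegel's lemma and the counting of monomials *)

(** The box principle on vectors with entries in [0, H], H = #|I| A. Replacing x by H - x where the
    coefficient is negative only translates each linear form and puts its values in [0, H^2]; and
    (H^2 + 1)^#|J| < (H + 1)^(2 #|J|) <= (H + 1)^#|I|. *)
Lemma siegel (I J : finType) (a : J -> I -> int) (A : nat) :
  (0 < A)%N -> (forall j i, (`|a j i| <= A)%N) -> (0 < #|I|)%N -> (2 * #|J| <= #|I|)%N ->
  exists c : I -> int, [/\ exists i, c i != 0, forall j, \sum_i a j i * c i = 0 &
                           forall i, (`|c i| <= #|I| * A)%N].
Proof.
move=> A0 aA I0 IJ; pose H := (#|I| * A)%N.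
have H0 : (0 < H)%N by rewrite muln_gt0 I0.
pose g j (f : {ffun I -> 'I_H.+1}) i := (if (0 <= a j i)%R then `|a j i| * f i else `|a j i| * (H - f i))%N.
have gH j f : (\sum_i g j f i < (H * H).+1)%N.
  rewrite ltnS; apply: leq_trans (_ : \sum_(i : I) A * H <= _)%N.
    apply: leq_sum => i _; rewrite /g; case: ifP => _; apply: leq_mul => //.
      by rewrite -ltnS.
    exact: leq_subr.
  by rewrite sum_nat_const mulnA.
pose F (f : {ffun I -> 'I_H.+1}) : {ffun J -> 'I_(H * H).+1} := [ffun j => Ordinal (gH j f)].
have : ~~ injectiveb F.
  apply/negP => /injectiveP /leq_card; rewrite !card_ffun !card_ord leqNgt => /negP; apply.
  have [->|J0] := posnP #|J|.
    by rewrite expn0 -(exp1n #|I|) ltn_exp2r.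
  apply: leq_trans (_ : _ <= H.+1 ^ (2 * #|J|))%N _; last by rewrite leq_exp2l.
  by rewrite expnM ltn_exp2r //; nia.
case/injectivePn => f [f' ff' Ff].
exists (fun i => (f i : nat)%:Z - (f' i : nat)%:Z); split.
- apply/existsP; apply: contraR ff'; rewrite negb_exists => /forallP h.
  apply/eqP/ffunP => i; apply: val_inj; apply/eqP.
  by move: (h i); rewrite negbK subr_eq0 eqz_nat.
- move=> j; have E h : (\sum_i g j h i)%N%:Z =
    \sum_i a j i * (h i : nat)%:Z + \sum_i (if 0 <= a j i then 0 else - a j i * H%:Z).
    rewrite -big_split /= -[LHS]/((\sum_i g j h i)%N : int) (big_morph Posz PoszD (erefl 0%:Z)).
    apply: eq_bigr => i _; rewrite /g; case: ifPn => ai; rewrite PoszM.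
      by rewrite gez0_abs // addr0.
    rewrite ltz0_abs ?ltNge // -subzn; last by rewrite -ltnS.
    ring.
  have : (\sum_i g j f i)%N%:Z = (\sum_i g j f' i)%N%:Z.
    by move/ffunP/(_ j): Ff; rewrite !ffunE => /(congr1 val) /= ->.
  rewrite !E => /addIr h; under eq_bigr => i _ do rewrite mulrBr.
  by rewrite sumrB h subrr.
- move=> i; have := ltn_ord (f i); have := ltn_ord (f' i); rewrite -/H; lia.
Qed.

Section Blocks.
Variables (m N : nat).
(* A form in m blocks of three variables, homogeneous of degree r h in block h, is
   represented by its coefficients P : multi -> int on homs r. *)
Definition block := {ffun 'I_3 -> 'I_N.+1}.
Definition multi := {ffun 'I_m -> block}.
Definition hom1 (r : nat) : {pred block} := [pred b : block | \sum_t b t == r]%N.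
Variable (r : 'I_m -> nat).
Definition homs : {pred multi} := family (fun h => hom1 (r h)).

Lemma homsP (I : multi) : reflect (forall h, (\sum_t I h t = r h)%N) (I \in homs).
Proof.
apply: (iffP familyP) => h i; first by have := h i; rewrite inE => /eqP.
by rewrite inE h.
Qed.

(** Transpositions of the coordinates preserve [hom1 q], so the three coordinates have equal totals,
    and together they sum to q on each block. *)
Lemma hom1_sum (F : comNzRingType) (q : nat) (t : 'I_3) :
  3%:R * \sum_(b in hom1 q) (b t : nat)%:R = (q * #|hom1 q|)%:R :> F.
Proof.
pose tot t := \sum_(b in hom1 q) (b t : nat)%:R : F.
have sym t1 t2 : tot t1 = tot t2.
  pose f (b : block) : block := [ffun u => b (tperm t1 t2 u)].
  rewrite /tot (reindex_onto f f) /= => [|b _]; last first.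
    by apply/ffunP => u; rewrite !ffunE tpermK.
  apply: eq_big => [b|b _]; last by rewrite ffunE tpermL.
  rewrite [in LHS]inE [in RHS]inE.
  have -> : f (f b) == b by apply/eqP/ffunP => u; rewrite !ffunE tpermK.
  rewrite andbT; congr (_ == _).
  rewrite [RHS](reindex_inj (@perm_inj _ (tperm t1 t2))) /=.
  by apply: eq_bigr => u _; rewrite ffunE.
transitivity (\sum_u tot u).
  by rewrite [RHS](eq_bigr (fun=> tot t)) ?sumr_const ?card_ord ?mulr_natl // => u _; exact: sym.
rewrite /tot exchange_big /= -[in RHS]sum1_card mulnC natrM natr_sum mulr_suml.
by apply: eq_bigr => b; rewrite inE => /eqP <-; rewrite mul1r natr_sum.
Qed.

Lemma homs_prod (F : 'I_m -> block -> rat) :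
  \sum_(I in homs) \prod_h F h (I h) = \prod_h \sum_(b in hom1 (r h)) F h b.
Proof. by rewrite bigA_distr_big_dep. Qed.

Hypothesis rN : forall h, (0 < r h <= N)%N.

Lemma card_hom1 q : (q <= N)%N -> (0 < #|hom1 q| <= 8 ^ q)%N.
Proof.
move=> qN; apply/andP; split.
  apply/card_gt0P; exists [ffun t => if t == ord0 then inord q else ord0].
  rewrite inE big_ord_recl ffunE eqxx inordK ?ltnS // big1 ?addn0 // => i _.
  by rewrite ffunE.
apply: leq_trans (_ : _ <= q.+1 ^ 3)%N _.
  have <- : #|(ffun_on [pred x : 'I_N.+1 | (x <= q)%N] : {pred block})| = (q.+1 ^ 3)%N.
    rewrite card_ffun_on card_ord; congr (_ ^ _)%N.
    have qN' : (q.+1 <= N.+1)%N by [].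
    rewrite -[RHS]card_ord -[RHS](card_image (f := widen_ord qN')).
      apply: eq_card => l; rewrite inE; apply/idP/imageP => [lc|[j _ ->]].
        by exists (Ordinal (lc : (l < q.+1)%N)) => //; exact: val_inj.
      by rewrite /= -ltnS ltn_ord.
    by move=> i j /(congr1 val) /= /val_inj.
  apply: subset_leq_card; apply/subsetP => b; rewrite inE => /eqP bq.
  by apply/ffun_onP => t; rewrite inE -bq (bigD1 t) //= leq_addr.
rewrite -[8%N]/(2 ^ 3)%N -expnM mulnC expnM leq_exp2r //.
exact: ltn_expl.
Qed.

Lemma card_homs : (0 < #|homs| <= 8 ^ \sum_h r h)%N.
Proof.
have E : #|homs| = (\prod_h #|hom1 (r h)|)%N.
  apply/eqP; rewrite -(eqr_nat rat) natr_prod; apply/eqP.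
  transitivity (\sum_(I in homs) \prod_(h < m) (fun _ _ => 1 : rat) h (I h)).
    by rewrite -sumr_const; apply: eq_bigr => I _; rewrite big1.
  by rewrite (homs_prod (fun _ _ => 1)); apply: eq_bigr => h _; rewrite sumr_const.
rewrite E prodn_gt0 => [|h]; last by have /andP[_ /card_hom1 /andP[]] := rN h.
rewrite (big_morph _ (expnD 8) (expn0 8)); apply: leq_prod => h _.
by have /andP[_ /card_hom1 /andP[]] := rN h.
Qed.

Variables (s : 'I_3 -> nat) (S : nat).
Hypothesis sS : forall t, (s t <= S)%N.
Hypothesis S0 : (0 < S)%N.

Definition bwt (q : nat) (b : block) : rat := (\sum_t s t * b t)%N%:R / q%:R.
Definition mean : rat := (\sum_t s t)%N%:R / 3.

Lemma bwt_mean q : (0 < q)%N -> \sum_(b in hom1 q) (bwt q b - mean) = 0.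
Proof.
move=> q0; have qR : q%:R != 0 :> rat by rewrite pnatr_eq0 -lt0n.
rewrite sumrB; apply/eqP; rewrite subr_eq0; apply/eqP.
rewrite sumr_const /bwt -mulr_suml.
have -> : \sum_(b in hom1 q) (\sum_t s t * b t)%N%:R = \sum_t (s t)%:R * ((q * #|hom1 q|)%:R / 3) :> rat.
  under eq_bigr => b _ do rewrite natr_sum.
  rewrite exchange_big /=; apply: eq_bigr => t _.
  under eq_bigr => b _ do rewrite natrM.
  by rewrite -mulr_sumr -(hom1_sum rat q t); congr (_ * _); field.
rewrite -mulr_suml -natr_sum /mean -[RHS]mulr_natr natrM; field.
exact: qR.
Qed.

Lemma bwt_bound q b : (0 < q)%N -> b \in hom1 q -> `|bwt q b - mean| <= S%:R.
Proof.
move=> q0; rewrite inE => /eqP bq.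
have h1 : 0 <= bwt q b <= S%:R.
  rewrite /bwt divr_ge0 //= ler_pdivrMr ?ltr0n // -natrM ler_nat -bq big_distrr /=.
  by apply: leq_sum => t _; rewrite leq_mul2r sS orbT.
have h2 : 0 <= mean <= S%:R.
  rewrite /mean divr_ge0 //= ler_pdivrMr // -natrM ler_nat -[X in (_ <= S * X)%N](card_ord 3) mulnC -sum_nat_const.
  exact: leq_sum.
by rewrite ler_norml; apply/andP; split; lra.
Qed.

(** For the uniform distribution on [homs] the blocks are independent, and each centred weight has
    mean 0 and is bounded by S. The mixed terms of the second moment vanish, which leaves at most m
    S^2; a deviation eps m then has probability at most S^2 / (eps^2 m) <= 1 / (2 d). *)
Lemma chebyshev (eps : rat) (d : nat) : 0 < eps -> (0 < m)%N ->
  (2 * d * S ^ 2)%:R <= eps ^+ 2 * m%:R ->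
  (2 * (d * #|[pred I in homs | (\sum_h bwt (r h) (I h) <= m%:R * (mean - eps))%R ]|) <= #|homs|)%N.
Proof.
move=> e0 m0 dS; set B := [pred I in homs | _].
pose f h b := bwt (r h) b - mean.
pose X (I : multi) := \sum_h f h (I h).
have X2 : \sum_(I in homs) X I ^+ 2 <= m%:R * S%:R ^+ 2 * #|homs|%:R.
  have -> : \sum_(I in homs) X I ^+ 2 = \sum_h \sum_h' \sum_(I in homs) f h (I h) * f h' (I h').
    under eq_bigr => I _ do rewrite expr2 /X mulr_suml.
    rewrite exchange_big /=; apply: eq_bigr => h _.
    under eq_bigr => I _ do rewrite mulr_sumr.
    by rewrite exchange_big.
  apply: le_trans (_ : _ <= \sum_(h < m) S%:R ^+ 2 * #|homs|%:R) _; last first.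
    by rewrite sumr_const card_ord -[leRHS]mulrA mulr_natl.
  apply: ler_sum => h _; rewrite (bigD1 h) //= [X in _ + X]big1 ?addr0 => [|h' hh].
    apply: le_trans (_ : _ <= \sum_(I in homs) S%:R ^+ 2) _; last by rewrite sumr_const mulr_natr.
    apply: ler_sum => I /familyP /(_ h) Ih; have /andP[r0 _] := rN h.
    have := bwt_bound r0 Ih; rewrite -/(f h _) => b.
    by rewrite -expr2 -real_normK ?num_real // lerXn2r ?nnegrE.
  pose F k b := if k == h then f h b else if k == h' then f h' b else 1.
  transitivity (\sum_(I in homs) \prod_k F k (I k)).
    apply: eq_bigr => I _; rewrite (bigD1 h) //= (bigD1 h') //= /F eqxx (negbTE hh) eqxx.
    by rewrite big1 ?mulr1 // => k /andP[/negbTE -> /negbTE ->].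
  rewrite homs_prod (bigD1 h) //= /F eqxx bwt_mean ?mul0r //.
  by have /andP[] := rN h.
have BX : #|B|%:R * (eps * m%:R) ^+ 2 <= \sum_(I in homs) X I ^+ 2.
  rewrite mulr_natl -sumr_const [leRHS](bigID (mem B)) /=.
  rewrite -[leLHS]addr0 lerD ?sumr_ge0 // => [|I _]; last exact: sqr_ge0.
  rewrite [leRHS](eq_bigl (mem B)) => [|I]; last by rewrite /= !inE andbA andbb.
  apply: ler_sum => I; rewrite inE => /andP[_ h].
  have XE : X I = (\sum_h bwt (r h) (I h)) - m%:R * mean.
    by rewrite /X /f sumrB sumr_const card_ord mulr_natl.
  have : eps * m%:R <= - X I by rewrite XE; lra.
  rewrite -[X I ^+ 2]sqrrN => le; rewrite lerXn2r ?nnegrE //.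
    by rewrite mulr_ge0 // ltW.
  by apply: le_trans le; rewrite mulr_ge0 // ltW.
have mR : (0 : rat) < m%:R by rewrite ltr0n.
have := le_trans BX X2; rewrite exprMn [m%:R ^+ 2]expr2.
have -> : #|B|%:R * (eps ^+ 2 * (m%:R * m%:R)) = m%:R * (#|B|%:R * (eps ^+ 2 * m%:R)) by ring.
rewrite -mulrA ler_pM2l // => h.
have S2 : (0 : rat) < S%:R ^+ 2 by rewrite exprn_gt0 // ltr0n.
rewrite -(ler_nat rat) -(ler_pM2l S2); apply: le_trans h.
apply: le_trans (_ : _ <= #|B|%:R * (2 * d * S ^ 2)%:R) _; last by rewrite ler_wpM2l.
by rewrite -natrX -!natrM ler_nat; nia.
Qed.

End Blocks.

(** * Linear substitutions in each block *)

Section BlockSubst.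
Variables (N : nat) (R : comNzRingType).
Implicit Types (g : 'M[R]_3) (I J K : block N).

Definition toM K : 'X_{1..3} := [multinom (K i : nat) | i < 3].
Definition rowf g i : {mpoly R[3]} := \sum_j g i j *: 'X_j.
Definition Sg g I : {mpoly R[3]} := \prod_i rowf g i ^+ I i.
(* The coefficient of Y^K in the image of X^I under X_i = \sum_j g i j Y_j. *)
Definition Sc g I K : R := (Sg g I)@_(toM K).

Lemma toM_inj : injective toM.
Proof.
move=> I J /mnmP h; apply/ffunP => i; apply: val_inj => /=.
by have := h i; rewrite !mnmE.
Qed.

Lemma rowf_homog g i : rowf g i \is 1.-homog.
Proof.
by apply: rpred_sum => j _; apply: rpredZ; rewrite dhomogX /= mdeg1.
Qed.

Lemma Sg_homog g I : Sg g I \is (\sum_i I i)%N.-homog.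
Proof.
rewrite /Sg; apply: (big_ind2 (fun p d => p \is d.-homog)) => [|p d q e hp hq|i _].
- exact: dhomog1.
- exact: dhomogM.
- by have := dhomogMn (I i) (rowf_homog g i); rewrite mul1n.
Qed.

Lemma Sg_expand g I q : (q <= N)%N -> I \in hom1 q ->
  Sg g I = \sum_(J in hom1 q) Sc g I J *: 'X_[toM J].
Proof.
move=> qN; rewrite inE => /eqP Iq; have hom := Sg_homog g I; rewrite Iq in hom.
apply/mpolyP => K; rewrite -[RHS]/(mcoeff K _) raddf_sum.
have [Kq|Kq] := eqVneq (mdeg K) q; last first.
  rewrite (dhomog_nemf_coeff hom Kq) big1 // => J; rewrite inE => /eqP Jq.
  rewrite -[LHS]/(mcoeff K _) mcoeffZ mcoeffX; case: eqP => [E|_]; last by rewrite mulr0.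
  case/eqP: Kq; rewrite -E mdegE -Jq; apply: eq_bigr => i _; exact: mnmE.
pose J : block N := [ffun i => inord (K i)].
have Ki i : (K i <= N)%N.
  by apply: leq_trans qN; rewrite -Kq mdegE (bigD1 i) //= leq_addr.
have JK : toM J = K by apply/mnmP => i; rewrite mnmE ffunE inordK // ltnS.
have Jq : J \in hom1 q.
  by rewrite inE -Kq mdegE; apply/eqP; apply: eq_bigr => i _; rewrite ffunE inordK // ltnS.
rewrite (bigD1 J) //= big1 => [|J' /andP[_ ne]]; last first.
  rewrite -[LHS]/(mcoeff K _) mcoeffZ mcoeffX -JK (inj_eq toM_inj) (negbTE ne) mulr0 //.
by rewrite addr0 -[RHS]/(mcoeff K _) mcoeffZ mcoeffX JK eqxx mulr1 /Sc JK.
Qed.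

Lemma Sc_mul g g' I K q : (q <= N)%N -> I \in hom1 q ->
  \sum_(J in hom1 q) Sc g I J * Sc g' J K = Sc (g *m g') I K.
Proof.
move=> qN Iq; pose psi (p : {mpoly R[3]}) : {mpoly R[3]} := mmap (@mpolyC 3 R) (rowf g') p.
have psiR i : psi (rowf g i) = rowf (g *m g') i.
  rewrite /psi /rowf rmorph_sum /=; under eq_bigr => j _ do rewrite mmapZ mmapX mmap1U.
  rewrite /rowf; under eq_bigr => j _ do rewrite mul_mpolyC scaler_sumr.
  rewrite exchange_big; apply: eq_bigr => k _; rewrite mxE scaler_suml.
  by apply: eq_bigr => j _; rewrite scalerA.
have E1 : psi (Sg g I) = Sg (g *m g') I.
  by rewrite /psi /Sg rmorph_prod; apply: eq_bigr => i _; rewrite rmorphXn /= -/(psi _) psiR.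
have E2 : psi (Sg g I) = \sum_(J in hom1 q) Sc g I J *: Sg g' J.
  rewrite (Sg_expand g qN Iq) /psi rmorph_sum; apply: eq_bigr => J _.
  rewrite /= mmapZ mmapX mul_mpolyC; congr (_ *: _).
  by apply: eq_bigr => i _; rewrite mnmE.
rewrite /Sc -E1 E2 raddf_sum; apply: eq_bigr => J _.
by rewrite -[RHS]/(mcoeff _ (_ *: _)) mcoeffZ.
Qed.

Section Bound.
Variables (nu : R -> rat) (rho kap : 'I_3 -> rat).
Hypothesis nu0 : nu 0 = 0.
Hypothesis nu_ge0 : forall x, 0 <= nu x.
Hypothesis nuD : forall x y, nu (x + y) <= nu x + nu y.
Hypothesis nuM : forall x y, nu (x * y) <= nu x * nu y.
Hypothesis nu1 : nu 1 <= 1.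
Hypothesis kap_gt0 : forall i, 0 < kap i.

(** For the norm of weights kap, row i is a linear form of norm at most 3 rho i, and reading off the
    coefficient at K costs kap^K. *)
Lemma Sc_bound g I K : (forall i j, nu (g i j) <= rho i * kap j) ->
  nu (Sc g I K) <= \prod_i (3 * rho i) ^+ I i * \prod_j kap j ^+ K j.
Proof.
move=> gb; have rn i : mnorm nu kap (rowf g i) <= 3 * rho i.
  apply: le_trans (mnorm_sum nu0 nuD kap_gt0 _ _ _) _.
  apply: le_trans (_ : _ <= \sum_(j < 3) rho i) _; last by rewrite sumr_const card_ord mulr_natl.
  apply: ler_sum => j _; apply: le_trans (mnormZX _ nu0 _ _) _.
  rewrite /mwt (bigD1 j) //= mnm1E eqxx expr1 big1 ?mulr1 => [|k kj]; last first.
    by rewrite mnm1E eq_sym (negbTE kj) expr0 invr1.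
  by rewrite ler_pdivrMr.
have kp : 0 < \prod_j kap j ^+ K j by apply: prodr_gt0 => j _; rewrite exprn_gt0.
rewrite -ler_pdivrMr //; apply: le_trans (_ : _ <= mnorm nu kap (Sg g I)) _.
  apply: le_trans (mnorm_coef nu0 nu_ge0 kap_gt0 (Sg g I) (toM K)).
  rewrite /Sc /mwt -prodfV le_eqVlt; apply/orP; left; apply/eqP; congr (_ * _).
  by apply: eq_bigr => i _; rewrite mnmE.
apply: le_trans (mnorm_prod nu0 nu_ge0 nuD nuM nu1 kap_gt0 _ _ _) _.
apply: ler_prod => i _; rewrite mnorm_ge0 //=.
apply: le_trans (mnormX nu0 nu_ge0 nuD nuM nu1 kap_gt0 _ _) _.
by rewrite lerXn2r // nnegrE ?mnorm_ge0 // (le_trans _ (rn i)) // mnorm_ge0.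
Qed.
End Bound.

End BlockSubst.

Lemma Sc_map (N : nat) (R S : comNzRingType) (f : {rmorphism R -> S}) (g : 'M[R]_3) (I K : block N) :
  Sc (map_mx f g) I K = f (Sc g I K).
Proof.
rewrite /Sc -mcoeff_map_mpoly; congr (_ @_ _).
rewrite /Sg rmorph_prod; apply: eq_bigr => i _; rewrite rmorphXn; congr (_ ^+ _).
rewrite /rowf rmorph_sum; apply: eq_bigr => j _.
by rewrite /= map_mpolyZ map_mpolyX mxE.
Qed.

Lemma avoidsM n v (p q : {mpoly rat[n]}) : avoids v p -> avoids v q -> avoids v (p * q).
Proof.
move=> pv qv K; rewrite -mcoeff_msupp => /msuppM_le/allpairsP [[a b] /=].
by rewrite !mcoeff_msupp => -[/pv av /qv bv ->]; rewrite mnmDE av bv.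
Qed.

Lemma avoids1 n v : avoids v (1 : {mpoly rat[n]}).
Proof.
by move=> K; rewrite mcoeff1; case: (eqVneq K 0%MM) => [->|_]; rewrite ?mnm0E ?eqxx.
Qed.

(** A change of coordinates inside the plane keeps the exponent of the transverse variable, which
    measures the order of vanishing along the plane. *)
Lemma Sc_third (N : nat) (T : 'M[rat]_3) (I K : block N) :
  (forall j, T ord_max j = (j == ord_max)%:R) -> (forall i, i != ord_max -> T i ord_max = 0) ->
  Sc T I K != 0 -> I ord_max = K ord_max.
Proof.
move=> T1 T2; rewrite /Sc /Sg big_ord_recr /=.
set p := \prod_(_ < _) _; set q := rowf _ _ ^+ _.
have qE : q = 'X_[U_(ord_max) *+ I ord_max].
  rewrite /q /rowf (bigD1 ord_max) //= big1 => [|j jm]; last by rewrite T1 (negbTE jm) scale0r.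
  by rewrite T1 eqxx scale1r addr0 mpolyXn.
have pv : avoids ord_max p.
  rewrite /p; apply: big_ind => [||i _]; [exact: avoids1|exact: avoidsM|].
  elim: (I _ : nat) => [|k IH]; first by rewrite expr0; exact: avoids1.
  rewrite exprS; apply: avoidsM IH; apply: avoids_sum => j _ L.
  rewrite mcoeffZ mcoeffX; case: (eqVneq j ord_max) => [->|jm].
    rewrite [T _ _]T2; first by rewrite mul0r eqxx.
    by rewrite -(inj_eq val_inj) /= neq_ltn (ltn_ord i).
  case: (eqVneq U_(j)%MM L) => [<- _|]; last by rewrite mulr0 eqxx.
  by rewrite mnm1E (negbTE jm).
have qo : only ord_max q.
  move=> L; rewrite qE mcoeffX; case: (eqVneq _ L) => [<- _|]; last by rewrite eqxx.
  by rewrite mulmnE mnm1E eqxx mul1n.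
rewrite (sep_coef _ pv qo) mulf_eq0 negb_or => /andP[_].
rewrite qE mcoeffX.
case: (eqVneq (U_(ord_max) *+ I ord_max)%MM (U_(ord_max) *+ toM K ord_max)%MM) => [E _|_]; last by rewrite eqxx.
move/mnmP/(_ ord_max): E; rewrite !mulmnE mnm1E eqxx !mul1n mnmE => E.
exact: val_inj.
Qed.

Definition mn3 a b c : 'X_{1..3} := [multinom nth 0%N [:: a; b; c] i | i < 3].

Definition i0 : 'I_3 := @Ordinal 3 0 isT.
Definition i1 : 'I_3 := @Ordinal 3 1 isT.
Definition i2 : 'I_3 := @Ordinal 3 2 isT.

Lemma mpolyX3 a b c : 'X_i0 ^+ a * 'X_i1 ^+ b * 'X_i2 ^+ c = 'X_[mn3 a b c] :> {mpoly rat[3]}.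
Proof.
rewrite [RHS]mpolyXE_id !big_ord_recl big_ord0 mulr1 ![mn3 a b c _]mnmE mulrA.
by congr (_ * _ * _); congr ('X_ _ ^+ _); exact: val_inj.
Qed.

Lemma mn3_eq (N : nat) (K : block N) a b c :
  (mn3 a b c == toM K) = [&& a == K i0, b == K i1 & c == K i2].
Proof.
apply/eqP/and3P => [/mnmP E|[/eqP E0 /eqP E1 /eqP E2]].
  by have := E i0; have := E i1; have := E i2; rewrite !mnmE /= => -> -> ->.
apply/mnmP => i; rewrite !mnmE.
case: i => [[|[|[|//]]] h] /=; rewrite ?E0 ?E1 ?E2;
  by congr (nat_of_ord (K _)); exact: val_inj.
Qed.

(** The substitution sends the three variables to xi Y0 + xi' Y1 + Y2, Y0 and Y1. The variable Y1
    already occurs [I (pi i2)] times, so when this is at least K i1 the two must be equal, and no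
    term xi' Y1 is chosen: xi' disappears from the answer. *)
Lemma slice_coef (N : nat) (F : 'M[rat]_3) (pi : 'S_3) (xi xi' : rat) (I K : block N) q :
  (forall j, F (pi i0) j = nth 0 [:: xi; xi'; 1] j) ->
  (forall j, F (pi i1) j = (j == i0)%:R) -> (forall j, F (pi i2) j = (j == i1)%:R) ->
  I \in hom1 q -> K \in hom1 q -> (I (pi i2) >= K i1)%N ->
  Sc F I K = if (I (pi i2) == K i1 :> nat)
    then ('C(I (pi i0), K i2))%:R * xi ^+ (I (pi i0) - K i2) else 0.
Proof.
move=> F0 F1 F2; rewrite !inE => /eqP Iq /eqP Kq le.
have {}Iq : (I (pi i0) + I (pi i1) + I (pi i2) = q)%N.
  rewrite -Iq (reindex_inj (@perm_inj _ pi)) /= !big_ord_recl big_ord0 addn0 addnA.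
  by congr (_ + _ + _)%N; congr (nat_of_ord (I (pi _))); exact: val_inj.
have {}Kq : (K i0 + K i1 + K i2 = q)%N.
  rewrite -Kq !big_ord_recl big_ord0 addn0 addnA.
  by congr (_ + _ + _)%N; congr (nat_of_ord (K _)); exact: val_inj.
pose i := I (pi i0); pose j := I (pi i1); pose l := I (pi i2).
have SE : Sg F I = \sum_(v < i.+1) \sum_(w < (i - v).+1)
   ('C(i, v)%:R * 'C(i - v, w)%:R * xi ^+ (i - v - w) * xi' ^+ v) *: 'X_[mn3 (i - v - w + j) (v + l) w].
  have e0 : ord0 = i0 by exact: val_inj.
  have e1 : lift ord0 (ord0 : 'I_2) = i1 by exact: val_inj.
  have e2 : lift ord0 (lift ord0 (ord0 : 'I_1)) = i2 by exact: val_inj.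
  rewrite /Sg (reindex_inj (@perm_inj _ pi)) /=.
  transitivity (rowf F (pi i0) ^+ i * (rowf F (pi i1) ^+ j * rowf F (pi i2) ^+ l)).
    by rewrite !big_ord_recl big_ord0 mulr1 e2 e1 e0.
  have -> : rowf F (pi i0) = (xi *: 'X_i0 + 'X_i2) + xi' *: 'X_i1.
    rewrite /rowf !big_ord_recl big_ord0 addr0 !F0 e2 e1 e0 /= scale1r addrA addrAC.
    by [].
  have -> : rowf F (pi i1) = 'X_i0.
    by rewrite /rowf (bigD1 i0) //= big1 => [|k ki]; rewrite F1 ?eqxx ?scale1r ?addr0 // (negbTE ki) scale0r.
  have -> : rowf F (pi i2) = 'X_i1.
    by rewrite /rowf (bigD1 i1) //= big1 => [|k ki]; rewrite F2 ?eqxx ?scale1r ?addr0 // (negbTE ki) scale0r.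
  rewrite exprDn mulr_suml; apply: eq_bigr => v _.
  rewrite -mulrnAr -mulrA exprDn mulr_suml; apply: eq_bigr => w _.
  rewrite -mpolyX3 !exprZn -!mul_mpolyC !mpolyCM !exprD !rmorph_nat -[_ *+ 'C(i - v, w)]mulr_natl -[_ *+ 'C(i, v)]mulr_natl.
  move: (_%:MP) (_%:MP) => A B; ring.
rewrite /Sc SE raddf_sum big_ord_recl /= [X in _ + X]big1 ?addr0 => [|v _]; last first.
  rewrite raddf_sum big1 // => w _; rewrite -[LHS]/(mcoeff _ (_ *: _)) mcoeffZ mcoeffX mn3_eq.
  have -> : (lift ord0 v + l == K i1)%N = false by apply/eqP => /=; rewrite /bump /l; lia.
  by rewrite andbF mulr0.
rewrite raddf_sum; case: eqP => lK; last first.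
  rewrite big1 // => w _; rewrite -[LHS]/(mcoeff _ (_ *: _)) mcoeffZ mcoeffX mn3_eq.
  have -> : (0 + l == K i1)%N = false by apply/eqP => /=; rewrite /l; lia.
  by rewrite andbF mulr0.
have E (w : 'I_(i - 0).+1) : (('C(i, 0)%:R * 'C(i - 0, w)%:R * xi ^+ (i - 0 - w) * xi' ^+ 0) *:
    'X_[mn3 (i - 0 - w + j) (0 + l) w])@_(toM K) =
    if (w : nat) == K i2 then 'C(i, K i2)%:R * xi ^+ (i - K i2) else 0.
  have wi := ltn_ord w; rewrite mcoeffZ mcoeffX mn3_eq; case: (eqVneq (w : nat) (K i2)) => [wK|_]; last by rewrite !andbF mulr0.
  have -> : (i - 0 - w + j == K i0)%N.
    by apply/eqP; move: Iq Kq wi lK wK; rewrite -/i -/j -/l /=; lia.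
  have -> : (0 + l == K i1)%N by rewrite add0n; apply/eqP.
  by rewrite wK bin0 subn0 expr0 mul1r !mulr1.
rewrite (eq_bigr _ (fun w _ => E w)).
have [le2|lt2] := leqP (K i2) i; last first.
  rewrite bin_small // mul0r big1 // => w _; case: eqP => // wK.
have hK : (K i2 < (i - 0).+1)%N by rewrite subn0.
rewrite (bigD1 (Ordinal hK)) //= eqxx big1 ?addr0 // => w ne.
by case: eqP => // wK; case/eqP: ne; exact: val_inj.
Qed.

Section Compo.
Variables (m N : nat) (r : 'I_m -> nat).
Hypothesis rN : forall h, (0 < r h <= N)%N.
Notation multi := (multi m N).
Notation homs := (@homs m N r).

Definition compo (R : comNzRingType) (g : 'I_m -> 'M[R]_3) (P : multi -> R) (K : multi) : R :=
  \sum_(I in homs) P I * \prod_h Sc (g h) (I h) (K h).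

Lemma compo_mul (R : comNzRingType) (g g' : 'I_m -> 'M[R]_3) (P : multi -> R) (K : multi) :
  compo g' (compo g P) K = compo (fun h => g h *m g' h) P K.
Proof.
rewrite /compo; under eq_bigr => J _ do rewrite mulr_suml.
rewrite exchange_big /=; apply: eq_bigr => I /homsP Ih.
under eq_bigr => J _ do rewrite -mulrA -big_split /=.
rewrite -mulr_sumr; congr (_ * _).
transitivity (\prod_h \sum_(b in @hom1 N (r h)) Sc (g h) (I h) b * Sc (g' h) b (K h)).
  by rewrite bigA_distr_big_dep.
apply: eq_bigr => h _; apply: Sc_mul; first by have /andP[] := rN h.
by rewrite inE Ih.
Qed.

Lemma compo_map (R S : comNzRingType) (f : {rmorphism R -> S}) (g : 'I_m -> 'M[R]_3) P K :
  compo (fun h => map_mx f (g h)) (fun I => f (P I)) K = f (compo g P K).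
Proof.
rewrite /compo rmorph_sum; apply: eq_bigr => I _; rewrite rmorphM rmorph_prod; congr (_ * _).
by apply: eq_bigr => h _; rewrite Sc_map.
Qed.

Lemma nrm_sumZX (n : nat) (I : Type) (s : seq I) (Q : pred I) (c : I -> rat) (a : I -> 'X_{1..n}) :
  nrm (\sum_(i <- s | Q i) c i *: 'X_[a i]) <= \sum_(i <- s | Q i) `|c i|.
Proof.
have k0 (i : 'I_n) : (0 : rat) < 1 := ltr01.
apply: le_trans (mnorm_sum (normr0 rat) (@ler_normD _ _) k0 _ _ _) _.
apply: ler_sum => i _; apply: le_trans (mnormZX _ (normr0 rat) _ _) _.
by rewrite /mwt big1 ?mulr1 // => j _; rewrite expr1n invr1.
Qed.

Variable P : multi -> int.
Hypothesis P0 : exists2 I, I \in homs & P I != 0.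
Variables (U : 'I_m -> 'M[int]_3) (T F : 'I_m -> 'M[rat]_3) (pi : 'I_m -> 'S_3).
Variables (xi xi' : 'I_m -> rat).
Hypothesis T1 : forall h j, T h ord_max j = (j == ord_max)%:R.
Hypothesis T2 : forall h i, i != ord_max -> T h i ord_max = 0.
Hypothesis FUT : forall h, F h = map_mx intr (U h) *m T h.
Hypothesis F0 : forall h j, F h (pi h i0) j = nth 0 [:: xi h; xi' h; 1] j.
Hypothesis F1 : forall h j, F h (pi h i1) j = (j == i0)%:R.
Hypothesis F2 : forall h j, F h (pi h i2) j = (j == i1)%:R.
Hypothesis UP : forall K, K \in homs -> \sum_h (K h i2)%:R / (r h)%:R < 1 :> rat -> compo U P K = 0.

Let rinv h : rat := (r h)%:R^-1.

(** Q is the part of P of lowest order in the variables [pi h i2], dehomogenised at the variables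
    [pi h i1]. Its Taylor coefficient at xi of exponent b is the coefficient of [compo F P] at a
    multi-exponent whose transverse part is b, and this vanishes when b has weight below 1. *)
Lemma roth_link : exists Q : {mpoly rat[m]},
  [/\ Q != 0, intp Q, dle r Q, nrm Q <= \sum_(I in homs) `|(P I)%:~R| & vord rinv 1 (trl xi Q)].
Proof.
have [I1 I1h PI1] := P0.
(* Minimality of the total exponent in the variables [pi h i2] selects one vector k of such
   exponents, and lets [slice_coef] kill all the terms of P with another vector. *)
pose tt (I : multi) := (\sum_h I h (pi h i2))%N.
case: (@arg_minnP _ I1 [pred I in homs | P I != 0] tt); first by rewrite inE I1h.
move=> I0 /andP[I0h PI0] Imin.
pose k (h : 'I_m) : nat := I0 h (pi h i2).
pose A := [pred I in homs | [forall h, I h (pi h i2) == k h :> nat]].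
pose mon (I : multi) : 'X_{1..m} := [multinom (I h (pi h i0) : nat) | h < m].
have hsum (I : multi) h : I \in homs -> (I h (pi h i0) + I h (pi h i1) + I h (pi h i2) = r h)%N.
  move=> /homsP <-; rewrite (reindex_inj (@perm_inj _ (pi h))) /= !big_ord_recl big_ord0 addn0 addnA.
  by congr (_ + _ + _)%N; congr (nat_of_ord (I h (pi h _))); exact: val_inj.
have moninj I J : I \in A -> J \in A -> mon I = mon J -> I = J.
  move=> /andP[Ih /forallP Ik] /andP[Jh /forallP Jk] /mnmP E; apply/ffunP => h; apply/ffunP => t.
  have := E h; rewrite !mnmE => E0; have sI := hsum I h Ih; have sJ := hsum J h Jh.
  have := Ik h; have := Jk h => /eqP e1 /eqP e2.
  have [j ->] : exists j, t = pi h j by exists ((pi h)^-1%g t); rewrite permKV.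
  apply: ord_inj; case: j => [[|[|[|//]]] hj] /=.
  - have -> : Ordinal hj = i0 by exact: val_inj.
    exact: E0.
  - have -> : Ordinal hj = i1 by exact: val_inj.
    by move: sI sJ e1 e2 E0; lia.
  - have -> : Ordinal hj = i2 by exact: val_inj.
    by rewrite e1 e2.
pose Q : {mpoly rat[m]} := \sum_(I in A) (P I)%:~R *: 'X_[mon I].
have QE K : Q@_K = \sum_(I in A) (P I)%:~R * (mon I == K)%:R.
  by rewrite raddf_sum; apply: eq_bigr => I _; rewrite -[LHS]/(mcoeff _ (_ *: _)) mcoeffZ mcoeffX.
have QA K : Q@_K != 0 -> exists2 I, I \in A & mon I = K.
  move=> QK; have [I /andP[IA /eqP IK]|none] := pickP [pred I in A | mon I == K].
    by exists I.
  case/eqP: QK; rewrite QE big1 // => I IA; have := none I; rewrite inE [I \in A]IA /= => ->.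
  by rewrite mulr0.
have QI I : I \in A -> Q@_(mon I) = (P I)%:~R.
  move=> IA; rewrite QE (bigD1 I) //= eqxx mulr1 big1 ?addr0 // => J /andP[JA JI].
  by case: eqP => [/(moninj _ _ JA IA) E|]; [rewrite E eqxx in JI|rewrite mulr0].
have I0A : I0 \in A by rewrite inE I0h; apply/forallP => h.
exists Q; split.
- by apply/eqP => Q0; have := QI _ I0A; rewrite Q0 mcoeff0 => /esym/eqP; rewrite intr_eq0 (negbTE PI0).
- move=> K; have [->|/QA [I IA <-]] := eqVneq Q@_K 0; first exact: rpred0.
  by rewrite QI //.
- by move=> K /QA [I /andP[Ih _] <-] h; rewrite mnmE -(hsum I h Ih) -addnA leq_addr.
- apply: le_trans (nrm_sumZX _ _ _ _) _.
  rewrite [leRHS](bigID (fun I : multi => [forall h, I h (pi h i2) == k h :> nat])) /= lerDl.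
  by apply: sumr_ge0.
move=> b; apply: contraR; rewrite -ltNge => blt; rewrite mcoeff_trl.
have -> : (hasse b Q).@[xi] =
   \sum_(I in A) (P I)%:~R * \prod_h (('C(I h (pi h i0), b h))%:R * xi h ^+ (I h (pi h i0) - b h)).
  have -> : hasse b Q = \sum_(I in A) hasse b ((P I)%:~R *: 'X_[mon I]) by rewrite -raddf_sum.
  rewrite raddf_sum; apply: eq_bigr => I _.
  rewrite -[LHS]/(meval _ (hasse _ _)) linearZ /= hasseX !mevalZ mevalX; congr (_ * _).
  rewrite /mbin -big_split; apply: eq_bigr => h _; rewrite /= mnmBE mnmE //.
have [bk|] := boolP [forall h, b h + k h <= r h]%N; last first.
  rewrite negb_forall => /existsP[h]; rewrite -ltnNge => lt.
  apply/eqP; rewrite big1 // => I /andP[Ih /forallP /(_ h) /eqP Ik].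
  have z : 'C(I h (pi h i0), b h) = 0%N.
    apply: bin_small; have e := hsum I h Ih; rewrite Ik in e.
    by move: lt; rewrite -e ltn_add2r; apply: leq_ltn_trans; exact: leq_addr.
  by rewrite (bigD1 h) //= z !mul0r mulr0.
(* The exponent of Y1 is the minimal k h, that of Y2 is the order of differentiation b h, and that
   of Y0 completes the degree. *)
pose kap : multi := [ffun h : 'I_m => [ffun t : 'I_3 => inord (nth 0%N [:: (r h - k h - b h)%N; k h; b h] t)]].
have rle h : (r h <= N)%N by have /andP[] := rN h.
have bkh h : (b h + k h <= r h)%N by exact: (forallP bk).
have kap0 h : kap h i0 = (r h - k h - b h)%N :> nat.
  by rewrite !ffunE /= inordK // ltnS; have := rle h; lia.
have kap1 h : kap h i1 = k h :> nat.
  by rewrite !ffunE /= inordK // ltnS; have := rle h; have := bkh h; lia.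
have kap2 h : kap h i2 = b h :> nat.
  by rewrite !ffunE /= inordK // ltnS; have := rle h; have := bkh h; lia.
have e0 : ord0 = i0 by exact: val_inj.
have e1 : lift ord0 (ord0 : 'I_2) = i1 by exact: val_inj.
have e2 : lift ord0 (lift ord0 (ord0 : 'I_1)) = i2 by exact: val_inj.
have kaph : kap \in homs.
  apply/homsP => h; rewrite !big_ord_recl big_ord0 e2 e1 e0 kap0 kap1 kap2.
  by have := bkh h; lia.
have Z : compo F (fun I => (P I)%:~R) kap = 0.
  rewrite /compo; under eq_bigr => I _ do under eq_bigr => h _ do rewrite FUT.
  rewrite -/(compo (fun h => map_mx intr (U h) *m T h) _ _) -compo_mul.
  rewrite /compo big1 // => K Kh.
  rewrite -/(compo (fun h => map_mx intr (U h)) _ _).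
  have [lt|ge] := ltP (\sum_h (K h i2)%:R / (r h)%:R : rat) 1.
    by rewrite (compo_map (intr : int -> rat)) UP // mul0r.
  have [h Kh2] : exists h, K h i2 != kap h i2.
    apply/existsP; rewrite -negb_forall; apply/negP => /forallP E.
    move: ge; rewrite leNgt => /negP; apply; rewrite /lwt in blt.
    rewrite (eq_bigr (fun h => rinv h * (b h)%:R)) // => h _.
    by rewrite (eqP (E h)) kap2 mulrC.
  rewrite (bigD1 h) //=; suff -> : Sc (T h) (K h) (kap h) = 0 by rewrite mul0r mulr0.
  have em : ord_max = i2 by exact: val_inj.
  apply/eqP; apply: contraR Kh2 => nz; rewrite -em; apply/eqP.
  exact: Sc_third (T1 h) (@T2 h) nz.
rewrite -[X in _ == X]Z /compo [X in _ == X](bigID (fun I : multi => [forall h, I h (pi h i2) == k h :> nat])) /=.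
rewrite [X in _ == _ + X]big1 ?addr0 => [|I /andP[Ih nI]]; last first.
  have [->|PI] := eqVneq (P I) 0; first by rewrite mul0r.
  (* Otherwise all exponents are at most those of I0, and equal to them since their total is
     minimal, so that I would be in A. *)
  have [h kI] : exists h, (k h < I h (pi h i2))%N.
    apply/existsP; apply: contraR nI; rewrite negb_exists => /forallP le.
    have {}le h : (I h (pi h i2) <= k h)%N by rewrite leqNgt le.
    have : (tt I0 <= tt I)%N by apply: Imin; rewrite inE Ih.
    rewrite /tt => le2.
    have /eqP : (\sum_h I h (pi h i2) = \sum_h k h)%N.
      by apply/eqP; rewrite eqn_leq le2 andbT; apply: leq_sum.
    have lf h : (I h (pi h i2) <= k h ?= iff (I h (pi h i2) == k h :> nat))%N by split.
    have [_ ->] := leqif_sum (fun h (_ : true) => lf h).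
    by move/forallP => E; apply/forallP => h; have := E h.
  rewrite (bigD1 h) //= (slice_coef (F0 h) (F1 h) (F2 h) (q := r h)) ?kap1.
  - by rewrite gtn_eqF // mul0r mulr0.
  - by rewrite inE; have /homsP -> := Ih.
  - by rewrite inE; have /homsP -> := kaph.
  - exact: ltnW.
apply/eqP; apply: eq_bigr => I /andP[Ih /forallP Ik]; congr (_ * _); apply: eq_bigr => h _.
rewrite (slice_coef (F0 h) (F1 h) (F2 h) (q := r h)) ?kap1.
- by rewrite Ik kap2.
- by rewrite inE; have /homsP -> := Ih.
- by rewrite inE; have /homsP -> := kaph.
- by rewrite (eqP (Ik h)).
Qed.

End Compo.

(** * The auxiliary form *)

Section PolyNorm.
Variable C : nat.
Hypothesis C0 : (0 < C)%N.
Implicit Types e f : {poly int}.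

(** X counts as C because X^k, once reduced modulo the equation of beta, has coordinates at most
    C^k: hence [red_bound]. *)
Definition pnrm e : rat := \sum_(i < size e) `|e`_i|%:~R * C%:R ^+ i.

Lemma pnrm_wide e n : (size e <= n)%N -> pnrm e = \sum_(i < n) `|e`_i|%:~R * C%:R ^+ i.
Proof.
move=> en; rewrite /pnrm (big_ord_widen n (fun i => `|e`_i|%:~R * C%:R ^+ i : rat) en) big_mkcond.
apply: eq_bigr => i _; case: ifPn => //; rewrite -leqNgt => /(nth_default 0) ->.
by rewrite normr0 mul0r.
Qed.

Lemma pnrm_ge0 e : 0 <= pnrm e.
Proof. by apply: sumr_ge0 => i _; rewrite mulr_ge0 ?ler0z ?exprn_ge0. Qed.

Lemma pnrm0 : pnrm 0 = 0.
Proof. by rewrite /pnrm size_poly0 big_ord0. Qed.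

Lemma pnrmD e f : pnrm (e + f) <= pnrm e + pnrm f.
Proof.
pose n := maxn (size e) (size f).
rewrite (@pnrm_wide (e + f) n) ?size_polyD // (@pnrm_wide e n) ?leq_maxl //.
rewrite (@pnrm_wide f n) ?leq_maxr // -big_split /=; apply: ler_sum => i _.
by rewrite -mulrDl ler_wpM2r ?exprn_ge0 // coefD -rmorphD ler_int ler_normD.
Qed.

Lemma pnrm_sum (I : Type) (s : seq I) (Q : pred I) (E : I -> {poly int}) :
  pnrm (\sum_(i <- s | Q i) E i) <= \sum_(i <- s | Q i) pnrm (E i).
Proof.
elim/big_rec2: _ => [|i y1 y2 _ le]; first by rewrite pnrm0.
by apply: le_trans (pnrmD _ _) _; rewrite lerD2l.
Qed.

Lemma pnrmZX (c : int) k : pnrm (c *: 'X^k) = `|c|%:~R * C%:R ^+ k.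
Proof.
have h : (size (c *: 'X^k : {poly int}) <= k.+1)%N.
  by apply: leq_trans (size_scale_leq _ _) _; rewrite size_polyXn.
rewrite (pnrm_wide h) (bigD1 ord_max) //= coefZ coefXn eqxx mulr1 big1 ?addr0 // => i ik.
rewrite coefZ coefXn; have -> : ((i : nat) == k) = false.
  by apply/negbTE; apply: contra ik => /eqP E; apply/eqP/val_inj.
by rewrite mulr0 normr0 mul0r.
Qed.

Lemma pnrmM e f : pnrm (e * f) <= pnrm e * pnrm f.
Proof.
have E g : g = \sum_(i < size g) g`_i *: 'X^i :> {poly int}.
  by rewrite -{1}[g]coefK poly_def.
rewrite {1}(E e) {1}(E f) mulr_suml; apply: le_trans (pnrm_sum _ _ _) _.
rewrite [leRHS]mulr_suml; apply: ler_sum => i _; rewrite mulr_sumr.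
apply: le_trans (pnrm_sum _ _ _) _; rewrite mulr_sumr; apply: ler_sum => j _.
rewrite -scalerAl -scalerAr scalerA -exprD pnrmZX normrM rmorphM exprD /=.
by rewrite mulrACA.
Qed.

Lemma pnrm1 : pnrm 1 <= 1.
Proof. by rewrite -[1 in leLHS]scale1r -(expr0 'X) pnrmZX normr1 mul1r expr0. Qed.

Lemma pnrm_prod (I : Type) (s : seq I) (Q : pred I) (E : I -> {poly int}) :
  pnrm (\prod_(i <- s | Q i) E i) <= \prod_(i <- s | Q i) pnrm (E i).
Proof.
elim/big_rec2: _ => [|i y1 y2 _ le]; first exact: pnrm1.
by apply: le_trans (pnrmM _ _) _; rewrite ler_wpM2l // pnrm_ge0.
Qed.
End PolyNorm.

Section Aux.
Variables (K : fieldType) (beta : K) (d C : nat) (rho : nat -> 'I_d -> int).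
Hypothesis C0 : (0 < C)%N.
Hypothesis rhoC : forall k j, `|rho k j|%:~R <= C%:R ^+ k :> rat.
Hypothesis rhoE : forall k, beta ^+ k = \sum_j (rho k j)%:~R * beta ^+ j.

Definition evb (e : {poly int}) : K := (map_poly intr e).[beta].
HB.instance Definition _ := GRing.RMorphism.copy evb (horner_eval beta \o map_poly intr).

Definition red (e : {poly int}) j : int := \sum_(k < size e) e`_k * rho k j.

Lemma evb_red e : evb e = \sum_j (red e j)%:~R * beta ^+ j.
Proof.
rewrite /evb (horner_coef_wide (n := size e)); last exact: size_poly.
under eq_bigr => k _ do rewrite rhoE coef_map_id0 // mulr_sumr.
rewrite exchange_big; apply: eq_bigr => j _; rewrite /red rmorph_sum mulr_suml.
by apply: eq_bigr => k _; rewrite mulrA rmorphM.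
Qed.

Lemma red_bound e j : `|red e j|%:~R <= pnrm C e.
Proof.
apply: le_trans (_ : _ <= \sum_(k < size e) `|e`_k * rho k j|%:~R) _.
  by rewrite -rmorph_sum ler_int ler_norm_sum.
apply: ler_sum => k _; rewrite normrM rmorphM; apply: ler_wpM2l; last exact: rhoC.
by rewrite ler0z.
Qed.

Variables (m N : nat) (r : 'I_m -> nat) (E : 'M[{poly int}]_3) (s : 'I_3 -> nat) (S : nat) (eps : rat).
Hypothesis rN : forall h, (0 < r h <= N)%N.
Hypothesis EC : forall i j, pnrm C (E i j) <= C%:R ^+ 2.
Hypothesis sS : forall t, (s t <= S)%N.
Hypothesis S0 : (0 < S)%N.
Hypothesis eps0 : 0 < eps.
Hypothesis m0 : (0 < m)%N.
Hypothesis mS : (2 * d * S ^ 2)%:R <= eps ^+ 2 * m%:R.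

Notation homs := (@homs m N r).
Notation low J := (\sum_h bwt s (r h) (J h) <= m%:R * (mean s - eps)).

(** Each vanishing condition lives in Z[beta] and becomes d integer equations by [evb_red]. By
    [chebyshev] the equations are at most half as many as the unknowns. Their coefficients are at
    most (3 C^2)^(sum r), and the number of unknowns contributes the factor 8^(sum r). *)
Lemma aux_poly : exists P : multi m N -> int,
  [/\ exists2 I, I \in homs & P I != 0,
      forall I, I \in homs -> (`|P I| <= (8 * (3 * C ^ 2)) ^ \sum_h r h)%N &
      forall J, J \in homs -> low J ->
        compo r (fun=> map_mx evb E) (fun I => (P I)%:~R) J = 0].
Proof.
pose X : finType := {I : multi m N | I \in homs}.
pose B := [pred I in homs | low I].
pose Y : finType := ({J : multi m N | J \in B} * 'I_d)%type.
pose a (y : Y) (x : X) : int := red (\prod_h Sc E (val x h) (val y.1 h)) y.2.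
pose A := ((3 * C ^ 2) ^ \sum_h r h)%N.
have A0 : (0 < A)%N by rewrite expn_gt0 muln_gt0 expn_gt0 C0.
have aA y x : (`|a y x| <= A)%N.
  rewrite -(ler_nat rat) natr_absz; apply: le_trans (red_bound _ _) _.
  apply: le_trans (pnrm_prod _ _ _ _) _.
  rewrite /A natrX (big_morph _ (exprD _) (expr0 _)); apply: ler_prod => h _.
  rewrite pnrm_ge0 //=; have /homsP xh := valP x.
  have := @Sc_bound N {poly int} (pnrm C) (fun=> C%:R ^+ 2) (fun=> 1) (pnrm0 C)
    (pnrm_ge0 C) (pnrmD C) (pnrmM C) (pnrm1 C) (fun=> ltr01) E (val x h) (val y.1 h).
  move=> h1; apply: le_trans (h1 _) _ => [i j|]; first by rewrite mulr1.
  rewrite [X in _ * X]big1 => [|i _]; last by rewrite expr1n.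
  by rewrite mulr1 -xh natrM natrX (big_morph _ (exprD _) (expr0 _)).
have cX : #|X| = #|homs| by rewrite card_sig.
have /andP[h0 h8] := card_homs rN.
have XY : (2 * #|Y| <= #|X|)%N.
  have cY : #|Y| = (#|B| * d)%N by rewrite card_prod card_ord card_sig.
  have := chebyshev rN sS S0 eps0 m0 mS; rewrite cX cY.
  have -> : #|B| = #|[pred I in homs | low I]| by [].
  by lia.
have [|c [[x cx] ca cA]] := siegel A0 aA _ XY; first by rewrite cX.
pose P (I : multi m N) : int := oapp c 0 (insub I).
have PX z : P (val z) = c z by rewrite /P valK.
exists P; split.
- by exists (val x); [exact: valP|rewrite PX].
- move=> I Ih; have -> : I = val (exist _ I Ih : X) by [].
  rewrite PX; apply: leq_trans (cA _) _; rewrite cX /A (expnMn 8) leq_mul2r.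
  by rewrite h8 orbT.
move=> J Jh Jl; have JB : J \in B by rewrite inE Jh.
pose yJ : {J : multi m N | J \in B} := exist _ J JB.
have E1 I : \prod_h Sc (map_mx evb E) (I h) (J h) =
   \sum_j (red (\prod_h Sc E (I h) (J h)) j)%:~R * beta ^+ j.
  rewrite -evb_red rmorph_prod; apply: eq_bigr => h _.
  exact: (Sc_map evb).
rewrite /compo; under eq_bigr => I _ do rewrite E1 mulr_sumr.
rewrite exchange_big big1 // => j _.
under eq_bigr => I _ do rewrite mulrA -rmorphM.
rewrite -mulr_suml -rmorph_sum.
suff -> : \sum_(I in homs) P I * red (\prod_h Sc E (I h) (J h)) j = 0 by rewrite rmorph0 mul0r.
rewrite -[RHS](ca (yJ, j)) (reindex_omap (val : X -> _) insub) => [|I Ih]; last by rewrite insubT.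
apply: eq_big => [z|z _]; first by rewrite (valP z) valK eqxx.
by rewrite PX mulrC.
Qed.
End Aux.

Section CompoBound.
Variables (m N : nat) (r : 'I_m -> nat).
Hypothesis rN : forall h, (0 < r h <= N)%N.
Variables (R : comNzRingType) (nu : R -> rat).
Hypothesis nu0 : nu 0 = 0.
Hypothesis nu_ge0 : forall x, 0 <= nu x.
Hypothesis nuD : forall x y, nu (x + y) <= nu x + nu y.
Hypothesis nuM : forall x y, nu (x * y) <= nu x * nu y.
Hypothesis nu1 : nu 1 <= 1.

Lemma nu_sum (I : Type) (s : seq I) (Q : pred I) (E : I -> R) :
  nu (\sum_(i <- s | Q i) E i) <= \sum_(i <- s | Q i) nu (E i).
Proof.
elim/big_rec2: _ => [|i y1 y2 _ le]; first by rewrite nu0.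
by apply: le_trans (nuD _ _) _; rewrite lerD2l.
Qed.

Lemma nu_prod (I : Type) (s : seq I) (Q : pred I) (E : I -> R) :
  nu (\prod_(i <- s | Q i) E i) <= \prod_(i <- s | Q i) nu (E i).
Proof.
elim/big_rec2: _ => [|i y1 y2 _ le]; first exact: nu1.
by apply: le_trans (nuM _ _) _; rewrite ler_wpM2l.
Qed.

(** The constant 24 is 8 for the number of monomials times 3 for the terms of a row. The bound Y is
    asked only where P does not vanish: this is how the vanishing of the low coefficients yields
    smallness. *)
Lemma compo_bound (g : 'I_m -> 'M[R]_3) (P : multi m N -> R) K (A Y : rat)
  (rho kap : 'I_m -> 'I_3 -> rat) :
  0 <= A -> 0 <= Y -> (forall h i, 0 <= rho h i) -> (forall h j, 0 < kap h j) ->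
  (forall h i j, nu (g h i j) <= rho h i * kap h j) ->
  (forall I, I \in homs r -> nu (P I) <= A) ->
  (forall I, I \in homs r -> P I != 0 -> \prod_h \prod_i rho h i ^+ I h i <= Y) ->
  nu (compo r g P K) <= 24 ^+ (\sum_h r h) * A * Y * \prod_h \prod_j kap h j ^+ K h j.
Proof.
move=> A0 Y0 rho0 kap0 gb PA PY.
have kp : 0 <= \prod_h \prod_j kap h j ^+ K h j.
  by apply: prodr_ge0 => h _; apply: prodr_ge0 => j _; rewrite exprn_ge0 // ltW.
apply: le_trans (nu_sum _ _ _) _.
apply: le_trans (_ : _ <= \sum_(I in homs r) A * (3 ^+ (\sum_h r h) * Y * \prod_h \prod_j kap h j ^+ K h j)) _.
  apply: ler_sum => I Ih; have [->|PI] := eqVneq (P I) 0.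
    by rewrite mul0r nu0 !mulr_ge0 // exprn_ge0.
  apply: le_trans (nuM _ _) _; apply: ler_pM => //; first exact: PA.
  apply: le_trans (nu_prod _ _ _) _.
  apply: le_trans (_ : _ <= \prod_h (3 ^+ r h * \prod_i rho h i ^+ I h i * \prod_j kap h j ^+ K h j)) _.
    apply: ler_prod => h _; rewrite nu_ge0 /=.
    apply: le_trans (Sc_bound nu0 nu_ge0 nuD nuM nu1 (kap0 h) _ _ (gb h)) _.
    rewrite le_eqVlt; apply/orP; left; apply/eqP; congr (_ * _).
    have /homsP <- := Ih; rewrite (big_morph _ (exprD _) (expr0 _)) -big_split /=.
    by apply: eq_bigr => i _; rewrite exprMn.
  rewrite !big_split /= (big_morph _ (exprD _) (expr0 _)) ler_wpM2r // ler_wpM2l //.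
    by apply: prodr_ge0 => h _; rewrite exprn_ge0.
  exact: PY.
set X := A * _; have X0 : 0 <= X by rewrite /X !mulr_ge0 // exprn_ge0.
have -> : 24 ^+ (\sum_h r h) * A * Y * \prod_h \prod_j kap h j ^+ K h j = 8 ^+ (\sum_h r h) * X.
  by rewrite /X (_ : (24 : rat) = 8 * 3) ?exprMn; ring.
have /andP[_ h8] := card_homs rN.
by rewrite sumr_const -[leLHS]mulr_natl ler_wpM2r // -natrX ler_nat.
Qed.
End CompoBound.

(** * Slopes of a plane with a primitive integral normal *)

Lemma denq_ratio (x y : int) : y != 0 ->
  (denq (- (x%:~R / y%:~R)) * (gcdn `|x| `|y|)%:Z = `|y|)%R.
Proof.
move=> y0; rewrite denqN.
have g0 : (0 < gcdn `|x| `|y|)%N by rewrite gcdn_gt0 !absz_gt0 y0 orbT.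
pose gg := gcdz x y; have gx : (gg %| x)%Z := dvdz_gcdl x y; have gy : (gg %| y)%Z := dvdz_gcdr x y.
have gE : gg = (gcdn `|x| `|y|)%:Z by [].
case/dvdzP: (gx) => x' xE; case/dvdzP: (gy) => y' yE.
have gg0 : gg != 0 by rewrite gE -lt0n.
have cop : coprime `|x'| `|y'|.
  rewrite /coprime -(@eqn_pmul2r `|gg|) ?absz_gt0 // mul1n.
  by rewrite muln_gcdl -!abszM -xE -yE gE.
have y'0 : y' != 0 by apply: contra y0 => /eqP z; rewrite yE z mul0r.
have -> : x%:~R / y%:~R = x'%:~R / y'%:~R :> rat.
  by rewrite xE yE !rmorphM /= -mulf_div divff ?mulr1 // intr_eq0.
by rewrite coprimeq_den // (negbTE y'0) -gE yE normrM [`|gg|]ger0_norm // gE.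
Qed.

(* gcd(m0, m1) gcd(m0, m2) divides m0 when gcd(m0, m1, m2) = 1. *)
Lemma good_slope (a b c : int) : a != 0 -> gcdn (gcdn `|a| `|b|) `|c| = 1%N ->
  (`|a| <= denq (- (b%:~R / a%:~R)) ^+ 2)%R \/ (`|a| <= denq (- (c%:~R / a%:~R)) ^+ 2)%R.
Proof.
move=> a0 g1; have Hb := denq_ratio b a0; have Hc := denq_ratio c a0.
set gb := gcdn `|b| `|a| in Hb; set gc := gcdn `|c| `|a| in Hc.
have dv : (gb * gc %| `|a|)%N.
  rewrite Gauss_dvd ?dvdn_gcdr // /coprime -g1 /gb /gc.
  by rewrite [gcdn `|c| _]gcdnC [gcdn `|b| _]gcdnC gcdnACA gcdnn gcdnA.
have le : (gb * gc <= `|a|)%N by apply: dvdn_leq dv; rewrite absz_gt0.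
have key (x : int) (e : nat) : (0 < e)%N -> (e * e <= `|a|)%N -> x * e%:Z = `|a|%R -> (`|a| <= x ^+ 2)%R.
  move=> e0 ee xe.
  have a0' : (0 : int) < `|a|%R by rewrite normr_gt0.
  have x0 : 0 < x by move: a0'; rewrite -xe pmulr_lgt0.
  have : `|a|%R * `|a|%R = x ^+ 2 * (e * e)%:Z by rewrite -xe PoszM; ring.
  have : (e * e)%:Z <= `|a|%R by rewrite -abszE.
  by move: a0' ; set A := `|a|%R; nia.
have ga : (0 < gb)%N by rewrite gcdn_gt0 !absz_gt0 a0 orbT.
have gd : (0 < gc)%N by rewrite gcdn_gt0 !absz_gt0 a0 orbT.
have [h|h] := leqP gb gc; [left; apply: (key _ gb)|right; apply: (key _ gc)] => //.
  by apply: leq_trans le; rewrite leq_mul2l h orbT.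
by apply: leq_trans le; rewrite leq_mul2r (ltnW h) orbT.
Qed.

Lemma I3_case (P : 'I_3 -> Prop) : P i0 -> P i1 -> P i2 -> forall i, P i.
Proof.
move=> h0 h1 h2 [[|[|[|//]]] h].
- by have -> : Ordinal h = i0 by exact: val_inj.
- by have -> : Ordinal h = i1 by exact: val_inj.
- by have -> : Ordinal h = i2 by exact: val_inj.
Qed.

Lemma sum3 (V : nmodType) (f : 'I_3 -> V) : \sum_i f i = f i0 + f i1 + f i2.
Proof.
rewrite !big_ord_recl big_ord0 addr0 addrA.
by congr (f _ + f _ + f _); exact: val_inj.
Qed.

Lemma perm3 (s p q : 'I_3) : s != p -> s != q -> p != q ->
  exists pi : 'S_3, [/\ pi i0 = s, pi i1 = p & pi i2 = q].
Proof.
move=> sp sq pq; pose f := tperm i0 s; pose y := f i1; pose pi := (f * tperm y p)%g.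
have ys : s != y by rewrite /y -[X in X != _](tpermL i0 s) (inj_eq perm_inj).
have p0 : pi i0 = s by rewrite permM tpermL tpermD // eq_sym.
have p1 : pi i1 = p by rewrite permM tpermL.
exists pi; split => //; have n0 : pi i2 != s by rewrite -p0 (inj_eq perm_inj).
have n1 : pi i2 != p by rewrite -p1 (inj_eq perm_inj).
move: sp sq pq n0 n1; move: (pi i2) => z; clear.
by move: s p q z; do 4![apply: I3_case].
Qed.

Section SeqChoice.
Variables (X : Type) (Q : X -> Prop) (c : X -> nat).
Hypothesis fam : forall B, exists2 x, Q x & (B <= c x)%N.

Lemma seq_choice D B m : exists x : nat -> X,
  [/\ forall h, (h < m)%N -> Q (x h), forall h, (h < m)%N -> (B <= c (x h))%N &
      forall h h', (h < h')%N -> (h' < m)%N -> (D * c (x h) <= c (x h'))%N].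
Proof.
elim: m => [|m [x [xQ xB xD]]].
  by have [x _ _] := fam 0; exists (fun=> x).
have [y Qy cy] := fam (B + D * \sum_(h < m) c (x h)).
exists (fun h => if (h < m)%N then x h else y); split=> [h hm|h hm|h h' hh hm].
- by case: ifP => // /xQ.
- by case: ifP => [/xB //|_]; apply: leq_trans cy; exact: leq_addr.
- have hm1 : (h < m)%N by exact: leq_trans hh _.
  rewrite hm1; case: ifP => [h'm|_]; first exact: xD.
  apply: leq_trans cy; apply: leq_trans (leq_addl _ _); rewrite leq_mul2l.
  by apply/orP; right; rewrite (bigD1 (Ordinal hm1)) //= leq_addr.
Qed.
End SeqChoice.

(* M is normal to the plane spanned by u and w; c measures the scale 2 ^ c. *)
Record plane := Plane {pc : nat; pM : 'I_3 -> int; pu : 'I_3 -> int; pw : 'I_3 -> int}.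

Definition cross_eq (u w : 'I_3 -> int) (lam : int) (M : 'I_3 -> int) :=
  [/\ u i1 * w i2 - u i2 * w i1 = lam * M i0, u i2 * w i0 - u i0 * w i2 = lam * M i1 &
      u i0 * w i1 - u i1 * w i0 = lam * M i2].

(** The parametrisation X = Y0 u + Y1 w + Y2 e_s, in which Y2 = 0 is the plane; its determinant is
    the s-th coordinate of the cross product of u and w. *)
Definition Umx (u w : 'I_3 -> int) (s : 'I_3) : 'M[int]_3 :=
  \matrix_(i, j) if j == i0 then u i else if j == i1 then w i else (i == s)%:R.

Section Dir.
Variables (u w M : 'I_3 -> int) (lam : int).
Hypothesis lam0 : lam != 0.
Hypothesis cr : cross_eq u w lam M.

Lemma cross_perm (pi : 'S_3) :
  exists2 e : int, e != 0 & [/\ u (pi i1) * w (pi i2) - u (pi i2) * w (pi i1) = e * M (pi i0),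
      u (pi i2) * w (pi i0) - u (pi i0) * w (pi i2) = e * M (pi i1) &
      u (pi i0) * w (pi i1) - u (pi i1) * w (pi i0) = e * M (pi i2)].
Proof.
case: cr => c0 c1 c2.
have n01 : pi i0 != pi i1 by rewrite (inj_eq perm_inj).
have n02 : pi i0 != pi i2 by rewrite (inj_eq perm_inj).
have n12 : pi i1 != pi i2 by rewrite (inj_eq perm_inj).
have lamN : - lam != 0 by rewrite oppr_eq0.
move: n01 n02 n12; move: (pi i0) (pi i1) (pi i2).
do 3![apply: I3_case] => //= _ _ _;
 try (by exists lam => //; split; rewrite ?c0 ?c1 ?c2);
 by exists (- lam) => //; rewrite !mulNr -?c0 -?c1 -?c2; split; ring.
Qed.

(** T inverts the minor of u and w on the coordinates [pi i1], [pi i2], which is a nonzero multiple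
    of M (pi i0), and fixes the transverse variable. These two coordinates become Y0 and Y1, and the
    third is read from the equation of the plane. *)
Lemma plane_dir (pi : 'S_3) : M (pi i0) != 0 ->
  exists T F : 'M[rat]_3,
  let xi := - ((M (pi i1))%:~R / (M (pi i0))%:~R) in
  let xi' := - ((M (pi i2))%:~R / (M (pi i0))%:~R) in
  [/\ (forall j, T ord_max j = (j == ord_max)%:R) /\ (forall i, i != ord_max -> T i ord_max = 0),
      F = map_mx intr (Umx u w (pi i0)) *m T,
      (forall j, F (pi i0) j = nth 0 [:: xi; xi'; 1] j),
      (forall j, F (pi i1) j = (j == i0)%:R) & (forall j, F (pi i2) j = (j == i1)%:R)].
Proof.
move=> M0; have [e e0 [E0 E1 E2]] := cross_perm pi.
have n01 : (pi i1 == pi i0) = false by rewrite (inj_eq perm_inj).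
have n02 : (pi i2 == pi i0) = false by rewrite (inj_eq perm_inj).
move: E0 E1 E2 n01 n02 M0; move: (pi i0) (pi i1) (pi i2) => s p q E0 E1 E2 n01 n02 M0.
pose De : rat := (e * M s)%:~R; have De0 : De != 0 by rewrite intr_eq0 mulf_neq0.
have eR : (e%:~R : rat) != 0 by rewrite intr_eq0.
have MR : ((M s)%:~R : rat) != 0 by rewrite intr_eq0.
have {}E0 : (u p)%:~R * (w q)%:~R - (u q)%:~R * (w p)%:~R = De by rewrite /De -E0 rmorphB !rmorphM.
have {}E1 : (u q)%:~R * (w s)%:~R - (u s)%:~R * (w q)%:~R = e%:~R * (M p)%:~R :> rat by rewrite -[RHS]rmorphM -E1 rmorphB !rmorphM.
have {}E2 : (u s)%:~R * (w p)%:~R - (u p)%:~R * (w s)%:~R = e%:~R * (M q)%:~R :> rat by rewrite -[RHS]rmorphM -E2 rmorphB !rmorphM.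
have DeE : De = e%:~R * (M s)%:~R by rewrite /De rmorphM.
pose T : 'M[rat]_3 := \matrix_(i, j)
  if i == i0 then (if j == i0 then (w q)%:~R / De else if j == i1 then - ((w p)%:~R / De) else 0)
  else if i == i1 then (if j == i0 then - ((u q)%:~R / De) else if j == i1 then (u p)%:~R / De else 0)
  else (j == i2)%:R.
have mx2 : ord_max = i2 :> 'I_3 by exact: val_inj.
exists T, (map_mx intr (Umx u w s) *m T); cbv zeta.
have FE i : [/\ (map_mx intr (Umx u w s) *m T) i i0 = ((u i)%:~R * (w q)%:~R - (w i)%:~R * (u q)%:~R) / De,
    (map_mx intr (Umx u w s) *m T) i i1 = ((w i)%:~R * (u p)%:~R - (u i)%:~R * (w p)%:~R) / De &
    (map_mx intr (Umx u w s) *m T) i i2 = (i == s)%:R].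
  split; rewrite !mxE sum3 !mxE /=.
  - by rewrite mulr0 addr0; ring.
  - by rewrite mulr0 addr0; ring.
  - by rewrite !mulr0 !add0r mulr1 rmorph_nat.
split=> //.
- split; rewrite mx2; first by apply: I3_case; rewrite !mxE.
  by apply: I3_case; rewrite ?eqxx // !mxE.
- have [f0 f1 f2] := FE s; apply: I3_case; rewrite ?f0 ?f1 ?f2 /= ?eqxx //.
    transitivity (- (e%:~R * (M p)%:~R) / De); first by rewrite -E1; congr (_ / _); ring.
    by rewrite DeE; field; rewrite eR MR.
  transitivity (- (e%:~R * (M q)%:~R) / De); first by rewrite -E2; congr (_ / _); ring.
  by rewrite DeE; field; rewrite eR MR.
- have [f0 f1 f2] := FE p; apply: I3_case; rewrite ?f0 ?f1 ?f2 /= ?n01 //.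
    by rewrite -[X in X / _](_ : De = _) ?divff // -E0; ring.
  by rewrite (_ : _ - _ = 0) ?mul0r //; ring.
- have [f0 f1 f2] := FE q; apply: I3_case; rewrite ?f0 ?f1 ?f2 /= ?n02 //.
    by rewrite (_ : _ - _ = 0) ?mul0r //; ring.
  by rewrite -[X in X / _](_ : De = _) ?divff // -E0; ring.
Qed.

(** Divide by a large coordinate of the normal: by [good_slope] one of the two quotients has a
    denominator of square at least that coordinate. The permutation puts this quotient at [pi i1],
    the slope that [roth_link] keeps. *)
Lemma plane_pick g b : (0 < b)%N -> (0 < g)%N ->
  gcdn (gcdn `|M i0| `|M i1|) `|M i2| = 1%N -> (exists i, (b <= `|M i| ^ g)%N) ->
  exists2 pi : 'S_3, M (pi i0) != 0 &
   (b%:R <= ((denq (- ((M (pi i1))%:~R / (M (pi i0))%:~R)))%:~R : rat) ^+ (2 * g)).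
Proof.
move=> b0 g0 gM [i bi].
have M0 : M i != 0.
  by apply: contraTneq bi => ->; rewrite exp0n // -ltnNge.
have key (s p q : 'I_3) : s != p -> s != q -> p != q -> M s != 0 -> (b <= `|M s| ^ g)%N ->
  gcdn (gcdn `|M s| `|M p|) `|M q| = 1%N -> exists2 pi : 'S_3, M (pi i0) != 0 &
   (b%:R <= ((denq (- ((M (pi i1))%:~R / (M (pi i0))%:~R)))%:~R : rat) ^+ (2 * g)).
  move=> sp sq pq Ms bs gs.
  have fin (y : int) : (`|M s| <= denq (- (y%:~R / (M s)%:~R)) ^+ 2)%R ->
     (b%:R <= ((denq (- (y%:~R / (M s)%:~R)))%:~R : rat) ^+ (2 * g)).
    move=> le; rewrite exprM; apply: le_trans (_ : _ <= ((`|M s|%N%:R : rat) ^+ g)) _.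
      by rewrite -natrX ler_nat.
    apply: lerX => //; rewrite natr_absz -rmorphXn /= ler_int //.
  case: (good_slope Ms gs) => /fin h.
    by have [pi [p0 p1 p2]] := perm3 sp sq pq; exists pi; rewrite ?p0 ?p1.
  have [pi [p0 p1 p2]] := perm3 sq sp (contra_neq (@esym _ _ _) pq).
  by exists pi; rewrite ?p0 ?p1.
move: i bi M0; apply: I3_case => bi M0.
- exact: (key i0 i1 i2).
- by apply: (key i1 i0 i2) => //; rewrite [gcdn `|M i1| _]gcdnC.
- by apply: (key i2 i0 i1) => //; rewrite -gM -gcdnA gcdnC.
Qed.
End Dir.

(** * A special case of the subspace theorem *)

Section KP.
Variables (K : fieldType) (ab : K -> rat).
Hypothesis ab0 : ab 0 = 0.
Hypothesis ab_ge0 : forall x, 0 <= ab x.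
Hypothesis abU : forall x y, ab (x + y) <= Num.max (ab x) (ab y).
Hypothesis abM : forall x y, ab (x * y) = ab x * ab y.
Hypothesis ab1 : ab 1 = 1.
Hypothesis ab_int : forall z : int, ab z%:~R <= 1.
Hypothesis ab_prod : forall z : int, z != 0 -> 1 <= `|z|%:~R * ab z%:~R.

Lemma abD x y : ab (x + y) <= ab x + ab y.
Proof.
apply: le_trans (abU x y) _; rewrite ge_max lerDl lerDr !ab_ge0 //.
Qed.

Lemma abMle x y : ab (x * y) <= ab x * ab y.
Proof. by rewrite abM. Qed.

Lemma ab1le : ab 1 <= 1. Proof. by rewrite ab1. Qed.

Lemma ab_sum1 (I : Type) (s : seq I) (Q : pred I) (E : I -> K) :
  (forall i, Q i -> ab (E i) <= 1) -> ab (\sum_(i <- s | Q i) E i) <= 1.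
Proof.
move=> h; apply: (big_ind (fun x => ab x <= 1)) => //; first by rewrite ab0.
by move=> x y hx hy; apply: le_trans (abU _ _) _; rewrite ge_max hx.
Qed.

Variables (beta : K) (d C : nat) (rho : nat -> 'I_d -> int).
Hypothesis C0 : (0 < C)%N.
Hypothesis rhoC : forall k j, `|rho k j|%:~R <= C%:R ^+ k :> rat.
Hypothesis rhoE : forall k, beta ^+ k = \sum_j (rho k j)%:~R * beta ^+ j.
Hypothesis beta1 : ab beta <= 1.

Variables (E : 'M[{poly int}]_3) (t : 'I_3 -> nat) (a g : nat).
Hypothesis EE : E *m E = 1%:M.
Hypothesis EC : forall i j, pnrm C (E i j) <= C%:R ^+ 2.
Hypothesis ta : (\sum_i t i = 3 * a + 2)%N.
Hypothesis g0 : (0 < g)%N.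

Let S := (3 * a + 2)%N.
Let Eb : 'M[K]_3 := map_mx (evb beta) E.

Lemma ab_X x k : ab x <= 1 -> ab (x ^+ k) <= 1.
Proof.
move=> x1; elim: k => [|k IH]; first by rewrite expr0 ab1.
by rewrite exprS abM mulr_ile1.
Qed.

Lemma ab_evb e : ab (evb beta e) <= 1.
Proof.
rewrite /evb horner_coef; apply: ab_sum1 => i _.
rewrite abM mulr_ile1 ?ab_X //.
by rewrite coef_map_id0 ?ab_int.
Qed.

Lemma Eb_le1 i j : ab (Eb i j) <= 1.
Proof. by rewrite mxE ab_evb. Qed.

Lemma Eb2 : Eb *m Eb = 1%:M.
Proof. by rewrite -map_mxM EE map_mx1. Qed.

(* The auxiliary form exploits that the exponents t sum to 3 a + 2, more than 3 a. *)
Definition good_plane (X : plane) :=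
  [/\ gcdn (gcdn `|pM X i0| `|pM X i1|) `|pM X i2| = 1%N,
      exists2 lam, lam != 0 & cross_eq (pu X) (pw X) lam (pM X),
      forall i, (`|pu X i| <= 2 ^ (a * pc X))%N /\ (`|pw X i| <= 2 ^ (a * pc X))%N,
      forall i, ab (\sum_j Eb i j * (pu X j)%:~R) * 2 ^+ (t i * pc X) <= 1 /\
                ab (\sum_j Eb i j * (pw X j)%:~R) * 2 ^+ (t i * pc X) <= 1
    & exists i, (2 ^ pc X <= `|pM X i| ^ g)%N].

Lemma tS i : (t i <= S)%N.
Proof. by rewrite /S -ta (bigD1 i) //= leq_addr. Qed.

Section Vanish.
Variables (m m' N W : nat) (r : 'I_m -> nat) (X : 'I_m -> plane).
Variables (s : 'I_m -> 'I_3) (P : multi m N -> int).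
Hypothesis mE : m = (2 * m')%N.
Let c h := pc (X h).
Let U h := Umx (pu (X h)) (pw (X h)) (s h).
Hypothesis rN : forall h, (0 < r h <= N)%N.
Hypothesis Xg : forall h, good_plane (X h).
Hypothesis cr : forall h, (c h * r h = W)%N.
Hypothesis PA : forall I, I \in homs r -> (`|P I| <= (8 * (3 * C ^ 2)) ^ \sum_h r h)%N.
Hypothesis Plow : forall J, J \in homs r ->
  \sum_h bwt t (r h) (J h) <= m%:R * (mean t - 1 / 6) ->
  compo r (fun=> Eb) (fun I => (P I)%:~R) J = 0.
Hypothesis m'S : (2 * S <= m')%N.
Variable c0 : nat.
Hypothesis Wc0 : W = (c0 * N)%N.
Hypothesis c0G : ((24 ^ 3 * (24 * C ^ 2)) ^ 4 < 2 ^ c0)%N.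
Hypothesis m'0 : (0 < m')%N.

(** The low coefficients of the auxiliary form in the linear forms vanish. Each remaining monomial
    has large weight, and the small values of the forms on u and w make it p-adically small. *)
Lemma vanish_ab KK : KK \in homs r ->
  ab (compo r U P KK)%:~R <= 24 ^+ (2 * \sum_h r h) * 2 ^- (m' * (2 * a + 1) * W) *
    2 ^+ (S * \sum_h c h * KK h i2).
Proof.
move=> Kh; rewrite -compo_map.
(* As Eb is an involution, P in the coordinates U is P in the linear forms followed by the matrix of
   the values of these forms on u, w and e_s. *)
have gE : compo r (fun h => map_mx intr (U h)) (fun I => (P I)%:~R) KK =
   compo r (fun h => Eb *m map_mx intr (U h)) (compo r (fun=> Eb) (fun I => (P I)%:~R)) KK.
  rewrite compo_mul //; apply: eq_bigr => I _; congr (_ * _); apply: eq_bigr => h _.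
  by rewrite mulmxA Eb2 mul1mx.
rewrite -[X in ab X]/(compo r (fun h => map_mx intr (U h)) _ KK) gE.
have two0 k : (0 : rat) < 2 ^+ k by rewrite exprn_gt0.
pose rh (h : 'I_m) (i : 'I_3) : rat := 2 ^- (t i * c h).
(* On e_s the forms are only known to be at most 1. The factor 2^(S c) in the third column
   compensates the row factor 2^(-t i c), and costs 2^(S c) per power of the transverse variable. *)
pose kp (h : 'I_m) (j : 'I_3) : rat := if j == i2 then 2 ^+ (S * c h) else 1.
have rh0 h i : 0 <= rh h i by rewrite invr_ge0 ltW.
have kp0 h j : 0 < kp h j by rewrite /kp; case: ifP.
pose A : rat := 24 ^+ (\sum_h r h).
have A0 : 0 <= A by apply: exprn_ge0; exact: ler0n.
have Y0 : (0 : rat) <= 2 ^- (m' * (2 * a + 1) * W) by rewrite invr_ge0 ltW.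
have h1 : forall h i j, ab ((Eb *m map_mx intr (U h)) i j) <= rh h i * kp h j.
  move=> h i j; have [_ _ _ Xb _] := Xg h; have [Xu Xw] := Xb i.
  rewrite /kp; move: j; apply: I3_case => /=.
  - have -> : (Eb *m map_mx intr (U h)) i i0 = \sum_j Eb i j * (pu (X h) j)%:~R.
      by rewrite mxE; apply: eq_bigr => j _; rewrite !mxE.
    by rewrite mulr1 /rh -[_^-1]mul1r ler_pdivlMr.
  - have -> : (Eb *m map_mx intr (U h)) i i1 = \sum_j Eb i j * (pw (X h) j)%:~R.
      by rewrite mxE; apply: eq_bigr => j _; rewrite !mxE.
    by rewrite mulr1 /rh -[_^-1]mul1r ler_pdivlMr.
  - apply: le_trans (_ : _ <= 1) _.
      rewrite mxE; apply: ab_sum1 => j _; rewrite abM mulr_ile1 ?Eb_le1 //.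
      by rewrite !mxE ab_int.
    rewrite mulrC ler_pdivlMr // mul1r ler_weXn2l ?ler1n //.
    by rewrite leq_mul2r tS orbT.
have h2 : forall I, I \in homs r -> ab (compo r (fun=> Eb) (fun I => (P I)%:~R) I) <= A.
  move=> I _; apply: le_trans (compo_bound rN ab0 ab_ge0 abD abMle ab1le (A := 1) (Y := 1)
    (rho := fun _ _ => 1) (kap := fun _ _ => 1) I _ _ _ _ _ _ _) _ => //.
  - by move=> h i j; rewrite mulr1 Eb_le1.
  - by move=> J _ _; rewrite big1 // => h _; rewrite big1 // => i _; rewrite expr1n.
  - rewrite [X in _ * X]big1 ?mulr1 // => h _; rewrite big1 // => i _; by rewrite expr1n.
have h3 : forall I, I \in homs r -> compo r (fun=> Eb) (fun I => (P I)%:~R) I != 0 ->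
   \prod_h \prod_i rh h i ^+ I h i <= 2 ^- (m' * (2 * a + 1) * W).
  move=> I Ih nz; have lt : m%:R * (mean t - 1 / 6) < \sum_h bwt t (r h) (I h).
    by rewrite ltNge; apply: contra nz => le; rewrite Plow.
  have PE h : \prod_i rh h i ^+ I h i = 2 ^- (c h * \sum_i t i * I h i)%N.
    rewrite big_distrr /= (big_morph _ (exprD _) (expr0 _)) -prodfV; apply: eq_bigr => i _.
    by rewrite /rh exprVn -exprM; congr (_ ^- _); lia.
  have -> : \prod_h \prod_i rh h i ^+ I h i = 2 ^- (\sum_h c h * \sum_i t i * I h i)%N.
    by rewrite (big_morph _ (exprD _) (expr0 _)) -prodfV; apply: eq_bigr => h _.
  rewrite lef_pV2 ?posrE // ler_weXn2l ?ler1n // -(ler_nat rat) natr_sum.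
  have -> : \sum_h (c h * \sum_i t i * I h i)%:R = W%:R * \sum_h bwt t (r h) (I h) :> rat.
    rewrite mulr_sumr; apply: eq_bigr => h _; rewrite -(cr h) /bwt !natrM.
    have : (r h)%:R != 0 :> rat by rewrite pnatr_eq0 -lt0n; have /andP[] := rN h.
    by move=> rh0'; field.
  rewrite natrM mulrC ler_wpM2l //; apply: ltW; apply: le_lt_trans lt.
  (* As mean t = a + 2/3 and m = 2 m', m (mean t - 1/6) = m' (2 a + 1), which exceeds the exponent m
     a of [vanish_int] by m'. *)
  by rewrite /mean ta mE le_eqVlt !(natrM, natrD); apply/orP; left; apply/eqP; field.
apply: le_trans (compo_bound rN ab0 ab_ge0 abD abMle ab1le KK A0 Y0 rh0 kp0 h1 h2 h3) _.
rewrite /A le_eqVlt; apply/orP; left; apply/eqP.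
rewrite [(2 * \sum_h r h)%N]mul2n -addnn exprD -!mulrA; congr (_ * (_ * (_ * _))).
clear -cr.
rewrite big_distrr /= (big_morph _ (exprD _) (expr0 _)); apply: (@eq_bigr rat 1 *%R) => h _.
rewrite (bigD1 i2) //= big1 ?mulr1 => [|i /negbTE ni]; last by rewrite /kp ni expr1n.
by rewrite /kp eqxx -exprM mulnA.
Qed.

(** In each block the exponents of the two columns of size 2^(a c h) sum to at most r h, so a block
    contributes at most 2^(a c h r h) = 2^(a W). *)
Lemma vanish_int KK : KK \in homs r -> `|compo r U P KK|%:~R <=
  (24 * (24 * C ^ 2))%:R ^+ (\sum_h r h) * 2 ^+ (a * m * W) :> rat.
Proof.
move=> Kh; pose nu (x : int) : rat := `|x|%:~R.
have nu0 : nu 0 = 0 by rewrite /nu normr0.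
have nu_ge0 x : 0 <= nu x by rewrite /nu ler0z.
have nuD x y : nu (x + y) <= nu x + nu y by rewrite /nu -rmorphD ler_int ler_normD.
have nuM x y : nu (x * y) <= nu x * nu y by rewrite /nu normrM rmorphM.
have nu1 : nu 1 <= 1 by [].
pose kp (h : 'I_m) (j : 'I_3) : rat := if j == i2 then 1 else 2 ^+ (a * c h).
have kp0 h j : 0 < kp h j by rewrite /kp; case: ifP => // _; rewrite exprn_gt0.
pose A : rat := ((24 * C ^ 2) ^ (\sum_h r h))%N%:R.
have h1 h i j : nu (U h i j) <= 1 * kp h j.
  have [_ _ Xb _ _] := Xg h; have [Xu Xw] := Xb i.
  rewrite mul1r mxE /nu /kp; move: j; apply: I3_case => /=.
  - by rewrite -natr_absz -natrX ler_nat.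
  - by rewrite -natr_absz -natrX ler_nat.
  - by case: (_ == _).
have h2 I : I \in homs r -> nu (P I) <= A.
  move=> Ih; rewrite /nu -natr_absz /A ler_nat (leq_trans (PA Ih)) //.
  by rewrite (_ : 24 * C ^ 2 = 8 * (3 * C ^ 2))%N //; lia.
have := compo_bound rN nu0 nu_ge0 nuD nuM nu1 (g := U) (P := P) KK (A := A) (Y := 1)
  (rho := fun _ _ => 1) (kap := kp) (ler0n _ _) ler01 (fun _ _ => ler01) kp0 h1 h2.
move=> h; apply: le_trans (h _) _ => [I _ _|].
  by rewrite big1 // => j _; rewrite big1 // => i _; rewrite expr1n.
rewrite mulr1 /A natrX [in leRHS]natrM [in leRHS]exprMn -!mulrA.
do 2![rewrite ler_wpM2l ?exprn_ge0 ?ler0n //].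

have -> : (a * m * W = \sum_(h < m) a * W)%N.
  by rewrite sum_nat_const card_ord; lia.
rewrite (big_morph _ (exprD _) (expr0 _)); apply: ler_prod => h' _; rewrite prodr_ge0 => [|j _]; last first.
  by rewrite exprn_ge0 // ltW.
rewrite /=; have pE (f : 'I_3 -> rat) : \prod_i f i = f i0 * f i1 * f i2.
  rewrite !big_ord_recl big_ord0 mulr1 mulrA.
  by congr (f _ * f _ * f _); exact: val_inj.
rewrite pE /kp /= expr1n mulr1 -exprD -exprM ler_weXn2l ?ler1n //.
rewrite -mulnA -(cr h') !leq_mul2l; apply/orP; right; apply/orP; right.
have /homsP/(_ h') <- := Kh.
have -> : (\sum_j KK h' j = KK h' i0 + KK h' i1 + KK h' i2)%N := sum3 (fun j => nat_of_ord (KK h' j)).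
exact: leq_addr.
Qed.

(** A nonzero integer would satisfy 1 <= |z| |z|_p. The two bounds leave a gain 2^(m' W) against
    2^(S W), because the transverse weight is below 1, and against the constant G^(sum r), with sum
    r <= 2 m' N. *)
Lemma vanish KK : KK \in homs r -> \sum_h (KK h i2)%:R / (r h)%:R < 1 :> rat -> compo r U P KK = 0.
Proof.
move=> Kh low; apply/eqP; apply: contraT => nz.
have W0 : (0 < W)%N.
  pose h0 : 'I_m := Ordinal (ltac:(lia) : (0 < m)%N).
  rewrite lt0n; apply/eqP => Wz; have := c0G; have /andP[r0 rn] := rN h0.
  have : (0 < N)%N by exact: leq_trans rn.
  move: Wz; rewrite Wc0 => /eqP; rewrite muln_eq0 => /orP[/eqP -> _|/eqP -> //].
  have G0 : (0 < (24 ^ 3 * (24 * C ^ 2)) ^ 4)%N.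
    by rewrite !(expn_gt0, muln_gt0) C0.
  by rewrite expn0 ltnS leqn0 => /eqP z; rewrite z in G0.
have sl : (\sum_h c h * KK h i2 <= W)%N.
  rewrite -(ler_nat rat) natr_sum.
  have -> : \sum_h (c h * KK h i2)%:R = W%:R * \sum_h (KK h i2)%:R / (r h)%:R :> rat.
    rewrite mulr_sumr; apply: eq_bigr => h _; rewrite -(cr h) !natrM.
    have : (r h)%:R != 0 :> rat by rewrite pnatr_eq0 -lt0n; have /andP[] := rN h.
    by move=> rh0'; field.
  by rewrite -[leRHS]mulr1 ler_wpM2l // ltW.
have V1 := vanish_ab Kh; have V2 := vanish_int Kh; have V0 := ab_prod nz.
set z := \sum_h r h in V1 V2.
have zN : (z <= m * N)%N.
  rewrite /z; apply: leq_trans (_ : \sum_(h < m) N <= _)%N.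
    by apply: leq_sum => h _; have /andP[] := rN h.
  by rewrite sum_nat_const card_ord.
have two0 k : (0 : rat) < 2 ^+ k by rewrite exprn_gt0.
pose G : nat := (24 ^ 3 * (24 * C ^ 2))%N.
have Gz : 1 <= (G%:R : rat) ^+ z * 2 ^+ (S * W) * 2 ^+ (a * m * W) * 2 ^- (m' * (2 * a + 1) * W).
  apply: le_trans V0 _; apply: le_trans (ler_pM _ _ V2 V1) _; rewrite ?ler0z ?ab_ge0 //.
  rewrite /G (exprM 24 2 z).
  have -> : (24 ^ 3 * (24 * C ^ 2))%N%:R = (24 * (24 * C ^ 2))%N%:R * 24 ^+ 2 :> rat.
    by rewrite !natrM; ring.
  have q0 : (0 : rat) <= 24 ^+ 2 by apply: exprn_ge0; exact: ler0n.
  move: q0; set q := (24 : rat) ^+ 2; clearbody q => q0; rewrite [in leRHS]exprMn.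
  have le : (2 : rat) ^+ (S * \sum_h c h * KK h i2) <= 2 ^+ (S * W).
    by rewrite ler_weXn2l ?ler1n // leq_mul2l sl orbT.
  set A1 := _ ^+ z; set A2 := _ ^+ z; set B := 2 ^+ (a * _ * _); set D := 2 ^- _.
  have p1 : 0 <= A1 by rewrite exprn_ge0 // ler0n.
  have p2 : 0 <= A2 by rewrite exprn_ge0.
  have p3 : 0 <= B by exact: ltW (two0 _).
  have p4 : 0 <= D by rewrite invr_ge0; exact: ltW (two0 _).
  clearbody A1 A2 B D.
  have -> (y : rat) : A1 * B * (A2 * D * y) = A1 * B * A2 * D * y by ring.
  have -> (y : rat) : A1 * A2 * y * B * D = A1 * B * A2 * D * y by ring.
  by rewrite ler_wpM2l // !mulr_ge0.
have e1 : (m' * (2 * a + 1) * W = a * m * W + m' * W)%N by rewrite mE; ring.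
have G1 : (2 : rat) ^+ (m' * W) <= (G%:R : rat) ^+ z * 2 ^+ (S * W).
  move: Gz; rewrite e1 exprD invfM !mulrA mulfK ?gt_eqF // ler_pdivlMr // mul1r //.
have G2 : (2 ^ (m' * W) <= G ^ (m * N) * 2 ^ (S * W))%N.
  have G0 : (0 < G)%N by rewrite /G !(expn_gt0, muln_gt0) C0.
  move: G1; rewrite -!natrX -natrM ler_nat => /leq_trans; apply.
  by rewrite leq_mul2r leq_pexp2l // orbT.
(* Squaring lets 2 S <= m' absorb the factor 2^(S W) into half of the gain; what remains contradicts
   G^4 < 2^c0 since W = c0 N. *)
have G3 : (2 ^ (2 * (m' * W)) <= G ^ (4 * m' * N) * 2 ^ (m' * W))%N.
  have := G2; rewrite -(@leq_exp2r _ _ 2) // -expnM mulnC => /leq_trans; apply.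
  rewrite expnMn -!expnM; apply: leq_mul; first by rewrite mE (_ : 2 * m' * N * 2 = 4 * m' * N)%N //; ring.
  rewrite leq_exp2l // mulnAC leq_mul2r; apply/orP; right.
  by rewrite mulnC.
have G4 : (2 ^ (m' * W) <= G ^ (4 * m' * N))%N.
  move: G3; rewrite [(2 * (m' * W))%N]mul2n -addnn expnD leq_pmul2r // expn_gt0 //.
move: G4; rewrite Wc0 leqNgt => /negP; case.
rewrite -mulnA [(G ^ _)%N]expnM (mulnCA m' c0 N) [(2 ^ _)%N]expnM ltn_exp2r //.
by move: W0; rewrite Wc0 !muln_gt0 m'0 => /andP[_ ->].
Qed.
End Vanish.

Lemma no_planes : ~ (forall B, exists2 X, good_plane X & (B <= pc X)%N).
Proof.
(* The term 36 d S^2 is what [chebyshev] needs for eps = 1/6 with m = 2 m' blocks; the term 2 S is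
   for [vanish]. *)
move=> fam; pose m' := (36 * d * S ^ 2 + 2 * S + 1)%N; pose m := (2 * m')%N.
have m'0 : (0 < m')%N by rewrite /m' addn1.
have m0 : (0 < m)%N by rewrite /m muln_gt0.
have [D D0 rD] := roth (leqnn m) ltr01.
(* G1 dominates the constants of [vanish]; G2 dominates those of Roth's lemma, where the
   denominators are only controlled through their powers 2 g. *)
pose G1 := ((24 ^ 3 * (24 * C ^ 2)) ^ 4)%N; pose G2 := ((2 * (192 * C ^ 2) ^ m) ^ (2 * g * D))%N.
have [x [xg xB xD]] := seq_choice fam D (G1 + G2) m.
pose X (h : 'I_m) := x h; pose c h := pc (X h).
pose h0 : 'I_m := Ordinal m0; pose c0 := c h0.
(* Degrees inversely proportional to the scales: every product c h * r h is exactly W, and rapidly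
   increasing scales become the rapidly decreasing degrees of Roth's lemma. *)
pose r (h : 'I_m) := (\prod_(h' | h' != h) c h')%N; pose N := r h0; pose W := (\prod_h c h)%N.
have cB h : (G1 + G2 <= c h)%N by exact: xB.
have cpos h : (0 < c h)%N.
  apply: leq_trans (cB h); rewrite addn_gt0; apply/orP; left.
  by rewrite /G1 !(expn_gt0, muln_gt0) C0.
have cr h : (c h * r h = W)%N by rewrite /W /r [RHS](bigD1 h).
have r0 h : (0 < r h)%N by rewrite prodn_gt0.
have cD (h h' : 'I_m) : (h < h')%N -> (D * c h <= c h')%N by move=> hh; exact: xD.
have c0h h : (c0 <= c h)%N.
  have [h00|hp] := posnP h; first by rewrite /c0 (_ : h0 = h) //; exact: val_inj.
  by apply: leq_trans (cD h0 h hp); rewrite leq_pmull.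
have rN h : (0 < r h <= N)%N.
  rewrite r0 /= -(leq_pmul2l (cpos h)) cr -(cr h0) leq_mul2r.
  by rewrite orbC c0h.
have c2 : (G1 + G2 < 2 ^ c0)%N.
  by apply: leq_ltn_trans (cB h0) _; exact: ltn_expl.
have m'S : (2 * S <= m')%N by rewrite /m'; lia.
have tS' := tS.
have mS : (2 * d * S ^ 2)%:R <= (1 / 6) ^+ 2 * m%:R :> rat.
  have : (72 * (d * S ^ 2) <= m)%N by rewrite /m /m'; lia.
  rewrite -(ler_nat rat) natrM -mulnA natrM; lra.
have [P [Pnz PA Plow]] := aux_poly C0 rhoC rhoE rN EC tS' (ltac:(by rewrite /S addn2) : (0 < S)%N)
  (ltac:(by []) : 0 < 1 / 6 :> rat) m0 mS.
have /fin_all_exists[pi pipick] : forall h, exists pi : 'S_3, pM (X h) (pi i0) != 0 /\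
   ((2 ^ c h)%:R <= ((denq (- ((pM (X h) (pi i1))%:~R / (pM (X h) (pi i0))%:~R)))%:~R : rat) ^+ (2 * g)).
  move=> h; have [gM _ _ _ bM] := xg h (ltn_ord h).
  have b0 : (0 < 2 ^ c h)%N by rewrite expn_gt0.
  by have [pi ? ?] := plane_pick b0 g0 gM bM; exists pi.
pose xi h : rat := - ((pM (X h) (pi h i1))%:~R / (pM (X h) (pi h i0))%:~R).
pose xi' h : rat := - ((pM (X h) (pi h i2))%:~R / (pM (X h) (pi h i0))%:~R).
have /fin_all_exists[T0 /fin_all_exists[F0 TF]] : forall h, exists T F : 'M[rat]_3,
  [/\ (forall j, T ord_max j = (j == ord_max)%:R) /\ (forall i, i != ord_max -> T i ord_max = 0),
      F = map_mx intr (Umx (pu (X h)) (pw (X h)) (pi h i0)) *m T,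
      (forall j, F (pi h i0) j = nth 0 [:: xi h; xi' h; 1] j),
      (forall j, F (pi h i1) j = (j == i0)%:R) & (forall j, F (pi h i2) j = (j == i1)%:R)].
  move=> h; have [_ [lam lam0 cre] _ _ _] := xg h (ltn_ord h).
  have [pz _] := pipick h.
  by have [T [F TF]] := plane_dir lam0 cre pz; exists T, F.
have UP KK : KK \in homs r -> \sum_h (KK h i2)%:R / (r h)%:R < 1 :> rat ->
  compo r (fun h => Umx (pu (X h)) (pw (X h)) (pi h i0)) P KK = 0.
  apply: (@vanish m m' N W r X (fun h => pi h i0) P) => //.
  - by move=> h; exact: xg.
  - exact: esym (cr h0).
  - by apply: leq_ltn_trans c2; exact: leq_addr.
have [Q [Q0 Qi Qd Qn Qv]] := roth_link rN Pnz (fun h => let: And5 q _ _ _ _ := TF h in q.1)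
  (fun h => let: And5 q _ _ _ _ := TF h in q.2) (fun h => let: And5 _ q _ _ _ := TF h in q)
  (fun h => let: And5 _ _ q _ _ := TF h in q) (fun h => let: And5 _ _ _ q _ := TF h in q)
  (fun h => let: And5 _ _ _ _ q := TF h in q) UP.
apply: (rD r xi Q N) Qv => //.
- move=> h h' hh _; rewrite -(leq_pmul2l (cpos h)) cr -(cr h') mulnCA mulnA.
  by rewrite leq_mul2r cD ?orbT.
- move=> h _; have [_ qh] := pipick h.
  pose L : nat := (192 * C ^ 2)%N.
  have nQ : nrm Q <= (L ^ (m * N))%N%:R.
    apply: le_trans Qn _; apply: le_trans (_ : _ <= \sum_(I in homs r) ((8 * (3 * C ^ 2)) ^ \sum_h r h)%N%:R) _.
      by apply: ler_sum => I Ih; rewrite -intr_norm -natr_absz ler_nat PA.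
    rewrite sumr_const -[leLHS]mulr_natl -natrM ler_nat.
    have /andP[_ h8] := card_homs rN.
    apply: (@leq_trans (L ^ (\sum_h r h))%N).
      have -> : L = (8 * (8 * (3 * C ^ 2)))%N by rewrite /L; ring.
      by rewrite [in leqRHS]expnMn leq_mul2r h8 orbT.
    rewrite leq_pexp2l //; first by rewrite /L !(expn_gt0, muln_gt0) C0.
    apply: leq_trans (_ : \sum_(h < m) N <= _)%N; last by rewrite sum_nat_const card_ord.
    by apply: leq_sum => h' _; have /andP[] := rN h'.
  have nQ0 : 0 <= nrm Q by apply: le_trans (nrm_ge1 Q0 Qi).
  (* Raised to the power 2 g, the left side is at most G2^N <= 2^(c0 N) = 2^W = 2^(c h r h), and
     [plane_pick] bounds the last power by the denominator. *)
  rewrite -(@ler_pXn2r _ (2 * g)) ?nnegrE ?muln_gt0 ?g0 //; last first.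
  + by rewrite exprn_ge0 // /qd ler0z denq_ge0.
  + by rewrite exprn_ge0 // mulr_ge0 // exprn_ge0.
  rewrite -[leRHS]exprM [(r h * _)%N]mulnC [leRHS]exprM.
  apply: le_trans (lerX (r h) _ qh); last by rewrite ler0n.
  rewrite -[leRHS]natrX -expnM cr -(cr h0).
  apply: le_trans (_ : _ <= ((2 ^ N * L ^ (m * N))%N%:R ^+ D) ^+ (2 * g)) _.
    apply: lerX; first by rewrite exprn_ge0 // mulr_ge0 // exprn_ge0.
    apply: lerX; first by rewrite mulr_ge0 // exprn_ge0.
    by rewrite natrM natrX ler_wpM2l // exprn_ge0.
  rewrite -exprM -natrX ler_nat.
  have -> : ((2 ^ N * L ^ (m * N)) ^ (D * (2 * g)) = G2 ^ N)%N.
    by rewrite /G2 [(L ^ (m * N))%N]expnM -expnMn -!expnM; congr (_ ^ _)%N; lia.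
  rewrite [leqRHS]expnM leq_exp2r ?r0 // ltnW //.
  by apply: leq_ltn_trans c2; exact: leq_addl.
- by move=> q qQ h; rewrite ltn_ord; exact: Qd.
Qed.
End KP.

(** * Planes from a good approximation *)

Definition v3 (T : Type) (a b c : T) : 'I_3 -> T := fun i => if i == i0 then a else if i == i1 then b else c.
Definition dot3 (u v : 'I_3 -> int) : int := u i0 * v i0 + u i1 * v i1 + u i2 * v i2.
Definition cr3 (u v : 'I_3 -> int) : 'I_3 -> int :=
  v3 (u i1 * v i2 - u i2 * v i1) (u i2 * v i0 - u i0 * v i2) (u i0 * v i1 - u i1 * v i0).
Definition supn (u : 'I_3 -> int) : nat := maxn (maxn `|u i0| `|u i1|) `|u i2|.
Definition gcd3 (u : 'I_3 -> int) : nat := gcdn (gcdn `|u i0| `|u i1|) `|u i2|.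

Lemma supn_ge u i : (`|u i| <= supn u)%N.
Proof. by rewrite /supn; move: i; apply: I3_case; rewrite !leq_max leqnn ?orbT. Qed.

Lemma supn_ex u : exists i, `|u i|%N = supn u.
Proof.
rewrite /supn; case: (leqP `|u i0| `|u i1|) => h; case: leqP => h'; by [exists i0|exists i1|exists i2].
Qed.

Lemma supn_le u b : (forall i, (`|u i| <= b)%N) -> (supn u <= b)%N.
Proof. by have [i <-] := supn_ex u. Qed.

Lemma supn_gt0 u i : u i != 0 -> (0 < supn u)%N.
Proof. by rewrite -absz_gt0 => /leq_trans; apply; exact: supn_ge. Qed.

Lemma gcd3_dvd u i : (gcd3 u %| `|u i|)%N.
Proof.
rewrite /gcd3; move: i; apply: I3_case; rewrite ?dvdn_gcdr //.
  by apply: dvdn_trans (dvdn_gcdl _ _) (dvdn_gcdl _ _).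
by apply: dvdn_trans (dvdn_gcdl _ _) (dvdn_gcdr _ _).
Qed.

Lemma gcd3_gt0 u i : u i != 0 -> (0 < gcd3 u)%N.
Proof. by rewrite -absz_gt0 => /(dvdn_gt0) -> //; exact: gcd3_dvd. Qed.

Lemma gcd3_nz u : gcd3 u = 1%N -> exists i, u i != 0.
Proof.
move=> g1; apply: contrapT => h.
have z i : u i = 0 by apply/eqP; apply: contrapT => /negP ?; apply: h; exists i.
by move: g1; rewrite /gcd3 !z.
Qed.

Lemma bezout3 u : gcd3 u = 1%N -> exists c, dot3 u c = 1.
Proof.
rewrite /gcd3 => g1.
have [a [b ab]] := Bezoutz (u i0) (u i1).
have [a' [b' ab']] := Bezoutz (gcdz (u i0) (u i1)) (u i2).
exists (v3 (a' * a) (a' * b) b'); rewrite /dot3 /v3 /=.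
rewrite [RHS](_ : 1 = gcdz (gcdz (u i0) (u i1)) (u i2)); last by rewrite /gcdz g1.
by rewrite -ab' -ab; ring.
Qed.

Lemma near_quo (a b : int) : b != 0 -> exists k : int, (2 * `|(a - k * b)%R| <= `|b|)%N.
Proof.
move=> b0; have r0 := modz_ge0 a b0; have r1 := ltz_mod a b0; have E := divz_eq a b.
case: (leqP (2 * `|(a %% b)%Z|) `|b|) => h.
  exists (a %/ b)%Z; rewrite {1}E [X in `|X|%N](_ : _ = (a %% b)%Z) //; ring.
exists ((a %/ b)%Z + Num.sg b).
rewrite {1}E [X in `|X|%N](_ : _ = (a %% b)%Z - `|b|).
  by move: r0 r1 h; move: (a %% b)%Z => r; lia.
by rewrite normrEsg; ring.
Qed.

Lemma absz_tri (a b : int) : (`|(a + b)%R| <= `|a| + `|b|)%N.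
Proof. lia. Qed.

Lemma supn_wedge u w i j : i != j -> (`|(u i * w j - u j * w i)%R| <= supn (cr3 u w))%N.
Proof.
move=> ij; suff [l <-] : exists l, `|cr3 u w l|%N = `|(u i * w j - u j * w i)%R|%N by exact: supn_ge.
move: i j ij; do 2!apply: I3_case; rewrite ?eqxx // => _;
 solve [by exists i0; rewrite /cr3 /v3 /= // distnC | by exists i1; rewrite /cr3 /v3 /= // distnC
   | by exists i2; rewrite /cr3 /v3 /= // distnC].
Qed.

(** The identity x x (y x c) = (x . c) y - (x . y) c, where the last term vanishes. *)
Lemma cr3_bac x y c : dot3 x y = 0 -> cr3 x (cr3 y c) =1 (fun i => dot3 x c * y i).
Proof.
rewrite /dot3 => h; have h' : x i0 * y i0 = - (x i1 * y i1 + x i2 * y i2) by move: h; lia.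
have h1 : x i1 * y i1 = - (x i0 * y i0 + x i2 * y i2) by move: h; lia.
have h2 : x i2 * y i2 = - (x i0 * y i0 + x i1 * y i1) by move: h; lia.
apply: I3_case; rewrite /cr3 /v3 /=; apply/eqP; rewrite -subr_eq0; apply/eqP.
- transitivity (- (c i0 * (x i1 * y i1 + x i2 * y i2 + x i0 * y i0))); first by ring.
  by rewrite h'; ring.
- transitivity (- (c i1 * (x i1 * y i1 + x i2 * y i2 + x i0 * y i0))); first by ring.
  by rewrite h'; ring.
- transitivity (- (c i2 * (x i1 * y i1 + x i2 * y i2 + x i0 * y i0))); first by ring.
  by rewrite h'; ring.
Qed.

Lemma cr3_shift x t q k : cr3 x (fun i => q * t i - k * x i) =1 (fun i => q * cr3 x t i).
Proof. by apply: I3_case; rewrite /cr3 /v3 /=; ring. Qed.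

Lemma dot3_cr x c : dot3 x (cr3 x c) = 0.
Proof. by rewrite /dot3 /cr3 /v3 /=; ring. Qed.

Lemma supn_eq u w : u =1 w -> supn u = supn w.
Proof. by move=> e; rewrite /supn !e. Qed.

(** Take y shortest in the lattice orthogonal to x, and w reduced modulo y at the largest coordinate
    i of y. Then |y| |w| <= |x| + |y|^2 / 2, the first term coming from the cross product, and |y|
    <= |w| absorbs the second one. *)
Lemma reduced_basis x : gcd3 x = 1%N -> exists y w,
  [/\ dot3 x y = 0, dot3 x w = 0, cr3 y w =1 x, gcd3 y = 1%N &
      (0 < supn y <= supn w)%N /\ (supn y * supn w <= 2 * supn x)%N].
Proof.
move=> gx; have [ix xi] := gcd3_nz gx.
pose P n := `[< exists y, [/\ exists i, y i != 0, dot3 x y = 0 & supn y = n] >].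
have exP : exists n, P n.
  suff [y y0 xy] : exists2 y, (exists i, y i != 0) & dot3 x y = 0.
    by exists (supn y); apply/asboolP; exists y.
  have [e1|n1] := eqVneq (x i1) 0.
    by exists (v3 0 1 0); [exists i1 | rewrite /dot3 /v3 /= e1; ring].
  by exists (v3 (x i1) (- x i0) 0); [exists i0 | rewrite /dot3 /v3 /=; ring].
case: (ex_minnP exP) => n1 /asboolP[y [[iy yi] xy yn]] min.
have {}min z : (exists i, z i != 0) -> dot3 x z = 0 -> (supn y <= supn z)%N.
  by move=> z0 xz; rewrite yn min //; apply/asboolP; exists z.
have y0 : (0 < supn y)%N := supn_gt0 yi.
have gy : gcd3 y = 1%N.
  have g0 := gcd3_gt0 yi; set g := gcd3 y in g0 *.
  pose z i := (y i %/ g%:Z)%Z.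
  have yE i : y i = z i * g%:Z by rewrite /z divzK // dvdzE /= gcd3_dvd.
  have zn : (supn y <= supn z)%N.
    apply: min; first by exists iy; move: yi; rewrite yE mulf_eq0 negb_or => /andP[].
    have : dot3 x z * g%:Z = 0 by rewrite -xy /dot3 !yE; ring.
    by move/eqP; rewrite mulf_eq0 => /orP[/eqP //|]; rewrite eqz_nat => /eqP gg; rewrite gg in g0.
  have [l lE] := supn_ex z; have := supn_ge y l; rewrite yE abszM lE absz_nat => le.
  have z0 : (0 < supn z)%N by apply: leq_trans zn.
  have : (supn z * g <= supn z)%N by lia.
  by rewrite -{2}[supn z]muln1 leq_pmul2l // => ?; apply/eqP; rewrite eqn_leq g0 andbT.
(* Since y is primitive there is c with y . c = 1, and [cr3_bac] shows that x x c completes y to a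
   pair of cross product x. *)
have [c cE] := bezout3 gy; pose w0 := cr3 x c.
have yx : dot3 y x = 0 by rewrite -xy /dot3; ring.
have yw0 : cr3 y w0 =1 x by move=> i; rewrite cr3_bac // cE mul1r.
have [i iE] := supn_ex y; have yi0 : y i != 0 by rewrite -absz_gt0 iE.
have [k kE] := near_quo (w0 i) yi0.
pose w l := 1 * w0 l - k * y l.
have yw : cr3 y w =1 x by move=> l; rewrite cr3_shift yw0 mul1r.
have xw : dot3 x w = 0.
  transitivity (dot3 x w0 - k * dot3 x y); first by rewrite /dot3 /w; ring.
  by rewrite /w0 dot3_cr xy; ring.
have wnz : exists l, w l != 0.
  apply: contrapT => h; have z l : w l = 0 by apply/eqP; apply: contrapT => /negP ?; apply: h; exists l.
  have := yw ix; move: xi; move: ix; apply: I3_case; rewrite /cr3 /v3 /= !z !mulr0 subr0 => /eqP h' e; by apply: h'; rewrite -e.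
have le := min _ wnz xw.
have [j jE] := supn_ex w.
have ij : i != j.
  apply/eqP => e; subst j; move: kE; rewrite -[w0 i]mul1r -/(w i) jE iE; lia.
have := supn_wedge y w ij; rewrite (supn_eq yw) => wed.
exists y, w; split=> //; rewrite y0 le; split=> //.
have yj := supn_ge y j.
have E : y i * w j = (y i * w j - y j * w i) + y j * w i by ring.
have T : (`|y i| * `|w j| <= supn x + `|y j| * `|w i|)%N.
  rewrite -!abszM [in X in (X <= _)%N]E; apply: leq_trans (absz_tri _ _) _.
  by rewrite leq_add2r.
move: kE; rewrite -[w0 i]mul1r -/(w i) iE => wi.
rewrite iE jE in T.
have m1 := leq_mul yj wi; have m2 : (supn y * supn y <= supn y * supn w)%N by rewrite leq_mul2l le orbT.
move: T m1 m2; clear; lia.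
Qed.

(* x and w span a sublattice of index q of the lattice orthogonal to y. *)
Lemma second_vector x y (q : nat) : gcd3 x = 1%N -> dot3 x y = 0 -> (q * supn y <= supn x ^ 2)%N ->
  exists w t (k : int), [/\ cr3 x w =1 (fun i => q%:Z * y i), (supn w <= 2 * supn x)%N &
     w =1 (fun i => q%:Z * t i - k * x i)].
Proof.
move=> gx xy qy; have [ix xi] := gcd3_nz gx.
have [c cE] := bezout3 gx; pose t := cr3 y c.
have xt : cr3 x t =1 y by move=> i; rewrite cr3_bac // cE mul1r.
have x0 := supn_gt0 xi.
have [i iE] := supn_ex x; have xi0 : x i != 0 by rewrite -absz_gt0 iE.
have [k kE] := near_quo (q%:Z * t i) xi0.
(* Reduction at the largest coordinate i of x. The other coordinates follow from the cross product q
   y: |x| |w_j| <= q |y| + |x|^2 / 2, and q |y| <= |x|^2. *)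
pose w l := q%:Z * t l - k * x l; rewrite -/(w i) iE in kE.
have xw : cr3 x w =1 (fun i => q%:Z * y i) by move=> l; rewrite cr3_shift xt.
exists w, t, k; split=> //; apply: supn_le => j.
have [<-|ij] := eqVneq i j; first by lia.
have := supn_wedge x w ij; rewrite (supn_eq xw).
have [l lE] := supn_ex (fun i => q%:Z * y i); rewrite -lE abszM absz_nat => wed.
have yl := supn_ge y l; have xj := supn_ge x j.
have E : x i * w j = (x i * w j - x j * w i) + x j * w i by ring.
have T : (`|x i| * `|w j| <= q * supn y + `|x j| * `|w i|)%N.
  rewrite -!abszM [in X in (X <= _)%N]E; apply: leq_trans (absz_tri _ _) _.
  apply: leq_add => //; apply: leq_trans wed _; by rewrite leq_mul2l yl orbT.
rewrite iE in T.
have T2 : (`|x j| * `|w i| * 2 <= supn x * supn x)%N.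
  by have := leq_mul xj kE; rewrite mulnCA mulnC.
have : (supn x * `|w j| * 2 <= supn x * (3 * supn x))%N.
  move: T T2 qy; clear; rewrite -mulnn; lia.
rewrite -mulnA leq_pmul2l //; lia.
Qed.

Section Logs.
Variable R : realType.
Definition lg (n : nat) : R := ln n%:R.

Lemma lg1 : lg 1 = 0. Proof. by rewrite /lg ln1. Qed.

Lemma lgM a b : (0 < a)%N -> (0 < b)%N -> lg (a * b) = lg a + lg b.
Proof. by move=> a0 b0; rewrite /lg natrM lnM ?posrE ?ltr0n. Qed.

Lemma lgX a k : (0 < a)%N -> lg (a ^ k) = k%:R * lg a.
Proof. by move=> a0; rewrite /lg natrX lnXn ?ltr0n // mulr_natl. Qed.

Lemma lg_le a b : (0 < a)%N -> (0 < b)%N -> (lg a <= lg b) = (a <= b)%N.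
Proof. by move=> a0 b0; rewrite /lg ler_ln ?posrE ?ltr0n // ler_nat. Qed.

Lemma lg_lt a b : (0 < a)%N -> (0 < b)%N -> (lg a < lg b) = (a < b)%N.
Proof. by move=> a0 b0; rewrite ltNge lg_le // -ltnNge. Qed.

Lemma lg_ge0 a : (0 < a)%N -> 0 <= lg a.
Proof. by move=> a0; rewrite -lg1 lg_le. Qed.

Lemma lg2_gt0 : 0 < lg 2. Proof. by rewrite -lg1 lg_lt. Qed.

Lemma lg_large (T : R) : exists2 F0 : nat, (0 < F0)%N & forall F, (F0 <= F)%N -> T <= lg F.
Proof.
exists (Num.truncn (expR T)).+1 => // F le.
rewrite -[T]expRK /lg ler_ln ?posrE ?expR_gt0 //; last first.
  by rewrite ltr0n; exact: leq_trans le.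
apply/ltW; apply: lt_le_trans (truncnS_gt _) _; by rewrite ler_nat.
Qed.

(** Scales of planes are integers, so a size is rounded up to a power of 2^50; the loss of at most
    2^50 is absorbed by taking F large. *)
Lemma pow_approx n : (0 < n)%N -> exists2 c, (n <= 2 ^ (50 * c))%N &
  50 * (c%:R * lg 2) <= 50 * lg 2 + lg n.
Proof.
move=> n0; have ex : exists c, (n <= 2 ^ (50 * c))%N.
  by exists n; apply: ltnW; apply: leq_trans (ltn_expl n (ltnSn 1)) _; rewrite leq_pexp2l // leq_pmull.
have [c ch min] := ex_minnP ex; exists c => //.
have l2 := lg2_gt0; have ln0 := lg_ge0 n0.
case: c ch min => [|c] ch min; first by rewrite mul0r; lra.
have : (2 ^ (50 * c) < n)%N by rewrite ltnNge; apply/negP => /min; rewrite ltnn.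
rewrite -lg_lt ?expn_gt0 // lgX // natrM -natr1; lra.
Qed.
End Logs.

(* Its first row is (1, X, X^2); both Ept and its transpose are involutions. *)
Definition Ept : 'M[{poly int}]_3 :=
  \matrix_(i, j) if i == i0 then 'X^j else - (i == j)%:R.

Lemma Ept2 : Ept *m Ept = 1%:M.
Proof.
apply/matrixP; do 2!apply: I3_case; rewrite !mxE sum3 !mxE /=; ring.
Qed.

Lemma Ept2T : Ept^T *m Ept^T = 1%:M.
Proof. by rewrite -trmx_mul Ept2 trmx1. Qed.

Lemma pnrm_Ept C i j : (0 < C)%N -> pnrm C (Ept i j) <= C%:R ^+ 2.
Proof.
move=> C0; have C1 : 1 <= C%:R :> rat by rewrite ler1n.
have C2 : 1 <= C%:R ^+ 2 :> rat by rewrite exprn_ege1.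
have X k : pnrm C 'X^k = C%:R ^+ k.
  rewrite /pnrm size_polyXn (bigD1 ord_max) //= coefXn eqxx mul1r big1 ?addr0 // => i' ne.
  by rewrite coefXn; case: eqP => [e|_]; [case/eqP: ne; exact: val_inj|rewrite mul0r].
rewrite mxE; case: (i == i0).
  by rewrite X ler_weXn2l //; exact: (leq_ord j).
case: (i == j).
  have -> : pnrm C (- 1%:R) = 1; last exact: C2.
  by rewrite /pnrm size_polyN size_poly1 big_ord_recl big_ord0 /= coefN coef1 /= mulr1 addr0.
rewrite /pnrm oppr0 size_poly0 big_ord0; exact: exprn_ge0 (ler0n _ _).
Qed.

Section Planes.
Variable R : realType.
Variables (K : fieldType) (ab : K -> rat).
Hypothesis ab0 : ab 0 = 0.
Hypothesis ab_ge0 : forall x, 0 <= ab x.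
Hypothesis abU : forall x y, ab (x + y) <= Num.max (ab x) (ab y).
Hypothesis abM : forall x y, ab (x * y) = ab x * ab y.
Hypothesis ab_int : forall z : int, ab z%:~R <= 1.
Variables (p : nat) (beta : K) (C1 d : nat).
Hypothesis p1 : (1 < p)%N.
Hypothesis abp : ab p%:R = p%:R^-1.
Hypothesis ab1 : ab 1 = 1.
Hypothesis beta1 : ab beta <= 1.
Hypothesis C10 : (0 < C1)%N.
Hypothesis d0 : (0 < d)%N.
Definition conic_form (z : 'I_3 -> int) : K := (z i0)%:~R + beta * (z i1)%:~R + beta ^+ 2 * (z i2)%:~R.
Hypothesis liouville : forall z, (exists i, z i != 0) ->
  1 <= C1%:R * (supn z)%:R ^+ d * ab (conic_form z).

Let l2 := lg R 2.
(** The exponent g of [good_plane]. Liouville's inequality gives F <= C1 |y|^d for a normal y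
    orthogonal to x, so that even the short normal is at least a fixed power of the scale. *)
Definition slope_exp := (2 * d + 2)%N.
(** For the planes of normal x the small form is X0 + beta X1 + beta^2 X2, the first row of [Ept];
    for those of normal y the small forms are beta X0 - X1 and beta^2 X0 - X2, the last rows of its
    transpose. Both weights sum to 152 = 3 * 50 + 2. *)
Definition wt_one : 'I_3 -> nat := v3 152 0 0.
Definition wt_two : 'I_3 -> nat := v3 0 76 76.

Lemma abp_X k : ab ((p ^ k)%N%:R) = (p ^ k)%N%:R^-1.
Proof.
elim: k => [|k IH]; first by rewrite expn0 ab1 invr1.
by rewrite expnS !natrM abM IH abp invfM.
Qed.

Lemma abU_le x y b : ab x <= b -> ab y <= b -> ab (x + y) <= b.
Proof. by move=> hx hy; apply: le_trans (abU _ _) _; rewrite ge_max hx. Qed.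

Lemma abN x : ab (- x) <= ab x.
Proof. by rewrite -mulN1r abM ler_piMl ?ab_ge0 // (ab_int (-1)). Qed.

Section Point.
Variables (f : nat) (x : 'I_3 -> int).
Let F := (p ^ f)%N.
Hypothesis gx : gcd3 x = 1%N.
Hypothesis ax : ab (x i0)%:~R = 1.
Hypothesis L1 : ab (beta * (x i0)%:~R - (x i1)%:~R) * F%:R <= 1.
Hypothesis L2 : ab (beta ^+ 2 * (x i0)%:~R - (x i2)%:~R) * F%:R <= 1.

Let F0 : (0 < F)%N. Proof. by rewrite expn_gt0 ltnW. Qed.
Let FR : 0 < F%:R :> rat. Proof. by rewrite ltr0n. Qed.

(** Eliminating x0 z0 through x . z = 0, x0 times the form at z is (beta x0 - x1) z1 + (beta^2 x0 -
    x2) z2, and x0 is a p-adic unit. *)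
Lemma orth_small z : dot3 x z = 0 -> ab (conic_form z) * F%:R <= 1.
Proof.
move=> h; have -> : ab (conic_form z) = ab ((x i0)%:~R * conic_form z) by rewrite abM ax mul1r.
rewrite -ler_pdivlMr // mul1r.
have -> : (x i0)%:~R * conic_form z = (beta * (x i0)%:~R - (x i1)%:~R) * (z i1)%:~R +
   (beta ^+ 2 * (x i0)%:~R - (x i2)%:~R) * (z i2)%:~R.
  have : (dot3 x z)%:~R = 0 :> K by rewrite h.
  rewrite /dot3 !rmorphD !rmorphM /= => h'; apply/eqP; rewrite -subr_eq0 -h' /conic_form; apply/eqP; ring.
apply: abU_le; rewrite abM; apply: le_trans (ler_wpM2l (ab_ge0 _) (ab_int _)) _;
  by rewrite mulr1 -[leRHS]mul1r ler_pdivlMr.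
Qed.

(** [orth_small] against Liouville's inequality: a nonzero vector orthogonal to x satisfies F <= C1
    |z|^d. *)
Lemma orth_big z : dot3 x z = 0 -> (exists i, z i != 0) -> lg R F <= lg R C1 + d%:R * lg R (supn z).
Proof.
move=> xz zn; have z0 : (0 < supn z)%N by case: zn => i; exact: supn_gt0.
rewrite -lgX // -lgM ?expn_gt0 ?z0 // (lg_le R F0) ?muln_gt0 ?C10 ?expn_gt0 ?z0 // -(ler_nat rat).
have := liouville zn; have := orth_small xz; rewrite natrM natrX.
set A := _ * (supn z)%:R ^+ d; have A0 : 0 <= A by rewrite mulr_ge0 ?exprn_ge0.
rewrite -ler_pdivlMr // mul1r => h1 h2.
have : 1 <= A * F%:R^-1 by apply: le_trans h2 _; rewrite ler_wpM2l.
by rewrite ler_pdivlMr // mul1r.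
Qed.

Lemma point_big : lg R F <= lg R C1 + d%:R * lg R (supn x).
Proof.
have x0 : x i0 != 0.
  by apply: contra_eq_neq ax => ->; rewrite ab0 eq_sym oner_eq0.
have zn : exists i, v3 (- x i1) (x i0) 0 i != 0 by exists i1.
apply: le_trans (orth_big _ zn) _; first by rewrite /dot3 /v3 /=; ring.
have z0 : (0 < supn (v3 (- x i1) (x i0) 0))%N by case: zn => i; exact: supn_gt0.
rewrite lerD2l ler_wpM2l // lg_le // ?(supn_gt0 x0) //.
apply: supn_le; apply: I3_case; rewrite /v3 //= ?abszN; exact: supn_ge.
Qed.

Hypothesis X100 : (supn x ^ 100 <= F ^ 63)%N.
Variables (B : nat).
Let T : R := (50 * B%:R + 1000) * l2.
Hypothesis Flarge : 3 * lg R C1 + d%:R * T + 100 * 100 * 100 * (l2 + lg R p) <= lg R F.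

(* If the orthogonal lattice of x has no short vector, then x is the normal of a plane
   containing a reduced basis of that lattice; otherwise the shortest vector y is the
   normal, and x with a vector congruent to a multiple of it modulo a power of p
   spans the plane. *)
Lemma planes_of_point :
  (exists2 X, good_plane ab beta Ept wt_one 50 slope_exp X & (B <= pc X)%N) \/
  (exists2 X, good_plane ab beta Ept^T wt_two 50 slope_exp X & (B <= pc X)%N).
Proof.
have [ix xi] := gcd3_nz gx; have xpos := supn_gt0 xi.
have [y [w [xy xw yw gy [/andP[y0 yw_le] yw2]]]] := reduced_basis gx.
have w0 : (0 < supn w)%N by exact: leq_trans yw_le.
have [iy yi] := gcd3_nz gy.
have wn : exists i, w i != 0.
  by have [i iE] := supn_ex w; exists i; rewrite -absz_gt0 iE.
have bw := orth_big xw wn; have by_ := orth_big xy (ex_intro _ iy yi); have bx := point_big.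
have l20 : 0 < l2 := lg2_gt0 R.
have lp0 : 0 <= lg R p by apply: lg_ge0; exact: ltnW.
have lC0 := lg_ge0 R C10; have lx0 := lg_ge0 R xpos; have ly0 := lg_ge0 R y0; have lw0 := lg_ge0 R w0.
have lyw : lg R (supn y) <= lg R (supn w) by rewrite lg_le.
have lyw2 : lg R (supn y) + lg R (supn w) <= l2 + lg R (supn x).
  by rewrite -!lgM // lg_le ?muln_gt0 ?y0.
have lX : 100 * lg R (supn x) <= 63 * lg R F.
  have F63 : (0 < F ^ 63)%N by rewrite expn_gt0 F0.
  have x100 : (0 < supn x ^ 100)%N by rewrite expn_gt0 xpos.
  by move: X100; rewrite -(lg_le R x100 F63) (lgX R 100 xpos) (lgX R 63 F0).
have B0 : 0 <= B%:R * l2 by rewrite mulr_ge0 // ltW.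
have TE : T = 50 * (B%:R * l2) + 1000 * l2 by rewrite /T; ring.
have T0 : 0 <= T by rewrite TE addr_ge0 // mulr_ge0 ?ler0n // ltW.
have dR : 0 < d%:R :> R by rewrite ltr0n.
have dT : 0 <= d%:R * T by rewrite mulr_ge0.
have l2E : lg R 2 = l2 by [].
move: Flarge; clearbody T l2 => FL.
have Tx : T <= lg R (supn x) by rewrite -(ler_pM2l dR); lra.
have Tw : T <= lg R (supn w) by rewrite -(ler_pM2l dR); lra.
have geB c n : (0 < n)%N -> T <= lg R n -> (n <= 2 ^ (50 * c))%N -> (B <= c)%N.
  move=> n0 Tn; rewrite -(lg_le R) ?expn_gt0 // lgX // natrM => h.
  rewrite -(ler_nat R) -(ler_pM2r l20); rewrite ?l2E in h; lra.
have gE : slope_exp%:R = 2 * d%:R + 2 :> R by rewrite /slope_exp natrD natrM.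
(* The threshold is |w|^152 <= F^50 up to rounding: a scale c with |w| <= 2^(50 c) then still has
   2^(152 c) <= F. *)
case: (lerP (152 * (50 * l2 + lg R (supn w))) (50 * lg R F)) => caseI.
  left; have [c wc cl] := pow_approx R w0; rewrite ?l2E in cl.
  exists (Plane c x y w); last exact: geB w0 Tw wc.
  have cF : (2 ^ (152 * c) <= F)%N.
    by rewrite -(lg_le R) ?F0 ?expn_gt0 // lgX // natrM ?l2E; lra.
  have small z : dot3 x z = 0 -> forall i,
     ab (\sum_j (map_mx (evb beta) Ept) i j * (z j)%:~R) * 2 ^+ (wt_one i * c) <= 1.
    move=> xz; apply: I3_case; rewrite sum3 !mxE /= /wt_one /v3 /=.
    - rewrite expr0 rmorph1 expr1 rmorphXn /=.
      have -> : evb beta 'X = beta by rewrite /evb map_polyX hornerX.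
      rewrite mul1r; apply: le_trans (orth_small xz).
      by rewrite ler_wpM2l // -natrX ler_nat.
    - rewrite oppr0 rmorph0 rmorphN rmorph1 !mul0r add0r addr0 mulN1r mul0n expr0 mulr1.
      by rewrite (le_trans (abN _)).
    - rewrite oppr0 rmorph0 rmorphN rmorph1 !mul0r !add0r mulN1r mul0n expr0 mulr1.
      by rewrite (le_trans (abN _)).
  split=> //=.
  - exists 1 => //; move: (yw i0) (yw i1) (yw i2); rewrite /cr3 /v3 /= => e0 e1 e2.
    by split; rewrite mul1r.
  - move=> i; split; apply: leq_trans (supn_ge _ _) _; last exact: wc.
    exact: leq_trans yw_le wc.
  - by move=> i; split; apply: small.
  - have [i iE] := supn_ex x; exists i; rewrite iE -(lg_le R) ?expn_gt0 ?xpos // !lgX // ?l2E gE.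
    have : 0 <= d%:R * lg R (supn x) by rewrite mulr_ge0 // ltW.
    lra.
right.
(* The modulus q is the largest power of p, at most F, with q |y| <= |x|^2, and it has to exceed
   |x|^(76/50). When q < F, it is at least |x|^2 / (p |y|), and |y| <= 2 |x| / |w| with |w| above
   F^(50/152). In logarithms the comparison is 2500/152 = 16.44... against 26 * 63/100 = 16.38; this
   thin margin is why [Flarge] has such a big constant. *)
have [q [k kf qE] [qy ql]] : exists2 q, (exists2 k, (k <= f)%N & q = p ^ k)%N &
    (q * supn y <= supn x ^ 2)%N /\ 76 * (51 * l2 + lg R (supn x)) <= 50 * lg R q.
  have [le|gt] := leqP (F * supn y) (supn x ^ 2).
    exists F; first by exists f.
    by split=> //; lra.
  have st : (p ^ 0 * supn y <= supn x ^ 2)%N.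
    rewrite expn0 mul1n -(lg_le R) ?expn_gt0 ?xpos // lgX //; lra.
  have ex : exists k, (supn x ^ 2 < p ^ k * supn y)%N by exists f.
  case: (ex_minnP ex) => [[|k]] hk min; first by rewrite ltnNge st in hk.
  exists (p ^ k)%N; first by exists k => //; apply: ltnW; exact: min.
  split; first by rewrite leqNgt; apply/negP => /min; rewrite ltnn.
  have pk0 : (0 < p ^ k)%N by rewrite expn_gt0 ltnW.
  have p0 : (0 < p)%N := ltnW p1.
  have ppk0 : (0 < p * p ^ k)%N by rewrite muln_gt0 p0.
  have ppky0 : (0 < p * p ^ k * supn y)%N by rewrite muln_gt0 ppk0.
  have xx0 : (0 < supn x ^ 2)%N by rewrite expn_gt0 xpos.
  move: hk; rewrite [(p ^ _.+1)%N]expnS -(lg_lt R xx0 ppky0) (lgX R 2 xpos) (lgM R ppk0 y0) (lgM R p0 pk0); lra.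
have q0 : (0 < q)%N by rewrite qE expn_gt0 ltnW.
have x20 : (0 < 2 * supn x)%N by rewrite muln_gt0.
have [v [t [k' [xv v2 vE]]]] := second_vector gx xy qy.
have [c xc cl] := pow_approx R x20; rewrite lgM // ?l2E in cl.
have cq : (2 ^ (76 * c) <= q)%N.
  by rewrite -(lg_le R) ?q0 ?expn_gt0 // lgX // natrM ?l2E; lra.
have cF : (2 ^ (76 * c) <= F)%N by apply: leq_trans cq _; rewrite qE leq_pexp2l // ltnW.
exists (Plane c y x v); last first.
  apply: geB xpos Tx _; apply: leq_trans xc; exact: leq_pmull.
have Q2 : (2 : rat) ^+ (76 * c) <= F%:R by rewrite -natrX ler_nat.
have Qq : (2 : rat) ^+ (76 * c) <= q%:R by rewrite -natrX ler_nat.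
have small (h : K) (xh : 'I_3) : xh != i0 -> ab h <= 1 -> ab (h * (x i0)%:~R - (x xh)%:~R) * F%:R <= 1 ->
   ab (h * (x i0)%:~R - (x xh)%:~R) * 2 ^+ (76 * c) <= 1 /\
   ab (h * (v i0)%:~R - (v xh)%:~R) * 2 ^+ (76 * c) <= 1.
  move=> _ h1 hx; have hx' : ab (h * (x i0)%:~R - (x xh)%:~R) * 2 ^+ (76 * c) <= 1.
    by apply: le_trans hx; rewrite ler_wpM2l.
  split=> //; rewrite !vE.
  (* Modulo q the vector v is a multiple of x, so its forms are as small as q or as those of x. *)
  have -> : h * (q%:Z * t i0 - k' * x i0)%:~R - (q%:Z * t xh - k' * x xh)%:~R =
     q%:R * (h * (t i0)%:~R - (t xh)%:~R) + (- k')%:~R * (h * (x i0)%:~R - (x xh)%:~R).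
    by rewrite !(rmorphB, rmorphM, rmorphN) /=; ring.
  have e0 : (0 : rat) < 2 ^+ (76 * c) by rewrite exprn_gt0.
  rewrite -ler_pdivlMr // mul1r; apply: abU_le; rewrite abM.
    have hh : ab (h * (t i0)%:~R - (t xh)%:~R) <= 1.
      apply: abU_le; first by rewrite abM mulr_ile1 ?ab_ge0.
      by apply: le_trans (abN _) _.
    apply: le_trans (ler_wpM2l (ab_ge0 _) hh) _; rewrite mulr1 qE abp_X -qE.
    by rewrite lef_pV2 ?posrE // ltr0n.
  apply: le_trans (ler_wpM2r (ab_ge0 _) (ab_int _)) _.
  by rewrite mul1r -[_^-1]mul1r ler_pdivlMr.
split=> //=.
- exists q%:Z; first by rewrite -lt0n.
  move: (xv i0) (xv i1) (xv i2); rewrite /cr3 /v3 /= => e0 e1 e2.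
  by split.
- move=> i; split; apply: leq_trans (supn_ge _ _) _; last exact: leq_trans xc.
  by apply: leq_trans xc; exact: leq_pmull.
- have bX : evb beta 'X = beta by rewrite /evb map_polyX hornerX.
  have form (z : 'I_3 -> int) : [/\ \sum_j (map_mx (evb beta) Ept^T) i0 j * (z j)%:~R = (z i0)%:~R,
     \sum_j (map_mx (evb beta) Ept^T) i1 j * (z j)%:~R = beta * (z i0)%:~R - (z i1)%:~R &
     \sum_j (map_mx (evb beta) Ept^T) i2 j * (z j)%:~R = beta ^+ 2 * (z i0)%:~R - (z i2)%:~R].
    split; rewrite sum3 !mxE /= ?expr0 ?expr1 ?rmorphN ?rmorphXn /= ?rmorph1 ?rmorph0 ?bX; ring.
  have [f0 f1 f2] := form x; have [f0' f1' f2'] := form v.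
  apply: I3_case; rewrite /wt_two /v3 /=.
  + by rewrite f0 f0' mul0n expr0 !mulr1.
  + by rewrite f1 f1'; exact: small.
  + by rewrite f2 f2'; apply: small => //; rewrite expr2 abM mulr_ile1.
- have [i iE] := supn_ex y; exists i; rewrite iE -(lg_le R) ?expn_gt0 ?y0 // !lgX // ?l2E gE.
  lra.
Qed.
End Point.
End Planes.

(** * A Liouville inequality *)

Section Liouville.
Variables (K : fieldType) (ab : K -> rat).
Hypothesis ab0 : ab 0 = 0.
Hypothesis ab_ge0 : forall x, 0 <= ab x.
Hypothesis abU : forall x y, ab (x + y) <= Num.max (ab x) (ab y).
Hypothesis abM : forall x y, ab (x * y) = ab x * ab y.
Hypothesis ab1 : ab 1 = 1.
Hypothesis ab_int : forall z : int, ab z%:~R <= 1.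
Hypothesis ab_prod : forall z : int, z != 0 -> 1 <= `|z|%:~R * ab z%:~R.
Variables (beta : K) (e : nat).
Let d := e.+1.
Variable cc : 'I_d -> int.
Hypothesis betaE : beta ^+ d = \sum_(j < d) (cc j)%:~R * beta ^+ j.

(** The coordinates of beta^k on 1, ..., beta^e: multiplication by beta shifts them, and [betaE]
    rewrites the overflow beta^d. *)
Fixpoint rho k : 'I_d -> int :=
  if k is k'.+1 then fun j => (if j == ord0 then 0 else rho k' (inord j.-1)) + rho k' ord_max * cc j
  else fun j => (j == ord0)%:R.

Lemma rhoE k : beta ^+ k = \sum_j (rho k j)%:~R * beta ^+ j.
Proof.
elim: k => [|k IH].
  by rewrite (bigD1 ord0) //= big1 ?addr0 ?mul1r // => i /negbTE ->; rewrite mul0r.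
rewrite exprS IH /=.
under [RHS]eq_bigr do rewrite rmorphD /= mulrDl.
rewrite big_split /= [X in _ = X + _]big_ord_recl /= mul0r add0r.
under [X in _ = _ + X]eq_bigr do rewrite rmorphM /= -mulrA.
rewrite -mulr_sumr -betaE big_ord_recr /= mulrDr mulr_sumr; congr (_ + _).
  apply: eq_bigr => j _; rewrite /= mulrCA -exprS; congr (_%:~R * _).
  by congr (rho k _); apply: val_inj; rewrite /= inordK //; exact: leqW (ltn_ord j).
by rewrite mulrCA -exprS.
Qed.

Definition Crho := (1 + \sum_(j < d) `|cc j|)%N.

Lemma rhoC k j : `|rho k j|%:~R <= Crho%:R ^+ k :> rat.
Proof.
suff h : (`|rho k j| <= Crho ^ k)%N by rewrite -natr_absz -natrX ler_nat.
elim: k j => [|k IH] j /=; first by case: (j == ord0).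
apply: leq_trans (absz_tri _ _) _; rewrite abszM expnS /Crho mulnDl mul1n.
apply: leq_add; first by case: ifP.
rewrite mulnC; apply: leq_mul => //.
by rewrite (bigD1 j) //= leq_addr.
Qed.

Hypothesis indep : forall c : 'I_d -> int, \sum_j (c j)%:~R * beta ^+ j = 0 -> forall j, c j = 0.

(** If |beta| > 1, the monic equation would bound |beta|^d by |beta|^(d-1). *)
Lemma beta_le1 : ab beta <= 1.
Proof.
rewrite leNgt; apply/negP => b1; have abX k : ab (beta ^+ k) = ab beta ^+ k.
  by elim: k => [|k IH]; rewrite ?expr0 // !exprS abM IH.
have : ab (beta ^+ d) <= ab beta ^+ e.
  rewrite betaE; apply: (big_ind (fun x => ab x <= ab beta ^+ e)).
  - by rewrite ab0 exprn_ge0.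
  - by move=> x y hx hy; apply: le_trans (abU _ _) _; rewrite ge_max hx.
  - move=> j _; rewrite abM abX; apply: le_trans (_ : _ <= 1 * ab beta ^+ j) _.
      by rewrite ler_wpM2r ?exprn_ge0.
    by rewrite mul1r ler_weXn2l ?(ltW b1) //; exact: (leq_ord j).
rewrite abX exprS -ler_pdivlMr ?exprn_gt0 ?(lt_trans ltr01 b1) // divff ?expf_neq0 ?gt_eqF ?(lt_trans ltr01 b1) //.
by rewrite leNgt b1.
Qed.

Hypothesis e2 : (2 <= e)%N.

Arguments rho : simpl never.

Definition mulmat (y : 'I_3 -> int) : 'M[int]_d :=
  \matrix_(i, j) (y i0 * rho i j + y i1 * rho i.+1 j + y i2 * rho i.+2 j).

Lemma mulmatE y i : \sum_j (mulmat y i j)%:~R * beta ^+ j = conic_form beta y * beta ^+ i.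
Proof.
under eq_bigr do rewrite mxE !rmorphD !rmorphM /= !mulrDl -!mulrA.
rewrite !big_split /= -!mulr_sumr -!rhoE /conic_form !exprS expr0; ring.
Qed.

(** As e >= 2, the powers 1, beta, beta^2 belong to the independent family. *)
Lemma conic_form_neq0 y : (exists i, y i != 0) -> conic_form beta y != 0.
Proof.
case=> i; apply: contra_neq => h.
have o1 : (1 < d)%N by rewrite /d ltnS ltnW.
have o2 : (2 < d)%N by rewrite /d ltnS.
pose c (j : 'I_d) : int := nth 0 [:: y i0; y i1; y i2] j.
have [v0 v1 v2] : [/\ c ord0 = y i0, c (Ordinal o1) = y i1 & c (Ordinal o2) = y i2] by [].
have /indep cz : \sum_j (c j)%:~R * beta ^+ j = 0.
  rewrite (bigD1 ord0) // (bigD1 (Ordinal o1)) // (bigD1 (Ordinal o2)) // big1; last first.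
    move=> j /andP[/andP[n0 n1] n2]; rewrite /c nth_default ?mul0r //=.
    by move: n0 n1 n2; rewrite -!val_eqE /=; case: (nat_of_ord j) => [|[|[|]]].
  rewrite v0 v1 v2 -[RHS]h /conic_form /= expr0 expr1; ring.
move: i; apply: I3_case.
- by rewrite -v0 cz.
- by rewrite -v1 cz.
- by rewrite -v2 cz.
Qed.

Lemma mulmat_det y : (exists i, y i != 0) -> \det (mulmat y) != 0.
Proof.
move=> yn; apply/det0P => -[c cn cM].
have h : conic_form beta y * \sum_i (c ord0 i)%:~R * beta ^+ i = 0.
  transitivity (\sum_i (c ord0 i)%:~R * \sum_j (mulmat y i j)%:~R * beta ^+ j).
    by rewrite mulr_sumr; apply: eq_bigr => i _; rewrite mulmatE mulrCA.
  under eq_bigr do rewrite mulr_sumr.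
  rewrite exchange_big big1 // => j _ /=.
  transitivity (((c *m mulmat y) ord0 j)%:~R * beta ^+ j); last by rewrite cM mxE mul0r.
  rewrite mxE rmorph_sum /= mulr_suml; apply: eq_bigr => i _; by rewrite rmorphM /= mulrA.
move/eqP: h; rewrite mulf_eq0 (negbTE (conic_form_neq0 yn)) /= => /eqP /indep cz.
by case/eqP: cn; apply/rowP => j; rewrite mxE cz.
Qed.

Definition Cliou := (d`! * (3 * Crho ^ (e + 2)) ^ d)%N.

Lemma Crho_gt0 : (0 < Crho)%N. Proof. by rewrite /Crho. Qed.

(* The determinant of the multiplication by y . (1, beta, beta^2) is a nonzero integer
   divisible by that number. *)
Lemma liouville y : (exists i, y i != 0) -> 1 <= Cliou%:R * (supn y)%:R ^+ d * ab (conic_form beta y).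
Proof.
move=> yn; set D := \det (mulmat y); have D0 : D != 0 := mulmat_det yn.
have abD : ab D%:~R <= ab (conic_form beta y).
  (* The vector of the powers of beta is an eigenvector of [mulmat y], with eigenvalue the conic
     form. Multiplying by the first row of the adjugate exhibits D as this eigenvalue times an
     integer polynomial in beta, whose absolute value is at most 1. *)
  have -> : D%:~R = conic_form beta y * \sum_j (\adj (mulmat y) ord0 j)%:~R * beta ^+ j.
    have adjE k : \sum_j \adj (mulmat y) ord0 j * mulmat y j k = (D *+ (ord0 == k)).
      by have /matrixP/(_ ord0 k) := mul_adj_mx (mulmat y); rewrite !mxE.
    rewrite mulr_sumr.
    transitivity (\sum_j (\adj (mulmat y) ord0 j)%:~R * \sum_k (mulmat y j k)%:~R * beta ^+ k).
      under eq_bigr do rewrite mulr_sumr.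
      rewrite exchange_big /= (bigD1 ord0) //= [X in _ + X]big1 ?addr0 => [|k /negbTE nk].
        under eq_bigr do rewrite expr0 mulr1 -rmorphM.
        by rewrite -rmorph_sum adjE eqxx.
      under eq_bigr do rewrite mulrA -rmorphM.
      by rewrite -mulr_suml -rmorph_sum adjE eq_sym nk /= mul0r.
    by apply: eq_bigr => j _; rewrite mulmatE mulrCA.
  rewrite abM ler_piMr //; apply: (big_ind (fun x => ab x <= 1)).
  - by rewrite ab0.
  - by move=> u v hu hv; apply: le_trans (abU _ _) _; rewrite ge_max hu.
  - move=> j _; rewrite abM mulr_ile1 //.
    elim: (nat_of_ord j) => [|k IH]; first by rewrite expr0 ab1.
    by rewrite exprS abM mulr_ile1 // beta_le1.
have Db : (`|D| <= Cliou * supn y ^ d)%N.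
  have C0 := Crho_gt0.
  have Mb i j : (`|mulmat y i j| <= 3 * Crho ^ (e + 2) * supn y)%N.
    have rb k : (k <= e + 2)%N -> (`|rho k j| <= Crho ^ (e + 2))%N.
      move=> ke; have := rhoC k j; rewrite -natr_absz -natrX ler_nat => /leq_trans; apply.
      by rewrite leq_pexp2l.
    have ie : (i <= e)%N := leq_ord i.
    rewrite mxE; apply: leq_trans (absz_tri _ _) _; rewrite -mulnA !mulSn mul0n addn0 addnA.
    apply: leq_add; last by rewrite abszM mulnC leq_mul ?supn_ge ?rb //; lia.
    apply: leq_trans (absz_tri _ _) _; apply: leq_add; rewrite abszM mulnC leq_mul ?supn_ge ?rb //; lia.
  rewrite /Cliou -mulnA -expnMn.
  have -> : d`! = (\sum_(s : 'S_d) 1)%N by rewrite sum1_card card_Sn.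
  rewrite big_distrl /=.
  have tri (I : finType) (G : I -> int) : (`|(\sum_i G i)%R| <= \sum_i `|G i|)%N.
    by elim/big_rec2: _ => // i a b _ h; apply: leq_trans (absz_tri _ _) _; rewrite leq_add2l.
  apply: leq_trans (tri _ _) _; apply: leq_sum => s _.
  rewrite abszM abszX exp1n ?mul1n.
  have -> : `|(\prod_i mulmat y i (s i))%R|%N = (\prod_i `|mulmat y i (s i)|)%N.
    by elim/big_rec2: _ => // i a b _ <-; rewrite abszM.
  apply: leq_trans (_ : \prod_(i < d) (3 * Crho ^ (e + 2) * supn y) <= _)%N.
    by apply: leq_prod => i _; exact: Mb.
  by rewrite prod_nat_const card_ord.
apply: le_trans (ab_prod D0) _; apply: ler_pM => //.
by rewrite -natr_absz -natrX -natrM ler_nat.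
Qed.
End Liouville.

(** With a the leading coefficient of an integral multiple of P, a alpha is a root of a monic
    integer polynomial. The minimality of the degree gives the independence of its powers. *)
Lemma alg_data (K : fieldType) (f : {rmorphism rat -> K}) (alpha : K) (P : {poly rat}) (e : nat) :
  size P = e.+2 -> root (map_poly f P) alpha ->
  (forall Q : {poly rat}, (size Q <= e.+1)%N -> root (map_poly f Q) alpha -> Q = 0) ->
  exists2 a : int, a != 0 & exists cc : 'I_e.+1 -> int,
   (a%:~R * alpha) ^+ e.+1 = \sum_(j < e.+1) (cc j)%:~R * (a%:~R * alpha) ^+ j /\
   forall c : 'I_e.+1 -> int, \sum_j (c j)%:~R * (a%:~R * alpha) ^+ j = 0 -> forall j, c j = 0.
Proof.
move=> sP rP min; have [q [b b0 PE]] := rat_poly_scale P.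
have bR : (b%:~R : rat) != 0 by rewrite intr_eq0.
have qE : map_poly intr q = b%:~R *: P by rewrite PE scalerA divff // scale1r.
have szq : size q = e.+2.
  by rewrite -sP -(size_scale _ bR) -qE size_map_inj_poly //; exact: intr_inj.
have fE (Q : {poly int}) : map_poly f (map_poly intr Q) = map_poly intr Q.
  by rewrite -map_poly_comp; apply: eq_map_poly => z /=; rewrite rmorph_int.
have rq : (map_poly (intr : int -> K) q).[alpha] = 0.
  by apply/eqP; rewrite -[_ == 0]/(root _ _) -fE qE map_polyZ rootZ ?fmorph_eq0.
have fz (z : int) : f z%:~R = z%:~R :> K by exact: rmorph_int.
pose a := lead_coef q; have a0 : a != 0 by rewrite lead_coef_eq0 -size_poly_gt0 szq.
have aE : q`_e.+1 = a by rewrite /a lead_coefE szq.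
exists a => //; exists (fun j => - q`_j * a ^+ (e - j)); split.
  move: rq; rewrite (@horner_coef_wide _ e.+2) -?szq ?size_poly // szq big_ord_recr /= coef_map_id0 // aE addrC.
  move/eqP; rewrite addr_eq0 => /eqP h; rewrite exprMn exprSr -mulrA h mulrN mulr_sumr -sumrN.
  apply: eq_bigr => j _; rewrite coef_map_id0 // exprMn !(rmorphM, rmorphN, rmorphXn) /=.
  rewrite -{1}(subnK (leq_ord j : (j <= e)%N)) exprD; ring.
move=> c h j; pose Q : {poly rat} := \poly_(i < e.+1) (c (inord i) * a ^+ i)%:~R.
have Q0 : Q = 0.
  apply: min; first exact: size_poly.
  apply/eqP; rewrite (@horner_coef_wide _ e.+1); last first.
    by apply: leq_trans (size_poly _ _) _; exact: size_poly.
  rewrite -[RHS]h; apply: eq_bigr => i _; rewrite coef_map /= coef_poly ltn_ord inord_val. rewrite fz.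
  by rewrite exprMn rmorphM rmorphXn /= mulrA.
have : Q`_j = 0 by rewrite Q0 coef0.
rewrite coef_poly ltn_ord inord_val => /eqP; rewrite intr_eq0 mulf_eq0 expf_eq0 (negbTE a0) andbF orbF.
by move/eqP.
Qed.

(** * p-adic continued fractions *)

Section Padic.
Variables (p : nat) (p_pr : prime p).
Notation pa := (padic_abs p).
Let p0 : (p%:R : rat) != 0. Proof. by rewrite pnatr_eq0 -lt0n prime_gt0. Qed.
Let pg : (0 : rat) < p%:R. Proof. by rewrite ltr0n prime_gt0. Qed.

Lemma padic_abs_int_le1 (z : int) : pa z%:~R <= 1.
Proof.
have [->|z0] := eqVneq z 0; first by rewrite padic_abs0.
by rewrite padic_abs_int // invf_le1 ?exprn_gt0 // exprn_ege1 // ler1n prime_gt0.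
Qed.

Lemma padic_abs_p : pa p%:R = p%:R^-1.
Proof.
have pn : (p%:Z : int) != 0 by rewrite -lt0n prime_gt0.
have := padic_abs_int p pn; rewrite /= => ->.
by rewrite (logn_prime p p_pr) eqxx expr1.
Qed.

Lemma padic_absX x n : pa (x ^+ n) = pa x ^+ n.
Proof. by elim: n => [|n IH]; rewrite ?expr0 ?padic_abs1 // !exprS padic_absM // IH. Qed.

Lemma padic_product (z : int) : z != 0 -> 1 <= `|z|%:~R * pa z%:~R.
Proof.
move=> z0; rewrite padic_abs_int // ler_pdivlMr ?exprn_gt0 // mul1r -natr_absz -natrX ler_nat.
by apply: dvdn_leq; rewrite ?absz_gt0 // pfactor_dvdnn.
Qed.

Lemma padic_abs_gt1 q : 1 < pa q -> exists k, pa q = p%:R ^+ k.+1.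
Proof.
rewrite /padic_abs; case: ifP => [_|_]; first by rewrite ltr10.
case: (- padic_val p q) => [[|k]|k]; first by rewrite expr0z ltxx.
  by exists k.
rewrite NegzE -exprnN ltNge invf_le1 ?exprn_gt0 // exprn_ege1 //.
by rewrite ler1n prime_gt0.
Qed.

Definition Zinvp (q : rat) := exists k (z : int), q = z%:~R / p%:R ^+ k.

Lemma ZinvpD x y : Zinvp x -> Zinvp y -> Zinvp (x + y).
Proof.
move=> [k [z ->]] [l [w ->]]; exists (k + l)%N, (z * p%:Z ^+ l + w * p%:Z ^+ k).
rewrite rmorphD !rmorphM !rmorphXn /= exprD; field; by rewrite !expf_neq0.
Qed.

Lemma ZinvpM x y : Zinvp x -> Zinvp y -> Zinvp (x * y).
Proof.
move=> [k [z ->]] [l [w ->]]; exists (k + l)%N, (z * w).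
rewrite rmorphM /= exprD; field; by rewrite !expf_neq0.
Qed.

Lemma Zinvp_int (z : int) : Zinvp z%:~R.
Proof. by exists 0%N, z; rewrite expr0 divr1. Qed.

Lemma Zinvp_integral q k : Zinvp q -> pa q <= p%:R ^+ k -> exists z : int, q * p%:R ^+ k = z%:~R.
Proof.
move=> [m [z ->]]; have [le _|lt] := leqP m k.
  exists (z * p%:Z ^+ (k - m)); rewrite rmorphM rmorphXn /= -{1}(subnK le) exprD; field.
  by rewrite expf_neq0.
have [->|z0] := eqVneq z 0; first by exists 0; rewrite !mul0r.
rewrite padic_absM // padic_absV // padic_absX padic_abs_p exprVn invrK padic_abs_int //.
rewrite ler_pdivrMl ?exprn_gt0 // -exprD => h.
have {h} h : (m <= logn p `|z| + k)%N by move: h; rewrite ler_eXn2l // ltr1n prime_gt1.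
have : (p ^ (m - k) %| `|z|)%N by rewrite pfactor_dvdn ?absz_gt0 //; lia.
rewrite -[(p ^ _)%N]/(`|(p ^ (m - k))%N%:Z|%N) -dvdzE => /dvdzP[w ->]; exists w.
rewrite -{2}(subnK (ltnW lt)) exprD rmorphM /= -natrX /=.
have e : ((p ^ (m - k))%N%:R : rat) = p%:R ^+ (m - k) by rewrite natrX.
by rewrite -[((p ^ (m - k))%N : int)%:~R]/((p ^ (m - k))%N%:R : rat) e; field; rewrite !expf_neq0.
Qed.
End Padic.

Section CF.
Variables (p : nat) (p_pr : prime p) (k : cf_kind).
Notation pa := (padic_abs p).
Notation ab := (@Qp_abs p p_pr).
Notation io := (Qp_of_rat p_pr).
Let p0 : (p%:R : rat) != 0. Proof. by rewrite pnatr_eq0 -lt0n prime_gt0. Qed.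
Let pg : (0 : rat) < p%:R. Proof. by rewrite ltr0n prime_gt0. Qed.
Let pg1 : (1 : rat) < p%:R. Proof. by rewrite ltr1n prime_gt1. Qed.

Lemma ab_io q : ab (io q) = pa q.
Proof. by rewrite -Qp_ratrE Qp_abs_ratr. Qed.

(** The difference is a sum of digits at positive powers of p. Both kinds of expansion are treated
    together through these two facts. *)
Lemma s_close (beta : Qp p_pr) q : padic_s k beta q -> ab (beta - io q) < 1 /\ Zinvp p q.
Proof.
case=> r [a [[_ cv] ->]]; set n0 := if _ then _ else _.
have n0P (j : nat) : (n0 <= j)%N -> exists m, r + j%:Z = m.+1%:Z.
  rewrite /n0; case: ifP => h hj; exists `|(r + j%:Z - 1)%R|%N; lia.
split; last first.
  rewrite /digit_sum; apply: (big_ind (Zinvp p)) => [||i _].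
  - exact: (Zinvp_int p 0).
  - exact: ZinvpD.
  - apply: ZinvpM => //; first exact: Zinvp_int.
    case: (r + i%:Z) => m; first by exists 0%N, (p%:Z ^+ m); rewrite expr0 divr1 rmorphXn.
    by exists m.+1, 1; rewrite NegzE -exprnN mul1r.
have [N cN] := cv 1 ltr01; pose n := maxn N n0.
have ioD m : digit_sum (Qp p_pr) p a r m = io (digit_sum rat p a r m).
  rewrite /digit_sum rmorph_sum; apply: eq_bigr => j _.
  by rewrite rmorphM /= rmorph_int fmorphXz rmorph_nat.
rewrite -(subrKA (digit_sum (Qp p_pr) p a r n)).
apply: le_lt_trans (Qp_absD _ _) _; rewrite gt_max Qp_absB cN ?leq_maxl //=.
rewrite ioD -rmorphB ab_io /= /digit_sum.
have le : (n0 <= n)%N := leq_maxr _ _.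
pose G j : rat := (a (r + j%:Z))%:~R * p%:R ^ (r + j%:Z).
rewrite -(big_mkord xpredT G) -(big_mkord xpredT G) (big_cat_nat (leq0n n0) le) //= addrAC subrr add0r.
rewrite big_nat; apply: (big_ind (fun x => pa x < 1)).
- by rewrite padic_abs0.
- by move=> x y; exact: padic_absD_lt.
- move=> j /andP[hj _]; have [m mE] := n0P j hj; rewrite /G mE -exprnP.
  rewrite padic_absM // (le_lt_trans (ler_wpM2r (padic_abs_ge0 _ _) (padic_abs_int_le1 p_pr _))) //.
  rewrite mul1r padic_absX // padic_abs_p // exprVn invf_lt1 ?exprn_gt0 // exprn_egt1 //.
Qed.

Variables (alpha : Qp p_pr) (b : nat -> rat).
Hypothesis b_cf : infinite_cf k alpha b.
Hypothesis b0 : b 0%N = 0.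
Notation A := (cf_num b).
Notation B := (cf_den b).

Lemma cf_den0 : B 0 = 1. Proof. by rewrite /cf_den /= mulr0 add0r. Qed.
Lemma cf_den1 : B 1 = b 1%N. Proof. by rewrite /cf_den /= b0 mul0r add0r mulr1 addr0. Qed.
Lemma cf_denS n : B n.+2 = b n.+2 * B n.+1 + B n.
Proof. by rewrite /cf_den /=; case: (continuants b _ n) => x y. Qed.
Lemma cf_num0 : A 0 = 0. Proof. by rewrite /cf_num /= b0 mul0r add0r. Qed.
Lemma cf_num1 : A 1 = 1. Proof. by rewrite /cf_num /= b0 mul0r !add0r mulr0 add0r. Qed.
Lemma cf_numS n : A n.+2 = b n.+2 * A n.+1 + A n.
Proof. by rewrite /cf_num /=; case: (continuants b _ n) => x y. Qed.

Lemma cf_facts : exists al : nat -> Qp p_pr,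
  [/\ al 0%N = alpha, forall i, al i - io (b i) != 0, forall i, ab (al i - io (b i)) < 1,
      forall i, Zinvp p (b i) & forall i, al i.+1 = (al i - io (b i))^-1].
Proof.
have [al [a0 s ne rec]] := b_cf; exists al; split=> //.
- by move=> i; rewrite subr_eq0 -Qp_ratrE.
- by move=> i; have [] := s_close (s i).
- by move=> i; have [] := s_close (s i).
- by move=> i; rewrite -Qp_ratrE.
Qed.

Lemma abV x : ab x^-1 = (ab x)^-1.
Proof.
have [->|x0] := eqVneq x 0; first by rewrite invr0 Qp_abs0 invr0.
have ax : ab x != 0 by rewrite Qp_abs_eq0.
apply: (mulfI ax); rewrite divff // -Qp_absM divff //.
by rewrite -(rmorph1 io) ab_io padic_abs1.
Qed.

Lemma ab_dom x y : ab y < ab x -> ab (x + y) = ab x.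
Proof.
move=> lt; apply/eqP; rewrite eq_le; apply/andP; split.
  by apply: le_trans (Qp_absD _ _) _; rewrite ge_max lexx ltW.
have := Qp_absD (x + y) (- y); rewrite addrK -[- y]sub0r Qp_absB subr0 le_max => /orP[//|h].
by rewrite leNgt lt in h.
Qed.

Lemma pa_dom x y : pa y < pa x -> pa (x + y) = pa x.
Proof. by rewrite -!ab_io rmorphD; exact: ab_dom. Qed.

Lemma b_big i : exists m, pa (b i.+1) = p%:R ^+ m.+1.
Proof.
have [al [_ ne lt _ rec]] := cf_facts; apply: padic_abs_gt1 => //.
have big : 1 < ab (al i.+1).
  by rewrite rec abV invf_gt1 ?lt // lt_def Qp_abs_ge0 Qp_abs_eq0 ne.
rewrite -ab_io -(subKr (al i.+1) (io _)) ab_dom //.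
by rewrite -[- _]sub0r Qp_absB subr0; apply: lt_trans (lt _) big.
Qed.

Lemma al_abs (al : nat -> Qp p_pr) : (forall i, ab (al i - io (b i)) < 1) -> forall i, ab (al i.+1) = pa (b i.+1).
Proof.
move=> lt i; have [m mE] := b_big i.
rewrite -(subrK (io (b i.+1)) (al i.+1)) addrC ab_dom ab_io // mE.
by apply: lt_le_trans (lt _) _; rewrite exprn_ege1 // ltW.
Qed.

(** Since |b_i|_p > 1 for i >= 1, the product b_n B_(n-1) dominates the recurrence, and |B_n|_p is
    the product of the |b_i|_p. The exponents increase strictly, whence n <= e n. *)
Lemma cf_den_abs : exists e : nat -> nat, forall n, [/\ pa (B n) = p%:R ^+ e n, (n <= e n)%N & (e n < e n.+1)%N].
Proof.
have [f fE] := choice b_big.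
pose e n := (\sum_(i < n) (f i).+1)%N.
have eS n : e n.+1 = (e n + (f n).+1)%N by rewrite /e big_ord_recr.
have h n : pa (B n) = p%:R ^+ e n /\ pa (B n.+1) = p%:R ^+ e n.+1.
  elim: n => [|n [h1 h2]].
    by rewrite cf_den0 cf_den1 fE /e big_ord0 big_ord_recl big_ord0 addn0 expr0 padic_abs1.
  have lt : pa (B n) < pa (b n.+2 * B n.+1).
    by rewrite padic_absM // fE h2 h1 -exprD ltr_eXn2l // eS; lia.
  by split=> //; rewrite cf_denS pa_dom // padic_absM // fE h2 -exprD (eS n.+1) addnC.
exists e => n; have [h1 _] := h n; split=> //; last by rewrite eS; lia.
by rewrite /e -{1}[n]card_ord -sum1_card; apply: leq_sum.
Qed.

Lemma cf_num_abs_le n : pa (A n) <= pa (B n).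
Proof.
have [e eE] := cf_den_abs.
suff [] : pa (A n) <= pa (B n) /\ pa (A n.+1) <= pa (B n.+1) by [].
elim: n => [|n [h1 h2]].
  rewrite cf_num0 cf_num1 padic_abs0 padic_abs1 padic_abs_ge0; split=> //.
  by have [-> _ _] := eE 1%N; rewrite exprn_ege1 // ltW.
split=> //; rewrite cf_numS; apply: le_trans (padic_absD _ _ _) _ => //.
have [eB _ lt] := eE n; have [eB1 _ lt1] := eE n.+1; have [eB2 _ _] := eE n.+2.
have -> : pa (B n.+2) = pa (b n.+2) * pa (B n.+1).
  rewrite cf_denS pa_dom padic_absM // eB eB1.
  have [m ->] := b_big n.+1; rewrite -exprD ltr_eXn2l //; lia.
rewrite ge_max padic_absM // ler_wpM2l ?padic_abs_ge0 //=.
apply: le_trans h1 _; rewrite eB eB1; have [m ->] := b_big n.+1.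
by rewrite -exprD ler_eXn2l //; lia.
Qed.

Lemma cf_Zinvp n : Zinvp p (A n) /\ Zinvp p (B n).
Proof.
have [_ [_ _ _ bz _]] := cf_facts.
suff [] : (Zinvp p (A n) /\ Zinvp p (B n)) /\ (Zinvp p (A n.+1) /\ Zinvp p (B n.+1)) by [].
elim: n => [|n [[h1 h2] [h3 h4]]].
  have z0 : Zinvp p 0 by exists 0%N, 0; rewrite mul0r.
  have z1 : Zinvp p 1 by exists 0%N, 1; rewrite divr1.
  rewrite cf_num0 cf_num1 cf_den0 cf_den1. by split; split.
by split=> //; rewrite cf_numS cf_denS; split; apply: ZinvpD => //; exact: ZinvpM.
Qed.

Definition theta n : Qp p_pr := alpha * io (B n) - io (A n).

(** Two consecutive errors satisfy theta_(n+1) = - theta_n / alpha_(n+2), and a complete quotient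
    has the absolute value of its partial quotient. *)
Lemma theta_abs n : ab (theta n) = (pa (B n.+1))^-1.
Proof.
have [al [a0 ne lt _ rec]] := cf_facts; have aE := al_abs lt.
have al0 i : al i.+1 != 0 by rewrite rec invr_eq0.
have th i : theta i.+1 = - (theta i / al i.+2).
  elim: i => [|i IH]; rewrite /theta.
    rewrite cf_num0 cf_num1 cf_den0 cf_den1 [al 2%N]rec invrK rmorph1 rmorph0 subr0 mulr1.
    have az : alpha != 0 by have := ne 0%N; rewrite a0 b0 rmorph0 subr0.
    have e : al 1%N * alpha = 1 by rewrite rec a0 b0 rmorph0 subr0 mulVf.
    by rewrite mulrBr -[alpha * al 1%N]mulrC e opprB.
  rewrite cf_numS cf_denS !rmorphD !rmorphM /=.
  transitivity (io (b i.+2) * theta i.+1 + theta i); first by rewrite /theta; ring.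
  have -> : theta i = - (al i.+2 * theta i.+1) by rewrite IH mulrN opprK mulrC divfK.
  by rewrite [al i.+3]rec invrK -/(theta i.+1); ring.
elim: n => [|n IH].
  rewrite /theta cf_num0 cf_den0 rmorph0 rmorph1 mulr1 subr0 cf_den1 -(al_abs lt) rec a0 b0 rmorph0 subr0 abV invrK //.
have [e eE] := cf_den_abs.
have lt2 : pa (B n) < pa (b n.+2 * B n.+1).
  rewrite padic_absM //; have [-> _ lt1] := eE n; have [-> _ _] := eE n.+1.
  by have [m ->] := b_big n.+1; rewrite -exprD ltr_eXn2l //; lia.
rewrite th -[- _]sub0r Qp_absB subr0 Qp_absM IH abV aE cf_denS pa_dom // padic_absM //.
by rewrite [in RHS]invfM mulrC.
Qed.

Lemma alpha_le1 : ab alpha <= 1.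
Proof.
have [al [a0 _ lt _ _]] := cf_facts.
by have := lt 0%N; rewrite b0 rmorph0 subr0 a0 => /ltW.
Qed.

Definition cfmx (i : nat) : 'M[rat]_2 :=
  \matrix_(u, v) if (u == 0) && (v == 0) then b i.+1 else (u != v)%:R.

Lemma cfmxE n : let M := \prod_(i < n.+1) cfmx i in
  [/\ M 0 0 = B n.+1, M 0 1 = B n, M 1 0 = A n.+1 & M 1 1 = A n].
Proof.
elim: n => [|n [h1 h2 h3 h4]] /=.
  by rewrite big_ord_recl big_ord0 mulr1 !mxE /= cf_num0 cf_num1 cf_den0 cf_den1.
rewrite big_ord_recr /= -/(\prod_(i < n.+1) cfmx i).
have sum2 (f : 'I_2 -> rat) : \sum_j f j = f 0 + f 1.
  by rewrite !big_ord_recl big_ord0 addr0; congr (f _ + f _); exact: val_inj.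
by split; rewrite mxE sum2 [cfmx n.+1 0 _]mxE [cfmx n.+1 1 _]mxE /= ?h1 ?h2 ?h3 ?h4 ?cf_denS ?cf_numS ?mulr1 ?mulr0 ?addr0 //;
  rewrite mulrC.
Qed.

Lemma trmx_prod (F : nat -> 'M[rat]_2) n : (\prod_(i < n) F i)^T = \prod_(i < n) (F (n.-1 - i)%N)^T.
Proof.
elim: n => [|n IH]; first by rewrite !big_ord0 trmx1.
rewrite big_ord_recr big_ord_recl /= -[_ * _]/(_ *m _) trmx_mul IH subn0; congr (_ *m _).
by apply: eq_bigr => i _; congr ((F _)^T); rewrite /bump /=; have := ltn_ord i; lia.
Qed.

(* A product of symmetric matrices read along a palindrome is symmetric. *)
Lemma palindrome_sym n : palindromic_prefix b n.+1 -> A n.+1 = B n.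
Proof.
move=> pal; have [_ h2 h3 _] := cfmxE n; rewrite -h2 -h3.
suff e : (\prod_(i < n.+1) cfmx i)^T = \prod_(i < n.+1) cfmx i by rewrite -[in LHS]e mxE.
rewrite trmx_prod; apply: eq_bigr => i _.
have i_lt := ltn_ord i.
have -> : cfmx (n.+1.-1 - i)%N = cfmx i.
  apply/matrixP => u v; rewrite !mxE; case: ifP => // _.
  by rewrite (pal i.+1) ?ltnS //; congr (b _); lia.
by apply/matrixP => u v; rewrite !mxE andbC [v == u]eq_sym.
Qed.
End CF.

(** * Integer points from palindromes, and the conclusion *)

Lemma growth_rat (R : realType) (q : rat) (n p : nat) : (0 < n)%N ->
  `|ratr q : R| `^ (n%:R^-1) < p%:R `^ (4%:R^-1) -> `|q| ^+ 4 < p%:R ^+ n.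
Proof.
move=> n0 h; have n0' : (n%:R : R) != 0 by rewrite pnatr_eq0 -lt0n.
rewrite -(ltr_rat R) !rmorphXn /= ratr_norm ratr_nat.
have e1 : (`|ratr q : R| `^ (n%:R^-1)) ^+ n = `|ratr q|.
  rewrite -powR_mulrn ?powR_ge0 // -powRrM. by rewrite mulVf // powRr1.
have e2 : ((p%:R : R) `^ (4%:R^-1)) ^+ 4 = p%:R.
  rewrite -powR_mulrn ?powR_ge0 // -powRrM mulVf ?pnatr_eq0 // powRr1 //; exact: ler0n.
rewrite -[in X in X < _]e1 -[in X in _ < X]e2 -!exprM mulnC.
rewrite ltrXn2r ?nnegrE ?powR_ge0 //. by rewrite -lt0n muln_gt0.
Qed.

Section Final.
Variables (p : nat) (p_pr : prime p) (k : cf_kind) (alpha : Qp p_pr) (b : nat -> rat).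
Hypothesis b_cf : infinite_cf k alpha b.
Hypothesis b0 : b 0%N = 0.
Variable N0 : nat.
Hypothesis growth : forall n, (N0 <= n)%N ->
  `|cf_num b n| ^+ 4 < p%:R ^+ n /\ `|cf_den b n| ^+ 4 < p%:R ^+ n :> rat.
Notation pa := (padic_abs p).
Notation ab := (@Qp_abs p p_pr).
Notation io := (Qp_of_rat p_pr).
Notation A := (cf_num b).
Notation B := (cf_den b).
Let p0 : (p%:R : rat) != 0. Proof. by rewrite pnatr_eq0 -lt0n prime_gt0. Qed.
Let pg : (0 : rat) < p%:R. Proof. by rewrite ltr0n prime_gt0. Qed.
Let pg1 : (1 : rat) < p%:R. Proof. by rewrite ltr1n prime_gt1. Qed.

Lemma ab_intQ (z : int) : ab z%:~R = pa z%:~R.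
Proof. by rewrite -(rmorph_int io) ab_io. Qed.

(** The fourth power is below p^(n + 4 e), and n <= e. *)
Lemma int_size (q : rat) (z : int) n e : (n <= e)%N -> `|q| ^+ 4 < p%:R ^+ n ->
  q * p%:R ^+ e = z%:~R -> (`|z| ^ 4 <= p ^ (5 * e))%N.
Proof.
move=> ne h zE; rewrite -(ler_nat rat) !natrX natr_absz intr_norm -zE normrM.
rewrite [`|p%:R ^+ e|]ger0_norm ?exprn_ge0 // exprMn -exprM.
have -> : (5 * e = e + e * 4)%N by lia.
rewrite exprD ler_wpM2r ?exprn_ge0 // (le_trans (ltW h)) // ler_weXn2l // ltW //.
Qed.

Lemma int_facts n : (N0 <= n)%N -> exists e (zB zA : int),
  [/\ pa (B n) = p%:R ^+ e /\ (n <= e)%N, B n * p%:R ^+ e = zB%:~R, A n * p%:R ^+ e = zA%:~R,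
    (`|zB| ^ 4 <= p ^ (5 * e))%N & (`|zA| ^ 4 <= p ^ (5 * e))%N].
Proof.
move=> n0; have [e eE] := cf_den_abs b_cf b0; have [eB ne _] := eE n; have [gA gB] := growth n0.
have [zA' zB'] := cf_Zinvp b_cf b0 n.
have [zB zBE] : exists z : int, B n * p%:R ^+ e n = z%:~R by apply: (Zinvp_integral p_pr zB'); rewrite eB.
have [zA zAE] : exists z : int, A n * p%:R ^+ e n = z%:~R.
  by apply: (Zinvp_integral p_pr zA'); rewrite -eB (cf_num_abs_le b_cf b0).
by exists (e n), zB, zA; split=> //; [exact: int_size ne gB zBE|exact: int_size ne gA zAE].
Qed.

(** If alpha = u / v, the integer u zB - v zA is nonzero because no error theta vanishes, and p^(2
    e) divides it up to its unit part. Its real size is at most a constant times p^(5 e / 4), which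
    is too small for large e. *)
Lemma irrational q : alpha <> io q.
Proof.
move=> aq; pose u := numq q; pose v := denq q; pose c := (`|u| + `|v|)%N.
pose n := (N0 + c ^ 4)%N.
have [e [zB [zA [[eB ne] zBE zAE sB sA]]]] := int_facts (leq_addr (c ^ 4) N0 : (N0 <= n)%N).
have [e' eE] := cf_den_abs b_cf b0; have [eB' _ lt] := eE n; have [eB1 _ _] := eE n.+1.
have ee' : e' n = e.
  by move: eB'; rewrite eB => /(ieexprIn pg (negbT (gt_eqF pg1))).
have vR : (v%:~R : rat) != 0 by rewrite intr_eq0 denq_neq0.
pose t := q * B n - A n.
have pt : pa t = p%:R ^- e' n.+1.
  rewrite -eB1 -(theta_abs b_cf b0) -ab_io /theta aq /t rmorphB rmorphM; by [].
pose z := u * zB - v * zA.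
have zE : (z%:~R : rat) = v%:~R * p%:R ^+ e * t.
  rewrite /z rmorphB !rmorphM /= -zBE -zAE /t -[q]divq_num_den -/u -/v; field; exact: vR.
have z0 : z != 0.
  rewrite -(intr_eq0 rat) zE !mulf_neq0 ?expf_neq0 //.
  by rewrite -(padic_abs_eq0 p_pr) pt invr_eq0 expf_neq0.
have pz : pa z%:~R <= p%:R ^- (2 * e).
  rewrite zE !padic_absM // padic_absX // padic_abs_p // pt -mulrA -exprVn.
  apply: le_trans (ler_wpM2r _ (padic_abs_int_le1 p_pr v)) _.
    by rewrite mulr_ge0 ?exprn_ge0 // invr_ge0 ltW.
  rewrite mul1r -exprD exprVn lef_pV2 ?posrE ?exprn_gt0 // ler_weXn2l ?ltW //.
  by move: lt; rewrite ee'; lia.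
have pe2 : (p ^ (2 * e) <= `|z|)%N.
  rewrite -(ler_nat rat) natrX natr_absz -[leLHS]mul1r.
  apply: le_trans (ler_wpM2r _ (padic_product p_pr z0)) _; first by rewrite exprn_ge0.
  rewrite -mulrA ler_piMr ?ler0z // -ler_pdivlMr ?exprn_gt0 // mul1r.
  exact: pz.
have size3 : (`|z| ^ 4 <= c ^ 4 * p ^ (5 * e))%N.
  have mx : (`|z| <= c * maxn `|zB| `|zA|)%N.
    rewrite /z /c mulnDl; apply: leq_trans (absz_tri _ _) _; rewrite abszN !abszM.
    by apply: leq_add; rewrite leq_mul2l leq_max leqnn ?orbT.
  apply: leq_trans (_ : (c * maxn `|zB| `|zA|) ^ 4 <= _)%N; first by rewrite leq_exp2r.
  by rewrite expnMn leq_mul2l; case: (leqP `|zB| `|zA|) => _; rewrite ?sA ?sB orbT.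
have p8 : (p ^ (8 * e) <= c ^ 4 * p ^ (5 * e))%N.
  apply: leq_trans size3; rewrite (_ : 8 * e = 2 * e * 4)%N; last by lia.
  by rewrite expnM leq_exp2r.
have p1 : (0 < p)%N := prime_gt0 p_pr.
have p3 : (p ^ (3 * e) <= c ^ 4)%N.
  move: p8; rewrite (_ : 8 * e = 3 * e + 5 * e)%N; last by lia.
  by rewrite expnD leq_pmul2r // expn_gt0 p1.
have := ltn_expl (3 * e) (prime_gt1 p_pr); rewrite ltnNge => /negP; apply.
apply: leq_trans p3 (leq_trans (leq_addl N0 _) (leq_trans ne _)).
exact: leq_pmull.
Qed.

Hypothesis b_pal : forall N, exists n, (N <= n)%N /\ palindromic_prefix b n.

(** The modulus exponent is f = 2 e: the errors theta contribute p^(-e), and clearing the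
    denominators of the convergents contributes p^(-e) again. *)
Lemma cf_point (a : int) L : a != 0 -> let beta := a%:~R * alpha in
  exists f (x : 'I_3 -> int), [/\ (L <= f)%N, gcd3 x = 1%N, ab (x i0)%:~R = 1,
   ab (beta * (x i0)%:~R - (x i1)%:~R) * (p ^ f)%:R <= 1 /\
   ab (beta ^+ 2 * (x i0)%:~R - (x i2)%:~R) * (p ^ f)%:R <= 1 & (supn x ^ 100 <= (p ^ f) ^ 63)%N].
Proof.
(* The coordinates carry at most the factor a^2, hence a^8 in fourth powers. Then |x|^100 <= K^25
   p^(125 e), while F^63 = p^(126 e): one factor p^e is left to absorb K^25, so n is taken at least
   K^25. *)
move=> a0 beta; have [K KE] : exists K, K = (`|a| ^ 8)%N by exists (`|a| ^ 8)%N.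
have [K25 K25E] : exists K25, K25 = (K ^ 25)%N by exists (K ^ 25)%N.
have [[|n] []] := b_pal (N0 + K25 + L).+1 => //; rewrite ltnS => nL pal.
have [n0 nK nl] : [/\ N0 <= n, K25 <= n & L <= n]%N by move: nL; clear; move=> nL; split; lia.
have [e [zB [zA [[eB ne] zBE zAE sB sA]]]] := int_facts (leqW n0).
have [e' eE] := cf_den_abs b_cf b0; have [eB' _ lt] := eE n; have [eB1 _ lt1] := eE n.+1; have [eB2 _ _] := eE n.+2.
have ee : e' n.+1 = e.
  by move: eB1; rewrite eB => /(ieexprIn pg (negbT (gt_eqF pg1))).
have AB := palindrome_sym p_pr b0 pal.
have [zA' zA'E] : exists z : int, A n * p%:R ^+ e = z%:~R.
  apply: (Zinvp_integral p_pr (proj1 (cf_Zinvp b_cf b0 n))).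
  apply: le_trans (cf_num_abs_le b_cf b0 n) _; rewrite eB' ler_weXn2l ?ltW //.
  by rewrite -ee ltnW.
have sA' : (`|zA'| ^ 4 <= p ^ (5 * e))%N.
  have [gA _] := growth n0; apply: (int_size _ gA zA'E).
  exact: ltnW.
pose y := v3 zB (a * zA) (a ^+ 2 * zA').
have zB0 : pa zB%:~R = 1.
  rewrite -zBE padic_absM // eB padic_absX // padic_abs_p // -exprMn divff // expr1n //.
have y0 : y i0 != 0.
  rewrite /y /v3 /=; apply: contra_eq_neq zB0 => ->.
  by rewrite padic_abs0 eq_sym oner_eq0.
pose G := gcd3 y; have G0 : (0 < G)%N := gcd3_gt0 y0.
pose x i := (y i %/ G%:Z)%Z.
have yE i : y i = x i * G%:Z by rewrite /x divzK // dvdzE /= gcd3_dvd.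
(* zB is a p-adic unit because p^e is exactly |B|_p; both of its integral factors are then units, so
   dividing by the gcd changes no p-adic size. *)
have pGx : pa (G%:Z)%:~R = 1 /\ pa (x i0)%:~R = 1.
  have h : pa (x i0)%:~R * pa (G%:Z)%:~R = 1.
    by rewrite -padic_absM // -rmorphM -yE.
  have h1 := padic_abs_int_le1 p_pr (x i0); have h2 := padic_abs_int_le1 p_pr G%:Z.
  have g1 := padic_abs_ge0 p (x i0)%:~R; have g2 := padic_abs_ge0 p (G%:Z)%:~R.
  have e1 : 1 <= pa (G%:Z)%:~R by rewrite -[leLHS]h ler_piMl.
  have e2 : 1 <= pa (x i0)%:~R by rewrite -[leLHS]h ler_piMr.
  by split; apply/eqP; rewrite eq_le ?e1 ?e2 ?h1 ?h2.
have [pG px] := pGx.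
have gx : gcd3 x = 1%N.
  have : (gcd3 x * G = G)%N.
    by rewrite {2}/G /gcd3 !yE !abszM absz_nat !muln_gcdl.
  by rewrite -{2}[G]mul1n => /eqP; rewrite eqn_pmul2r // => /eqP.
have abG (h : Qp p_pr) i : ab (h * (x i0)%:~R - (x i)%:~R) = ab (h * (y i0)%:~R - (y i)%:~R).
  rewrite !yE !rmorphM /= mulrA -mulrBl Qp_absM.
  by rewrite -[X in _ * ab X]/((G%:Z)%:~R) ab_intQ pG mulr1.
pose F : rat := p%:R ^+ e.
have ioF : io F != 0 by rewrite fmorph_eq0 expf_neq0.
have abF : ab (io F) = F^-1 by rewrite ab_io /F padic_absX // padic_abs_p // exprVn.
have ioz (q : rat) (z : int) : q * F = z%:~R -> z%:~R = io q * io F.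
  by move=> h; rewrite -rmorphM h rmorph_int.
have th := theta_abs b_cf b0.
have F1 : 1 <= F by rewrite /F exprn_ege1 // ltW.
have Fg : 0 < F by exact: lt_le_trans F1.
have pf : ((p ^ (2 * e))%N%:R : rat) = F * F by rewrite natrX mul2n -addnn exprD.
have th1 : ab (theta alpha b n.+1) <= F^-1.
  rewrite th eB2 /F lef_pV2 ?posrE ?exprn_gt0 // ler_weXn2l ?(ltW pg1) // -ee; exact: ltnW.
have th0 : ab (theta alpha b n) <= F^-1 by rewrite th eB.
have aint (z : int) : ab z%:~R <= 1 by rewrite ab_intQ padic_abs_int_le1.
have fin (w : Qp p_pr) : ab w <= F^-1 -> ab (w * io F) * (F * F) <= 1.
  move=> h; rewrite Qp_absM abF; have -> : ab w * F^-1 * (F * F) = ab w * F.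
    by field; rewrite gt_eqF.
  by rewrite -ler_pdivlMr // mul1r.
have small (z : int) w : ab w <= F^-1 -> ab (z%:~R * w) <= F^-1.
  by move=> h; rewrite Qp_absM (le_trans _ h) // ler_piMl ?Qp_abs_ge0.
exists (2 * e)%N, x; split=> //.
- by rewrite (leq_trans nl) // (leq_trans (ltnW ne)) // leq_pmull.
- by rewrite ab_intQ.
- rewrite pf !abG /y /v3 /= !rmorphM ?rmorphXn /= (ioz _ _ zBE) (ioz _ _ zAE) (ioz _ _ zA'E); split.
    have -> : beta * (io (B n.+1) * io F) - a%:~R * (io (A n.+1) * io F) =
       a%:~R * theta alpha b n.+1 * io F by rewrite /beta /theta; ring.
    by apply: fin; exact: small.
  (* The palindrome gives B_n = A_(n+1), and so alpha^2 B_(n+1) - A_n = alpha theta_(n+1) +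
     theta_n. *)
  have -> : beta ^+ 2 * (io (B n.+1) * io F) - a%:~R * a%:~R * (io (A n) * io F) =
       (a ^+ 2)%:~R * (alpha * theta alpha b n.+1 + theta alpha b n) * io F.
    by rewrite /beta /theta -AB rmorphXn /=; ring.
  apply: fin; apply: small; apply: le_trans (Qp_absD _ _) _; rewrite ge_max th0 andbT.
  by rewrite Qp_absM (le_trans _ th1) // ler_piMl ?Qp_abs_ge0 // (alpha_le1 b_cf b0).
- have a1 : (0 < `|a|)%N by rewrite absz_gt0.
  have p1 : (0 < p)%N := prime_gt0 p_pr.
  have xb i : (`|x i| ^ 4 <= K * p ^ (5 * e))%N.
    apply: leq_trans (_ : `|y i| ^ 4 <= _)%N.
      by rewrite leq_exp2r // yE abszM absz_nat leq_pmulr.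
    rewrite KE; move: i; apply: I3_case; rewrite /y /v3 /=.
    + by apply: leq_trans sB _; rewrite leq_pmull // expn_gt0 a1.
    + rewrite abszM expnMn leq_mul // leq_pexp2l //.
    + by rewrite abszM abszX expnMn leq_mul // -expnM.
  have nb : (supn x ^ 4 <= K * p ^ (5 * e))%N by have [i <-] := supn_ex x.
  have -> : (supn x ^ 100 = (supn x ^ 4) ^ 25)%N by rewrite -expnM.
  apply: leq_trans (_ : (K * p ^ (5 * e)) ^ 25 <= _)%N; first by rewrite leq_exp2r.
  rewrite expnMn -K25E -!expnM.
  have -> : (2 * e * 63 = e + 5 * e * 25)%N by clear; lia.
  rewrite expnD leq_mul2r; apply/orP; right.
  apply: leq_trans (ltnW (ltn_expl e (prime_gt1 p_pr))).
  by rewrite (leq_trans nK) // ltnW.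
Qed.

Lemma not_high_degree (R : realType) (P : {poly rat}) (e : nat) : (2 <= e)%N ->
  size P = e.+2 -> root (map_poly io P) alpha ->
  (forall Q : {poly rat}, (size Q <= e.+1)%N -> root (map_poly io Q) alpha -> Q = 0) -> False.
Proof.
move=> e2 sP rP min; have [a a0 [cc [betaE indep]]] := alg_data sP rP min.
set beta := a%:~R * alpha in betaE indep.
have ab0 := Qp_abs0 p_pr; have ab_ge0 := @Qp_abs_ge0 p p_pr.
have abU := @Qp_absD p p_pr; have abM := @Qp_absM p p_pr.
have ab1 : ab 1 = 1 by rewrite -(rmorph1 io) ab_io padic_abs1.
have ab_int (z : int) : ab z%:~R <= 1 by rewrite ab_intQ padic_abs_int_le1.
have ab_prod (z : int) : z != 0 -> 1 <= `|z|%:~R * ab z%:~R.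
  by move=> z0; rewrite ab_intQ padic_product.
have abp : ab p%:R = p%:R^-1 by rewrite -(rmorph_nat io) ab_io padic_abs_p.
have C0 := Crho_gt0 cc; have rE := rhoE betaE; have rC := @rhoC e cc.
have beta1 := beta_le1 ab0 ab_ge0 abU abM ab1 ab_int betaE.
have liou := liouville ab0 ab_ge0 abU abM ab1 ab_int ab_prod betaE indep e2.
have CL0 : (0 < Cliou cc)%N by rewrite /Cliou muln_gt0 fact_gt0 !(expn_gt0, muln_gt0) C0.
have g0 : (0 < slope_exp e.+1)%N by rewrite /slope_exp addn2.
have EC i j := @pnrm_Ept (Crho cc) i j C0.
have ECT i j : pnrm (Crho cc) (Ept^T i j) <= (Crho cc)%:R ^+ 2 by rewrite mxE.
have t1E : (\sum_i wt_one i = 3 * 50 + 2)%N by exact: (sum3 (fun j => wt_one j)).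
have t2E : (\sum_i wt_two i = 3 * 50 + 2)%N by exact: (sum3 (fun j => wt_two j)).
have no1 := no_planes ab0 ab_ge0 abU abM ab1 ab_int ab_prod C0 rC rE beta1 Ept2 EC t1E g0.
have no2 := no_planes ab0 ab_ge0 abU abM ab1 ab_int ab_prod C0 rC rE beta1 Ept2T ECT t2E g0.
have bounded (Q : plane -> Prop) : ~ (forall B, exists2 X, Q X & (B <= pc X)%N) ->
    exists B, forall X, Q X -> (pc X < B)%N.
  move=> h; apply: contrapT => h'; apply: h => B; apply: contrapT => h2; apply: h'.
  by exists B => X QX; rewrite ltnNge; apply/negP => le; apply: h2; exists X.
have [B1 nB1] := bounded _ no1; have [B2 nB2] := bounded _ no2.
(* Both families of planes have bounded scales; a point with F large enough produces a plane of one
   of them beyond both bounds. *)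
pose M := maxn B1 B2.
have [L L0 hL] := lg_large (3 * lg R (Cliou cc) + e.+1%:R * ((50 * M%:R + 1000) * lg R 2) +
 100 * 100 * 100 * (lg R 2 + lg R p)).
have [f [x [Lf gx ax [L1 L2] X100]]] := cf_point L a0.
have big : (L <= p ^ f)%N by apply: leq_trans Lf (ltnW (ltn_expl f (prime_gt1 p_pr))).
have := planes_of_point ab0 ab_ge0 abU abM ab_int (prime_gt1 p_pr) abp ab1 beta1 CL0
  (ltn0Sn e) liou gx ax L1 L2 X100 (hL _ big).
case=> -[X gX MX].
- by have := nB1 X gX; rewrite ltnNge (leq_trans (leq_maxl _ _) MX).
- by have := nB2 X gX; rewrite ltnNge (leq_trans (leq_maxr _ _) MX).
Qed.

Lemma dichotomy (R : realType) : transcendental alpha \/ quadratic_irrational alpha.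
Proof.
have [h|h] := pselect (transcendental alpha); first by left.
have {h} [P0 P00 rP0] : algebraicOver (@ratr (Qp p_pr)) alpha by exact: contrapT.
right; have ioE (P : {poly rat}) : map_poly (@ratr (Qp p_pr)) P = map_poly io P.
  by apply: eq_map_poly => q; exact: Qp_ratrE.
pose S n := `[< exists P : {poly rat}, [/\ P != 0, size P = n & root (map_poly io P) alpha] >].
have exS : exists n, S n by exists (size P0); apply/asboolP; exists P0; rewrite -ioE.
case: (ex_minnP exS) => n /asboolP[P [Pn sP rP]] min.
have minQ (Q : {poly rat}) : (size Q < n)%N -> root (map_poly io Q) alpha -> Q = 0.
  move=> sQ rQ; apply: contraTeq sQ => Qn; rewrite -leqNgt; apply: min; apply/asboolP.
  by exists Q.
have irr q : alpha <> ratr q by rewrite Qp_ratrE; exact: irrational.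
have ev m : size P = m -> \sum_(i < m) io P`_i * alpha ^+ i = 0.
  move=> sPm.
  have h0 : (map_poly io P).[alpha] = 0 by exact/eqP.
  rewrite -[RHS]h0 (@horner_coef_wide _ m) -?sPm ?size_poly //.
  by apply: eq_bigr => i _; rewrite coef_map.
case: n sP min minQ => [|[|[|[|e]]]] sP min minQ; have {}ev := ev _ sP.
- by case/negP: Pn; rewrite -size_poly_eq0 sP.
- move: ev; rewrite big_ord_recl big_ord0 addr0 mulr1 => /eqP; rewrite fmorph_eq0 => /eqP h.
  by case/negP: Pn; rewrite -lead_coef_eq0 lead_coefE sP /= h.
- case: (irr (- (P`_0 / P`_1))).
  have P1 : P`_1 != 0 by have := Pn; rewrite -lead_coef_eq0 lead_coefE sP.
  move: ev; rewrite !big_ord_recl big_ord0 addr0 mulr1 /= expr1 => /eqP.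
  rewrite addrC addr_eq0 => /eqP h; rewrite Qp_ratrE rmorphN fmorph_div -mulNr -h mulrC mulKf //.
  by rewrite fmorph_eq0.
- split; first by exists P; [exact: sP | rewrite ioE; exact: rP].
  by move=> [q /irr].
- exfalso; apply: (@not_high_degree R P e.+2) => // Q sQ; exact: minQ.
Qed.
End Final.

Theorem theoremA (R : realType) (p : nat) (p_pr : prime p) (p_odd : odd p)
    (k : cf_kind) (alpha : Qp p_pr) (b : nat -> rat)
    (b_cf : infinite_cf k alpha b) (b0 : b 0%N = 0)
    (b_pal : forall N : nat,
       exists n : nat, (N <= n)%N /\ palindromic_prefix b n)
    (b_growth : exists N : nat, forall n : nat, (N <= n)%N ->
       Num.max (`|ratr (cf_num b n) : R| `^ (n%:R^-1))
               (`|ratr (cf_den b n) : R| `^ (n%:R^-1))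
         < p%:R `^ (4%:R^-1)) :
  transcendental alpha \/ quadratic_irrational alpha.
Proof.
have [N gN] := b_growth.
(* The shift to N + 1 keeps n positive, so that n-th roots can be raised back to the power n. *)
apply: (@dichotomy p p_pr k alpha b b_cf b0 N.+1 _ b_pal R) => n Nn.
have n0 : (0 < n)%N by exact: leq_trans Nn.
have := gN n (ltnW Nn); rewrite gt_max => /andP[gA gB].
by split; apply: (@growth_rat R).
Qed.
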